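(* Let $U\subset\mathbb{C}$ be a simply connected domain and let $\Phi\in\Sigma(U)$ be a piecewise analytic function, $\Phi=\sum_{i=1}^{r}A_i\chi_i$ a.e. in $U$, with data $(M_i,A_i)_{i=1}^r$ as in the context. Let $p\in U$ satisfy: (i) $p\in\overline{M_i}$ for all $1\le i\le r$; (ii) $A_i(p)-A_k(p)\notin\mathbb{R}\,(A_j(p)-A_k(p))$ for every triple $(i,j,k)$ of distinct indices in $\{1,\dots,r\}$; (iii) $A_i(p)\neq A_k(p)$ for every pair of distinct indices $i,k$. Then there exists a neighborhood $\widetilde N(p)$ of $p$ such that $\Phi=2\,\partial\varphi/\partial z$ a.e. in $\widetilde N(p)$, where $\varphi(z)=\max_{1\le i\le r}H_i(z)$ and $H_i(z)=\Re\int_p^z A_i(w)\,dw$.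
   Context: A function $\Phi\in L^1_{loc}(U)$ is called piecewise analytic with data $(M_i,A_i)_{i=1}^r$ if $M_1,\dots,M_r$ are pairwise disjoint open subsets of $U$ such that $U\setminus\bigcup_i M_i$ has Lebesgue measure zero, $A_1,\dots,A_r$ are pairwise distinct analytic functions on $U$, $\chi_i$ is the characteristic function of $M_i$, and $\Phi=\sum_{i=1}^r A_i\chi_i$ a.e. Derivatives are taken in the sense of distributions, $\partial/\partial z=\frac12(\partial_x-i\partial_y)$, $\partial/\partial\bar z=\frac12(\partial_x+i\partial_y)$. $\Sigma(U)$ denotes the set of distributions $f$ on $U$ with $\partial f/\partial\bar z\ge 0$ (i.e. $\partial f/\partial \bar z$ is a positive measure). For $p\in U$, $H_i(z)=\Re\int_p^z A_i(w)\,dw$ is a well-defined harmonic function on $U$. *)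

(* Defs.v *)
From HB Require Import structures.
From mathcomp Require Import all_boot all_order all_algebra.
From mathcomp Require Import all_classical all_reals all_analysis.
From mathcomp Require Import complex.
Set Implicit Arguments. Unset Strict Implicit. Unset Printing Implicit Defensive.
Import Order.TTheory GRing.Theory Num.Theory.
Import numFieldNormedType.Exports.
Local Open Scope classical_set_scope.
Local Open Scope ring_scope.
Local Open Scope complex_scope.

(* Equip R[i] with its canonical normed-module structure over itself (the
   numeric-field norm |z|), hence with the usual topology of the plane. *)
HB.instance Definition _ (R : rcfType) := NormedModule.copy R[i] (R[i]^o).

Section Defs.
Variable R : realType.
Local Notation C := (R[i]).

Definition toC (q : R * R) : C := q.1 +i* q.2.

Definition lam2 := ((@lebesgue_measure R) \x (@lebesgue_measure R))%E.

Definition cint (D : set C) (g : C -> C) : C :=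
  (Rintegral lam2 (toC @^-1` D) (fun q => complex.Re (g (toC q))))%:C
  + 'i * (Rintegral lam2 (toC @^-1` D) (fun q => complex.Im (g (toC q))))%:C.

Definition pdx (f : C -> R) : C -> R :=
  fun z => derive1 (fun t : R => f (z + t%:C)) 0.
Definition pdy (f : C -> R) : C -> R :=
  fun z => derive1 (fun t : R => f (z + Complex 0 t)) 0.

Fixpoint Cn (n : nat) (f : C -> R) : Prop :=
  continuous f /\
  match n with
  | 0 => True
  | n'.+1 =>
      (forall z, derivable (fun t : R => f (z + t%:C)) 0 1 /\
                 derivable (fun t : R => f (z + Complex 0 t)) 0 1) /\
      Cn n' (pdx f) /\ Cn n' (pdy f)
  end.

Definition smooth (f : C -> R) : Prop := forall n, Cn n f.

Definition support (f : C -> R) : set C := closure [set z | f z != 0].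

Definition test_fun (O : set C) (f : C -> R) : Prop :=
  smooth f /\ compact (support f) /\ support f `<=` O.

Definition dz (f : C -> R) (z : C) : C :=
  ((pdx f z)%:C - 'i * (pdy f z)%:C) / 2%:R.
Definition dzbar (f : C -> R) (z : C) : C :=
  ((pdx f z)%:C + 'i * (pdy f z)%:C) / 2%:R.

Definition loc_integrable (U : set C) (f : C -> C) : Prop :=
  forall K : set C, compact K -> K `<=` U ->
    lam2.-integrable (toC @^-1` K) (EFin \o (fun q => complex.Re (f (toC q)))) /\
    lam2.-integrable (toC @^-1` K) (EFin \o (fun q => complex.Im (f (toC q)))).

(* f in Sigma(U): the distribution dzbar f is positive, i.e.
   <dzbar f, psi> = - \int f dzbar psi is a nonnegative real number for every
   nonnegative test function psi (0 <= w in R[i] means w real and >= 0). *)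
Definition in_Sigma (U : set C) (f : C -> C) : Prop :=
  forall psi : C -> R, test_fun U psi -> (forall z, 0 <= psi z) ->
    0 <= - cint U (fun z => f z * dzbar psi z).

Definition domain (U : set C) : Prop := open U /\ connected U /\ U !=set0.

Definition I01 : set R := [set s | 0 <= s <= 1].

Definition simply_connected (U : set C) : Prop :=
  forall g : R -> C,
    {within I01, continuous g} ->
    (forall s, I01 s -> U (g s)) -> g 0 = g 1 ->
    exists H : R * R -> C,
      {within (I01 `*` I01), continuous H} /\
      (forall s t, I01 s -> I01 t -> U (H (s, t))) /\
      (forall s, I01 s -> H (s, 0) = g s /\ H (s, 1) = g 0) /\
      (forall t, I01 t -> H (0, t) = g 0 /\ H (1, t) = g 0).

Definition analytic_on (U : set C) (A : C -> C) : Prop :=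
  forall z, U z -> derivable A z 1.

Definition piecewise_analytic (U : set C) (Phi : C -> C) (r : nat)
    (M : 'I_r -> set C) (A : 'I_r -> C -> C) : Prop :=
  loc_integrable U Phi /\
  (forall i, open (M i) /\ M i `<=` U) /\
  (forall i j, i != j -> M i `&` M j = set0) /\
  lam2.-negligible (toC @^-1` (U `\` \bigcup_i M i)) /\
  (forall i, analytic_on U (A i)) /\
  (forall i j, i != j -> exists z, U z /\ A i z != A j z) /\
  {ae lam2, forall q, U (toC q) ->
     Phi (toC q) = \sum_(i < r) A i (toC q) * \1_(M i) (toC q)}.

Definition maxfam (r : nat) : ('I_r -> R) -> R :=
  match r return ('I_r -> R) -> R with
  | 0 => fun _ => 0
  | n.+1 => fun h => \big[Num.max/h ord0]_(i < n.+1) h i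
  end.

Definition phimax (r : nat) (H : 'I_r -> C -> R) (z : C) : R :=
  maxfam (fun i => H i z).

End Defs.

(* Main.v *)
Require Import Defs.
From HB Require Import structures.
From mathcomp Require Import all_boot all_order all_algebra.
From mathcomp Require Import all_classical all_reals all_analysis.
From mathcomp Require Import complex measurable_realfun ring lra.
Set Implicit Arguments. Unset Strict Implicit. Unset Printing Implicit Defensive.
Import Order.TTheory GRing.Theory Num.Theory.
Import numFieldNormedType.Exports.
Local Open Scope classical_set_scope.
Local Open Scope ring_scope.

(** Write [A_i = al_i + i be_i] and [F_i = H_i + i G_i].  Near [p] the imaginary part of the
    condition [Phi \in Sigma(U)] makes the mollified field [Phi_e] equal to [2 d(psi_e)/dz] for a
    real potential [psi_e], and the real part makes [psi_e] subharmonic.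

    The heart of the proof is a comparison principle: if [z0] lies in [M_j], then
    [u = psi_e - (H_j)_e] cannot drop by a fixed amount between [z0] and another point [z1] near
    [p], once [e] is small.  Choose [k] such that [A_k - A_j] is as orthogonal as possible to the
    direction [z1 - z0]; by (ii) the other differences [A_l - A_j] are then uniformly transversal
    to it.  Put [W = F_k - F_j] and use the conformal coordinate
    [X + i Y = conj (W(z1) - W(z0)) (W_e - W_e(z0))].  For a small generic slope [s], the function
    [v = u + s X - (penalties in X and Y)] is positive near [z0] and negative on the boundary of
    a square, its Laplacian is bounded below, and where it is positive its gradient is bounded
    below off a set whose measure tends to [0] with [e].  Testing the Laplacian of [v] against a
    large power of the positive part of [v] is then contradictory.

    Applying the principle in both directions between points of [M_i] and [M_j], and letting the
    former tend to [p], which is possible by (i), gives [H_i <= H_j] on [M_j] near [p].  Hence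
    [phi = H_j] on [M_j].  Its weak derivatives are computed by approximating the maximum by
    [log (sum_i exp (n H_i)) / n]; a tie [H_i = H_j] in [M_j] is harmless because it is a local
    minimum of [H_j - H_i], where the gradients agree. *)

(** * Calculus on squares *)

(** A subharmonic function may well decrease along a segment, so subharmonicity of [u] alone gives
    no comparison. What forbids the drop is that in the limit the gradient of [u] takes only the
    finitely many values conj(A_l - A_j). A drop, once tilted by [s X], would produce an interior
    positive maximum of [v]; around it a function whose Laplacian is bounded below has small
    gradient on a set of positive measure. The power makes this quantitative: n int v^n |grad v|^2
    <= C int v^(n+1) <= C V int v^n fails for large n if |grad v| stays bounded below where v > 0.
    The gradient is bounded below through its component along grad X, which does not see the penalty
    in Y because grad X and grad Y are orthogonal. A linear coordinate along z1 - z0 would serve for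
    the transversal branches, but for the branch k the product grad(H_k - H_j) . grad X could then
    change sign. With X built from W this product is exactly d1 |W'|^2 with d1 constant, so a single
    value of s has to be avoided. All constants are independent of e; only the integral of the error
    depends on it. *)

Section pointwise_derivatives.
Variable R : realType.
Implicit Types (f g : R -> R) (x c : R).

Lemma is_deriveDp f g x df dg : is_derive x 1 f df -> is_derive x 1 g dg ->
  is_derive x 1 (fun t => f t + g t) (df + dg).
Proof. by move=> hf hg; exact: is_deriveD. Qed.

Lemma is_deriveBp f g x df dg : is_derive x 1 f df -> is_derive x 1 g dg ->
  is_derive x 1 (fun t => f t - g t) (df - dg).
Proof. by move=> hf hg; exact: is_deriveB. Qed.

Lemma is_deriveMp f g x df dg : is_derive x 1 f df -> is_derive x 1 g dg ->
  is_derive x 1 (fun t => f t * g t) (f x * dg + g x * df).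
Proof. by move=> hf hg; exact: is_deriveM. Qed.

Lemma is_deriveZl c f x df : is_derive x 1 f df -> is_derive x 1 (fun t => c * f t) (c * df).
Proof. by move=> hf; exact: is_deriveZ. Qed.

Lemma is_deriveZr c f x df : is_derive x 1 f df -> is_derive x 1 (fun t => f t * c) (df * c).
Proof.
move=> hf; rewrite mulrC; rewrite (_ : (fun t => _) = (fun t => c * f t)).
  exact: is_deriveZl.
by apply/funext => t; rewrite mulrC.
Qed.

Lemma is_derive_compp f g x df dg : is_derive (g x) 1 f df -> is_derive x 1 g dg ->
  is_derive x 1 (fun t => f (g t)) (df * dg).
Proof. by move=> hf hg; exact: (is_derive1_comp hf hg). Qed.

Lemma is_deriveNp f x df : is_derive x 1 f df -> is_derive x 1 (fun t => - f t) (- df).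
Proof. by move=> hf; exact: is_deriveN. Qed.

Lemma is_derive_subl c x : is_derive x 1 (fun t => c - t) (- 1).
Proof.
apply: is_derive_eq (is_deriveBp (is_derive_cst c x 1) (is_derive_id x 1)) _.
by rewrite sub0r.
Qed.

Lemma is_derive_expn n x : is_derive x 1 (fun s : R => s ^+ n.+1) (n.+1%:R * x ^+ n).
Proof.
rewrite (_ : (fun s : R => _) = (fun s : R => s) ^+ n.+1); last first.
  by apply/funext => s; rewrite exprfctE.
have h := @is_deriveX R R (fun s : R => s) n.+1 x 1 1 (is_derive_id x 1).
by apply: is_derive_eq h _; rewrite /GRing.scale /= mulr1.
Qed.

Lemma dnbhs0_norm_le (e : R) : 0 < e -> \forall h \near (0 : R)^', `|h| <= e.
Proof.
move=> e0; apply: nbhs_dnbhs; apply/nbhs_ballP; exists e => //= h.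
by rewrite /ball /= sub0r normrN => /ltW.
Qed.

(* max(t,0)^(n+2) is C^1: at 0 the difference quotient is squeezed by |h|^(n+1). *)
Definition posp n (t : R) : R := Num.max t 0 ^+ n.

Lemma posp_derive n x : is_derive x 1 (posp n.+2) (n.+2%:R * posp n.+1 x).
Proof.
have [x0|x0|->] := ltgtP x 0.
- rewrite {2}/posp (max_idPr (ltW x0)) expr0n /= mulr0.
  have h0 : is_derive x 1 (fun=> 0 : R) (0 : R) by exact: is_derive_cst.
  have hn : \near x, 0 = posp n.+2 x.
    near=> s; rewrite /posp (max_idPr _) ?expr0n//.
    by apply: ltW; near: s; exact: lt_nbhsl.
  exact: (near_eq_is_derive hn h0).
- rewrite {2}/posp (max_idPl (ltW x0)).
  have h0 : is_derive x 1 (fun s : R => s ^+ n.+2) (n.+2%:R * x ^+ n.+1).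
    exact: is_derive_expn.
  have hn : \near x, x ^+ n.+2 = posp n.+2 x.
    near=> s; rewrite /posp (max_idPl _)//.
    by apply: ltW; near: s; exact: lt_nbhsr.
  exact: (near_eq_is_derive hn h0).
- rewrite {2}/posp maxxx expr0n /= mulr0.
  suff h : (fun h : R => h^-1 *: (posp n.+2 (h *: 1 + 0) - posp n.+2 0)) @ 0^' --> (0 : R).
    by apply: DeriveDef; [apply/cvg_ex; exists 0|exact/cvg_lim].
  apply/cvgr0Pnorm_le => e e0; near=> h.
  have h0 : h != 0 by near: h; exact: nbhs_dnbhs_neq.
  have he : `|h| <= e.
    by near: h; exact: dnbhs0_norm_le.
  have h1 : `|h| <= 1.
    by near: h; exact: dnbhs0_norm_le.
  rewrite /posp maxxx expr0n /= subr0 addr0 /GRing.scale /= mulr1 normrM normrX normfV.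
  have m : `|Num.max h 0| <= `|h|.
    by case: (leP h 0) => hh; rewrite ?normr0 ?normr_ge0.
  rewrite ler_pdivrMl ?normr_gt0// exprSr exprSr -mulrA.
  apply: le_trans (_ : 1 * (`|h| * `|h|) <= _); last by rewrite mul1r ler_wpM2l.
  apply: ler_pM; rewrite ?mulr_ge0 ?exprn_ge0//; last exact: ler_pM.
  by apply: exprn_ile1 => //; exact: le_trans m h1.
Unshelve. all: by end_near. Qed.

Lemma posp_continuous n : continuous (posp n.+1).
Proof.
move=> x; rewrite /posp; apply: (@continuous_comp _ _ _ (fun t : R => Num.max t 0) (fun t => t ^+ n.+1)).
  by apply: continuous_max; [exact: cvg_id|exact: cvg_cst].
exact: exprn_continuous.
Qed.

Lemma posp_ge0 n x : 0 <= posp n x.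
Proof. by rewrite exprn_ge0// le_max lexx orbT. Qed.
End pointwise_derivatives.

Section squares.
Variable R : realType.
Implicit Types (p z : R * R) (a : R) (f : R * R -> R).
Local Notation mR := (measurableTypeR R).
Local Notation R2 := (mR * mR)%type.
Local Notation mu := (@lam2 R).

(** Closed squares rather than discs: an integral over a square is an iterated integral over
    intervals, so integration by parts reduces to the one-dimensional fundamental theorem. *)
Definition sq p a : set (R * R) :=
  [set z | `|z.1 - p.1| <= a /\ `|z.2 - p.2| <= a].

Lemma sqE p a : sq p a = `[p.1 - a, p.1 + a]%classic `*` `[p.2 - a, p.2 + a]%classic.
Proof.
by apply/seteqP; split => z /=; rewrite /sq /= !ler_distl !in_itv /= => -[].
Qed.

Lemma measurable_sq p a : measurable (sq p a : set R2).
Proof. by rewrite sqE; apply: measurableX; exact: measurable_itv. Qed.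

Lemma lam2_sq p a : 0 <= a -> lam2 (sq p a) = ((a *+ 2) ^+ 2)%:E.
Proof.
move=> a0; have itvE (x : R) : (lebesgue_measure `[(x - a)%R, (x + a)%R]%classic = (a *+ 2)%:E)%E.
  rewrite lebesgue_measure_itv /= lte_fin.
  case: ltP => [_|h]; first by rewrite -EFinB; congr EFin; lra.
  by congr EFin; move: h; lra.
rewrite sqE /lam2 product_measure1E; [|exact: measurable_itv|exact: measurable_itv].
transitivity ((a *+ 2)%:E * (a *+ 2)%:E)%E; last by rewrite -EFinM expr2.
by congr (_ * _)%E; exact: itvE.
Qed.

Lemma lam2_sq_fin p a : (lam2 (sq p a) < +oo)%E.
Proof.
have [a0|a0] := leP 0 a; first by rewrite lam2_sq// ltry.
have -> : sq p a = set0.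
  by apply/seteqP; split => // z [h _]; have := normr_ge0 (z.1 - p.1); lra.
by rewrite /lam2 measure0 ltry.
Qed.

Lemma compact_sq p a : compact (sq p a).
Proof. by rewrite sqE; apply: compact_setX; exact: segment_compact. Qed.

(** The measurable structure is that of the product of two lines, so openness has to be turned into
    a countable union of boxes; those with rational corners suffice. *)
Lemma open_measurable_plane (U : set (R * R)) : open U ->
  measurable (U : set R2).
Proof.
move=> oU.
pose B (q : (rat * rat) * (rat * rat)) : set (R * R) :=
  `]ratr q.1.1, ratr q.1.2[%classic `*` `]ratr q.2.1, ratr q.2.2[%classic.
have -> : U = \bigcup_(q in [set q | B q `<=` U]) B q.
  apply/seteqP; split => [z Uz|z [q /= + Bz]]; last exact.
  have /nbhs_ballP [e /= e0 eU] : nbhs z U by exact: open_nbhs_nbhs.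
  have lt1 (x : R) : x - e < x by lra.
  have lt2 (x : R) : x < x + e by lra.
  have [q1 /[!in_itv]/= /andP[l1 r1]] := rat_in_itvoo (lt1 z.1).
  have [q2 /[!in_itv]/= /andP[l2 r2]] := rat_in_itvoo (lt2 z.1).
  have [q3 /[!in_itv]/= /andP[l3 r3]] := rat_in_itvoo (lt1 z.2).
  have [q4 /[!in_itv]/= /andP[l4 r4]] := rat_in_itvoo (lt2 z.2).
  exists ((q1, q2), (q3, q4)); last by split; rewrite /= in_itv /= ?r1 ?l2 ?r3 ?l4.
  rewrite /B /= => w [] /=.
  rewrite !in_itv /= => /andP[a1 a2] /andP[a3 a4]; apply: eU.
  by split; rewrite /ball /= ltr_distlC; lra.
rewrite bigcup_mkcond; apply: countable_bigcupT_measurable => [|q]; first exact: countableP.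
case: ifPn => _; last exact: measurable0.
by apply: measurableX; exact: measurable_itv.
Qed.

(** Continuity in the whole plane at each point of [D], not relative to [D]. On a closed square this
    includes continuity across the sides, which makes the property local and stable under
    composition. *)
Definition cont_on (D : set (R * R)) f := forall z, D z -> {for z, continuous f}.

Lemma measurable_cont_on (D : set (R * R)) f :
  measurable (D : set R2) -> cont_on D f ->
  measurable_fun (D : set R2) (f : _ -> mR).
Proof.
move=> mD cf; apply: (measurability _ (RGenOInfty.measurableE R)) => /= _ [_ [x ->] <-].
have -> : D `&` f @^-1` `]x, +oo[ = D `&` interior (f @^-1` `]x, +oo[).
  apply/seteqP; split => z [Dz fz]; split => //; last exact: interior_subset fz.
  by apply: (cf z Dz); apply: open_nbhs_nbhs; split => //.
apply: measurableI => //; apply: open_measurable_plane; exact: open_interior.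
Qed.

Lemma cont_on_bounded p a f : cont_on (sq p a) f ->
  exists2 K : R, 0 < K & forall z, sq p a z -> `|f z| <= K.
Proof.
move=> cf.
have cpt : compact (f @` sq p a).
  apply: continuous_compact; last exact: compact_sq.
  by apply: continuous_in_subspaceT => z /set_mem/cf.
have [K [_ /(_ (Num.max K 0 + 1))]] := compact_bounded cpt.
move=> /(_ _)/wrap[]; first by rewrite (le_lt_trans (_ : K <= Num.max K 0)) ?le_max ?lexx// ltrDl.
move=> h; exists (Num.max K 0 + 1).
  by rewrite ltr_wpDl// le_max lexx orbT.
by move=> z az; apply: h; exists z.
Qed.

Lemma sq_integrable p a f K :
  measurable_fun (sq p a : set R2) (f : _ -> mR) ->
  (forall z, sq p a z -> `|f z| <= K) -> mu.-integrable (sq p a) (EFin \o f).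
Proof.
move=> mf fK; apply: measurable_bounded_integrable => //.
- exact: measurable_sq.
- exact: lam2_sq_fin.
- exists K; split; first by rewrite num_real.
  by move=> x Kx z /fK/le_trans; apply; exact: ltW.
Qed.

Lemma cont_on_integrable p a f : cont_on (sq p a) f -> mu.-integrable (sq p a) (EFin \o f).
Proof.
move=> cf; have [K _ fK] := cont_on_bounded cf.
apply: sq_integrable fK; apply: measurable_cont_on cf; exact: measurable_sq.
Qed.
End squares.

Section calculus_on_squares.
Variable R : realType.
Implicit Types (p z w : R * R) (a : R) (f g : R * R -> R) (D : set (R * R)).
Local Notation mR := (measurableTypeR R).
Local Notation R2 := (mR * mR)%type.
Local Notation mu := (@lam2 R).

Definition dx_on D f g :=
  forall z, D z -> is_derive (z.1 : R) 1 (fun t : R => f (t, z.2)) (g z).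
Definition dy_on D f g :=
  forall z, D z -> is_derive (z.2 : R) 1 (fun t : R => f (z.1, t)) (g z).

Lemma pairr_continuous (y t : R) : {for t, continuous (fun s : R => (s, y))}.
Proof.
move=> A /nbhs_ballP [e /= e0 eA]; apply/nbhs_ballP; exists e => //= s ts.
by apply: eA; split => //=; exact: ballxx.
Qed.

Lemma pairl_continuous (x t : R) : {for t, continuous (fun s : R => (x, s))}.
Proof.
move=> A /nbhs_ballP [e /= e0 eA]; apply/nbhs_ballP; exists e => //= s ts.
by apply: eA; split => //=; exact: ballxx.
Qed.

Lemma derive_seg_continuous (f df : R -> R) (a b : R) :
  (forall t, a <= t <= b -> is_derive t 1 f (df t)) -> {within `[a, b], continuous f}.
Proof.
move=> fd; apply: continuous_in_subspaceT => t /set_mem /=; rewrite in_itv /= => /fd [h _].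
by apply: differentiable_continuous; apply/derivable1_diffP.
Qed.

Lemma integral_derive (f df : R -> R) (a b : R) : a < b ->
  (forall t, a <= t <= b -> is_derive t 1 f (df t)) ->
  (forall t, a <= t <= b -> {for t, continuous df}) ->
  (\int[lebesgue_measure]_(x in `[a, b]) (df x)%:E = (f b)%:E - (f a)%:E)%E.
Proof.
move=> ab fd cdf; have cf := derive_seg_continuous fd.
apply: continuous_FTC2 => //.
- by apply: continuous_in_subspaceT => t /set_mem /=; rewrite in_itv /= => /cdf.
- have [cf1 cfa cfb] := (continuous_within_itvP f ab).1 cf; split => //.
  by move=> t; rewrite in_itv /= => /andP[at_ tb]; have [] := fd t; rewrite ?(ltW at_) ?(ltW tb).
- move=> t; rewrite in_itv /= => /andP[at_ tb]; rewrite derive1E.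
  have abt : a <= t <= b by rewrite (ltW at_) (ltW tb).
  by case: (fd t abt).
Qed.

Lemma mvt_lip (f df : R -> R) (K x y : R) :
  (forall t, Num.min x y <= t <= Num.max x y -> is_derive t 1 f (df t) /\ `|df t| <= K) ->
  `|f x - f y| <= K * `|x - y|.
Proof.
wlog xy : x y / x <= y.
  move=> h; have [xy|yx] := orP (le_total x y); first exact: h.
  by rewrite distrC (distrC x) minC maxC => H; apply: h.
rewrite (min_idPl xy) (max_idPr xy) => h.
have fd t : x <= t <= y -> is_derive t 1 f (df t) by move=> /h [].
have fd' t : t \in `]x, y[ -> is_derive t 1 f (df t).
  by rewrite in_itv /= => /andP[xt ty]; apply: fd; rewrite (ltW xt) (ltW ty).
have [c + fE] := MVT_segment xy fd' (derive_seg_continuous fd).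
rewrite in_itv /= => cxy.
rewrite distrC fE normrM (distrC x); apply: ler_wpM2r => //.
by case: (h c).
Qed.

Lemma sq_lip p a f fx fy (K : R) : dx_on (sq p a) f fx -> dy_on (sq p a) f fy ->
  (forall z, sq p a z -> `|fx z| <= K /\ `|fy z| <= K) ->
  forall z w, sq p a z -> sq p a w -> `|f z - f w| <= K * (`|z.1 - w.1| + `|z.2 - w.2|).
Proof.
move=> hx hy hK z w [z1 z2] [w1 w2].
(* The path through the corner (w.1, z.2) stays in the square; this is why distances are measured by
   the sum of the coordinate differences throughout. *)
have -> : f z - f w = (f (z.1, z.2) - f (w.1, z.2)) + (f (w.1, z.2) - f (w.1, w.2)).
  by rewrite -!surjective_pairing; ring.
rewrite mulrDr; apply: le_trans (ler_normD _ _) _; apply: lerD.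
- apply: (@mvt_lip (fun t => f (t, z.2)) (fun t => fx (t, z.2))) => t tzw.
  have st : sq p a (t, z.2).
    split => //=; move: z1 w1 tzw; rewrite !ler_distl ge_min le_max.
    by move=> /andP[? ?] /andP[? ?] /andP[/orP[]? /orP[]?]; lra.
  by split; [exact: (hx (t, z.2))|have [] := hK _ st].
- apply: (@mvt_lip (fun t => f (w.1, t)) (fun t => fy (w.1, t))) => t tzw.
  have st : sq p a (w.1, t).
    split => //=; move: z2 w2 tzw; rewrite !ler_distl ge_min le_max.
    by move=> /andP[? ?] /andP[? ?] /andP[/orP[]? /orP[]?]; lra.
  by split; [exact: (hy (w.1, t))|have [] := hK _ st].
Qed.

(** The boundary terms are kept because [conv_mass] uses a function that does not vanish on the
    vertical sides. *)
Lemma sq_integral_dxE p a f g : 0 < a -> dx_on (sq p a) f g -> cont_on (sq p a) g ->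
  (\int[mu]_(z in sq p a) (g z)%:E =
   \int[lebesgue_measure]_(y in `[(p.2 - a)%R, (p.2 + a)%R])
     (f ((p.1 + a)%R, y) - f ((p.1 - a)%R, y))%:E)%E.
Proof.
move=> a0 fg cg; have ig := cont_on_integrable cg.
rewrite integral_mkcond -integral21_prod_meas1; last first.
  by apply/(integrable_mkcond _ (measurable_sq p a)).
rewrite [RHS]integral_mkcond; apply: eq_integral => y _; rewrite /fubini_G [RHS]patchE.
case: ifPn => [/set_mem|/negP ya]; last first.
  apply: integral0_eq => x _; rewrite patchE; case: ifPn => // /set_mem [_ /= h].
  by exfalso; apply: ya; apply/mem_set; rewrite /= in_itv /= -ler_distl.
rewrite /= in_itv /= -ler_distl => ya.
transitivity (\int[lebesgue_measure]_(x in `[(p.1 - a)%R, (p.1 + a)%R]) (g (x, y))%:E)%E.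
  rewrite [RHS]integral_mkcond; apply: eq_integral => x _.
  rewrite !patchE; congr (if _ then _ else _).
  apply/idP/idP => /set_mem h; apply/mem_set; move: h; rewrite /sq /= in_itv /= ler_distl.
    by case.
  by split.
apply: (@integral_derive (fun x => f (x, y)) (fun x => g (x, y))).
- by lra.
- by move=> t ht; apply: (fg (t, y)); split; rewrite //= ler_distl.
- move=> t ht; have st : sq p a (t, y) by split; rewrite //= ler_distl.
  apply: (@continuous_comp R (R * R)%type R (fun t => (t, y)) g); last exact: cg.
  exact: pairr_continuous.
Qed.

Lemma sq_integral_dx p a f g : 0 < a -> dx_on (sq p a) f g -> cont_on (sq p a) g ->
  (forall z, sq p a z -> `|z.1 - p.1| = a -> f z = 0) ->
  \int[mu]_(z in sq p a) g z = 0.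
Proof.
move=> a0 fg cg f0; rewrite /Rintegral (sq_integral_dxE a0 fg cg).
have n1 : `|p.1 + a - p.1| = a by rewrite addrAC subrr add0r gtr0_norm.
have n2 : `|p.1 - a - p.1| = a by rewrite addrAC subrr add0r normrN gtr0_norm.
rewrite integral0_eq//= => y; rewrite /= in_itv /= -ler_distl => ya.
by rewrite !f0 ?subrr//=; split; rewrite /= ?n1 ?n2 ?lexx.
Qed.

Lemma sq_integral_dy p a f g : 0 < a -> dy_on (sq p a) f g -> cont_on (sq p a) g ->
  (forall z, sq p a z -> `|z.2 - p.2| = a -> f z = 0) ->
  \int[mu]_(z in sq p a) g z = 0.
Proof.
move=> a0 fg cg f0; rewrite /Rintegral.
suff -> : (\int[mu]_(z in sq p a) (g z)%:E = 0)%E by [].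
have ig := cont_on_integrable cg.
rewrite integral_mkcond -integral12_prod_meas1; last first.
  by apply/(integrable_mkcond _ (measurable_sq p a)).
rewrite integral0_eq// => x _; rewrite /fubini_F.
have [xa|xa] := leP `|x - p.1| a; last first.
  apply: integral0_eq => y _; rewrite patchE; case: ifPn => // /set_mem [/= + _].
  by rewrite leNgt xa.
transitivity (\int[lebesgue_measure]_(y in `[(p.2 - a)%R, (p.2 + a)%R]) (g (x, y))%:E)%E.
  rewrite [RHS]integral_mkcond; apply: eq_integral => y _.
  rewrite !patchE; congr (if _ then _ else _).
  apply/idP/idP => /set_mem h; apply/mem_set; move: h; rewrite /sq /= in_itv /= ler_distl.
    by case=> _; rewrite ler_distl.
  by move=> ?; split; rewrite -?ler_distl// ler_distl.
transitivity ((f (x, p.2 + a)%R)%:E - (f (x, p.2 - a)%R)%:E)%E.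
  apply: (@integral_derive (fun y => f (x, y)) (fun y => g (x, y))).
  - by lra.
  - by move=> t ht; apply: (fg (x, t)); split; rewrite //= ler_distl.
  - move=> t ht; have st : sq p a (x, t) by split; rewrite //= ler_distl.
    apply: (@continuous_comp R (R * R)%type R (fun t => (x, t)) g); last exact: cg.
    exact: pairl_continuous.
have n1 : `|p.2 + a - p.2| = a by rewrite addrAC subrr add0r gtr0_norm.
have n2 : `|p.2 - a - p.2| = a by rewrite addrAC subrr add0r normrN gtr0_norm.
by rewrite !f0 ?subee//=; split; rewrite /= ?n1 ?n2 ?lexx.
Qed.
End calculus_on_squares.

(** * Mollification *)

Section convolution.
Variable R : realType.
Implicit Types (p z w : R * R) (a : R) (f g : R * R -> R) (D : set (R * R)) (k : R -> R).
Local Notation mR := (measurableTypeR R).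
Local Notation R2 := (mR * mR)%type.
Local Notation mu := (@lam2 R).

Definition bmeas p a g (K : R) :=
  measurable_fun (sq p a : set R2) (g : _ -> mR) /\ forall z, sq p a z -> `|g z| <= K.

Definition kder k k' := forall t : R, is_derive t 1 k (k' t).

(** Convolution of [g], cut off outside the square, with the product kernel k1(x) k2(y). Keeping the
    factors apart makes the family closed under differentiation, which only replaces one factor by
    its derivative, and lets a primitive of a kernel be used as a factor too. *)
Definition conv p a g k1 k2 z : R :=
  \int[mu]_(w in sq p a) (g w * (k1 (z.1 - w.1) * k2 (z.2 - w.2))).

Lemma convE p a g k1 k2 z : conv p a g k1 k2 z =
  \int[mu]_(w in sq p a) (g w * (k1 (z.1 - w.1) * k2 (z.2 - w.2))).
Proof. by []. Qed.

Lemma kder_continuous k k' : kder k k' -> continuous k.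
Proof. by move=> h t; have [d _] := h t; apply: differentiable_continuous; apply/derivable1_diffP. Qed.

Lemma fst_sub_continuous k (x : R) : continuous k -> continuous (fun w : R * R => k (x - w.1)).
Proof.
move=> ck w; apply: (@continuous_comp _ _ _ (fun w : R * R => x - w.1) k); last exact: ck.
by apply: cvgB; [exact: cvg_cst|exact: cvg_fst].
Qed.

Lemma snd_sub_continuous k (x : R) : continuous k -> continuous (fun w : R * R => k (x - w.2)).
Proof.
move=> ck w; apply: (@continuous_comp _ _ _ (fun w : R * R => x - w.2) k); last exact: ck.
by apply: cvgB; [exact: cvg_cst|exact: cvg_snd].
Qed.

Lemma bounded_on_seg k (u v : R) : continuous k ->
  exists2 K : R, 0 < K & forall t, u <= t <= v -> `|k t| <= K.
Proof.
move=> ck; pose c := (`|u| + `|v|).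
have cf : cont_on (sq ((0 : R), (0 : R)) c) (fun w : R * R => k (0 - w.1)).
  by move=> w _; apply: fst_sub_continuous.
have [K K0 hK] := cont_on_bounded cf; exists K => // t tuv.
have := hK (- t, 0) ; rewrite /= opprK add0r; apply; split => /=; rewrite !subr0.
  rewrite normrN /c; move: tuv (ler_norm u) (ler_norm v) (ler_norm (- u)) (ler_norm (- v)).
  by rewrite !normrN ler_norml => /andP[? ?] ? ? ? ?; have := normr_ge0 u; have := normr_ge0 v; lra.
by rewrite normr0 addr_ge0.
Qed.

Lemma bounded_kernel (p a : R) k (q c : R) : continuous k ->
  exists2 K : R, 0 < K & forall x s, `|x - q| <= c -> `|s - p| <= a -> `|k (x - s)| <= K.
Proof.
move=> ck; have [K K0 hK] := bounded_on_seg (q - p - (c + a)) (q - p + (c + a)) ck.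
by exists K => // x s; rewrite !ler_distl => /andP[? ?] /andP[? ?]; apply: hK; lra.
Qed.

Lemma conv_measurable p a g K k1 k2 z : bmeas p a g K -> continuous k1 -> continuous k2 ->
  measurable_fun (sq p a : set R2) (fun w => g w * (k1 (z.1 - w.1) * k2 (z.2 - w.2)) : mR).
Proof.
move=> [mg _] c1 c2; apply: measurable_funM => //.
apply: measurable_cont_on; first exact: measurable_sq.
by move=> w _; apply: cvgM; [exact: fst_sub_continuous|exact: snd_sub_continuous].
Qed.

Lemma conv_integrable p a g K k1 k2 z : bmeas p a g K -> continuous k1 -> continuous k2 ->
  mu.-integrable (sq p a) (EFin \o (fun w => g w * (k1 (z.1 - w.1) * k2 (z.2 - w.2)))).
Proof.
move=> bg c1 c2; have [K1 K10 h1] := bounded_kernel p.1 a z.1 0 c1.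
have [K2 K20 h2] := bounded_kernel p.2 a z.2 0 c2.
apply: (@sq_integrable _ _ _ _ (`|K| * (K1 * K2))); first exact: conv_measurable bg c1 c2.
move=> w [w1 w2]; rewrite !normrM.
apply: ler_pM => //; rewrite ?mulr_ge0//.
  by apply: le_trans (ler_norm _); apply: bg.2.
by apply: ler_pM => //; [apply: h1|apply: h2]; rewrite ?subrr ?normr0.
Qed.

Lemma conv_bound p a g K k1 k2 q c : bmeas p a g K -> continuous k1 -> continuous k2 ->
  exists2 L : R, 0 < L & forall z, sq q c z -> `|conv p a g k1 k2 z| <= L.
Proof.
move=> bg c1 c2; have [K1 K10 h1] := bounded_kernel p.1 a q.1 c c1.
have [K2 K20 h2] := bounded_kernel p.2 a q.2 c c2.
have m0 : 0 <= fine (mu (sq p a)) by exact: fine_ge0.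
exists ((`|K| * (K1 * K2)) * fine (mu (sq p a)) + 1).
  by rewrite ltr_wpDl// !mulr_ge0// ltW.
move=> z [z1 z2]; apply: le_trans (le_normr_Rintegral _ _) _.
- exact: measurable_sq.
- exact: conv_integrable bg c1 c2.
rewrite -[leLHS]addr0; apply: lerD => //; rewrite -Rintegral_cst; last exact: measurable_sq.
apply: le_Rintegral.
- exact: measurable_sq.
- apply: (@sq_integrable _ _ _ _ (`|K| * (K1 * K2))).
    apply: measurableT_comp; first exact: normr_measurable.
    exact: conv_measurable bg c1 c2.
  move=> w [w1 w2]; rewrite normr_id !normrM.
  apply: ler_pM => //; rewrite ?mulr_ge0//.
    by apply: le_trans (ler_norm _); apply: bg.2.
  by apply: ler_pM => //; [apply: h1|apply: h2].
- by apply: cont_on_integrable => w _; exact: cvg_cst.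
- move=> w [w1 w2]; rewrite !normrM.
  apply: ler_pM => //; rewrite ?mulr_ge0//.
    by apply: le_trans (ler_norm _); apply: bg.2.
  by apply: ler_pM => //; [apply: h1|apply: h2].
Qed.

Lemma is_derive_shift k k' (s x : R) : kder k k' -> is_derive x 1 (fun t : R => k (t - s)) (k' (x - s)).
Proof.
move=> hk; rewrite -[k' _]mulr1.
apply: (@is_derive1_comp _ k (fun t => t - s)); first exact: hk.
by apply: is_derive_eq; rewrite subr0.
Qed.

Lemma conv_dx p a g K k1 k1' k2 D : bmeas p a g K -> kder k1 k1' -> continuous k1' ->
  continuous k2 -> dx_on D (conv p a g k1 k2) (conv p a g k1' k2).
Proof.
move=> bg d1 c1 c2 z _.
have ck1 := kder_continuous d1.
pose f (x : R) (w : R2) := g w * (k1 (x - w.1) * k2 (z.2 - w.2)).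
have df (x : R) w : is_derive x 1 (f ^~ w) (g w * (k1' (x - w.1) * k2 (z.2 - w.2))).
  by apply: is_deriveZl; apply: is_deriveZr; exact: is_derive_shift.
have [K1 K10 h1] := bounded_kernel p.1 a z.1 1 c1.
have [K2 K20 h2] := bounded_kernel p.2 a z.2 0 c2.
(* The integrand of the derivative is dominated by a constant for x within distance 1 of z.1, since
   the kernels are bounded on the differences that occur. *)
pose G (w : R2) := `|K| * (K1 * K2).
have Iz : `](z.1 - 1), (z.1 + 1)[%classic z.1 by rewrite /= in_itv /=; lra.
have intf x : `](z.1 - 1), (z.1 + 1)[%classic x -> mu.-integrable (sq p a) (EFin \o f x).
  by move=> _; apply: (conv_integrable (x, z.2) bg ck1 c2).
have derf x y : `](z.1 - 1), (z.1 + 1)[%classic x -> sq p a y -> derivable (f^~ y) x 1.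
  by move=> _ _; have [] := df x y.
have G0 y : 0 <= G y by rewrite /G !mulr_ge0// ltW.
have intG : mu.-integrable (sq p a) (EFin \o G).
  by apply: cont_on_integrable => w _; exact: cvg_cst.
have Gub x y : `](z.1 - 1), (z.1 + 1)[%classic x -> sq p a y -> `|partial1of2 f x y| <= G y.
  rewrite /= in_itv /= => /andP[x1 x2] [y1 y2]; rewrite partial1of2E; have [_ ->] := df x y.
  rewrite /G !normrM; apply: ler_pM => //; rewrite ?mulr_ge0//.
    by apply: le_trans (ler_norm _); apply: bg.2.
  by apply: ler_pM => //; [apply: h1 => //; rewrite ler_distl; lra|apply: h2; rewrite ?subrr ?normr0].
have dF := derivable_under_integral (measurable_sq p a) Iz intf derf G0 intG Gub.
have FE := differentiation_under_integral (measurable_sq p a) Iz intf derf G0 intG Gub.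
apply: DeriveDef; first exact: dF.
rewrite -derive1E; apply: etrans FE _; apply: eq_Rintegral => w _ /=.
by rewrite partial1of2E; have [_ ->] := df z.1 w.
Qed.

Lemma conv_dy p a g K k1 k2 k2' D : bmeas p a g K -> continuous k1 -> kder k2 k2' ->
  continuous k2' -> dy_on D (conv p a g k1 k2) (conv p a g k1 k2').
Proof.
move=> bg c1 d2 c2 z _.
have ck2 := kder_continuous d2.
pose f (x : R) (w : R2) := g w * (k1 (z.1 - w.1) * k2 (x - w.2)).
have df (x : R) w : is_derive x 1 (f ^~ w) (g w * (k1 (z.1 - w.1) * k2' (x - w.2))).
  by do 2 apply: is_deriveZl; exact: is_derive_shift.
have [K1 K10 h1] := bounded_kernel p.1 a z.1 0 c1.
have [K2 K20 h2] := bounded_kernel p.2 a z.2 1 c2.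
pose G (w : R2) := `|K| * (K1 * K2).
have Iz : `](z.2 - 1), (z.2 + 1)[%classic z.2 by rewrite /= in_itv /=; lra.
have intf x : `](z.2 - 1), (z.2 + 1)[%classic x -> mu.-integrable (sq p a) (EFin \o f x).
  by move=> _; apply: (conv_integrable (z.1, x) bg c1 ck2).
have derf x y : `](z.2 - 1), (z.2 + 1)[%classic x -> sq p a y -> derivable (f^~ y) x 1.
  by move=> _ _; have [] := df x y.
have G0 y : 0 <= G y by rewrite /G !mulr_ge0// ltW.
have intG : mu.-integrable (sq p a) (EFin \o G).
  by apply: cont_on_integrable => w _; exact: cvg_cst.
have Gub x y : `](z.2 - 1), (z.2 + 1)[%classic x -> sq p a y -> `|partial1of2 f x y| <= G y.
  rewrite /= in_itv /= => /andP[x1 x2] [y1 y2]; rewrite partial1of2E; have [_ ->] := df x y.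
  rewrite /G !normrM; apply: ler_pM => //; rewrite ?mulr_ge0//.
    by apply: le_trans (ler_norm _); apply: bg.2.
  by apply: ler_pM => //; [apply: h1; rewrite ?subrr ?normr0|apply: h2 => //; rewrite ler_distl; lra].
have dF := derivable_under_integral (measurable_sq p a) Iz intf derf G0 intG Gub.
have FE := differentiation_under_integral (measurable_sq p a) Iz intf derf G0 intG Gub.
apply: DeriveDef; first exact: dF.
rewrite -derive1E; apply: etrans FE _; apply: eq_Rintegral => w _ /=.
by rewrite partial1of2E; have [_ ->] := df z.2 w.
Qed.

Lemma lip_cont_on f : (forall q, exists2 K : R, 0 < K & forall z, sq q 1 z ->
    `|f z - f q| <= K * (`|z.1 - q.1| + `|z.2 - q.2|)) -> forall D, cont_on D f.
Proof.
move=> h D q _; have [K K0 hK] := h q.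
apply/cvgrPdist_le => e e0.
suff /nbhs_ballP : nbhs_ball q [set z | `|f q - f z| <= e] by [].
exists (Num.min 1 (e / (K * 2))) => /=.
  by rewrite lt_min ltr01 divr_gt0// mulr_gt0.
move=> z [/= ]; rewrite /ball /= !lt_min => /andP[a1 a2] /andP[b1 b2].
rewrite distrC; apply: le_trans (hK z _) _.
  by split; rewrite distrC ltW.
rewrite mulrC -ler_pdivlMr//; move: a2 b2.
rewrite distrC (distrC q.2) invfM mulrA => a2 b2.
by move: (`|z.1 - q.1|) (`|z.2 - q.2|) (e / K) a2 b2 => u v t; lra.
Qed.

(** Continuity is read off from a local Lipschitz bound given by the two partial derivatives, so it
    costs one continuous derivative of each kernel. *)
Lemma conv_cont_on p a g K k1 k1' k2 k2' D : bmeas p a g K -> kder k1 k1' -> continuous k1' ->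
  kder k2 k2' -> continuous k2' -> cont_on D (conv p a g k1 k2).
Proof.
move=> bg d1 c1 d2 c2; apply: lip_cont_on => q.
have ck1 := kder_continuous d1; have ck2 := kder_continuous d2.
have [L1 L10 h1] := conv_bound q 1 bg c1 ck2.
have [L2 L20 h2] := conv_bound q 1 bg ck1 c2.
exists (L1 + L2); first exact: addr_gt0.
move=> z qz; apply: (sq_lip (conv_dx (D := sq q 1) bg d1 c1 ck2) (conv_dy bg ck1 d2 c2)) => //.
  move=> w qw; split; first by apply: le_trans (h1 _ qw) _; rewrite lerDl ltW.
  by apply: le_trans (h2 _ qw) _; rewrite lerDr ltW.
by split; rewrite subrr normr0.
Qed.

Lemma bmeas_lin p a g1 g2 K1 K2 (c : R) : bmeas p a g1 K1 -> bmeas p a g2 K2 ->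
  bmeas p a (fun z => g1 z + c * g2 z) (K1 + `|c| * K2).
Proof.
move=> [m1 b1] [m2 b2]; split.
  by apply: measurable_funD => //; apply: measurable_funM => //; exact: measurable_cst.
move=> z az; apply: le_trans (ler_normD _ _) _; rewrite normrM; apply: lerD; first exact: b1.
by apply: ler_wpM2l => //; exact: b2.
Qed.

Lemma conv_lin p a g1 g2 K1 K2 (c : R) k1 k2 z : bmeas p a g1 K1 -> bmeas p a g2 K2 ->
  continuous k1 -> continuous k2 ->
  conv p a (fun z => g1 z + c * g2 z) k1 k2 z = conv p a g1 k1 k2 z + c * conv p a g2 k1 k2 z.
Proof.
move=> b1 b2 c1 c2; rewrite /conv.
have m := @measurable_sq R p a.
have i1 := conv_integrable z b1 c1 c2; have i2 := conv_integrable z b2 c1 c2.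
rewrite -(RintegralZl _ m i2) -RintegralD//.
  by apply: eq_Rintegral => w _; rewrite mulrDl -[c * _ * _]mulrA.
by have := integrableZl m c i2; apply: eq_integrable => // w _ /=; rewrite EFinM.
Qed.

Lemma cont_bmeas p a g : cont_on (sq p a) g -> exists2 K : R, 0 < K & bmeas p a g K.
Proof.
move=> cg; have [K K0 hK] := cont_on_bounded cg; exists K => //; split => //.
by apply: measurable_cont_on cg; exact: measurable_sq.
Qed.

(** Mollification commutes with differentiation wherever the kernel centred at [z] vanishes on the
    two vertical sides. The two sign changes, from k1(z.1 - s) and from integration by parts,
    cancel. *)
Lemma conv_ibp_x p a h hx k1 k1' k2 z : 0 < a -> dx_on (sq p a) h hx ->
  cont_on (sq p a) h -> cont_on (sq p a) hx ->
  kder k1 k1' -> continuous k1' -> continuous k2 ->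
  (forall s, `|s - p.1| = a -> k1 (z.1 - s) = 0) ->
  conv p a h k1' k2 z = conv p a hx k1 k2 z.
Proof.
move=> a0 hhx ch chx d1 c1 c2 k0; apply/eqP; rewrite -subr_eq0 -oppr_eq0 opprB; apply/eqP.
have ck1 := kder_continuous d1.
have [K _ bh] := cont_bmeas ch; have [K' _ bhx] := cont_bmeas chx.
rewrite /conv -RintegralB; [|exact: measurable_sq|exact: conv_integrable bhx ck1 c2|exact: conv_integrable bh c1 c2].
apply: (@sq_integral_dx _ _ _ (fun w => h w * (k1 (z.1 - w.1) * k2 (z.2 - w.2)))) => //.
- move=> w aw /=.
  have e1 : is_derive (w.1 : R) 1 (fun t : R => k1 (z.1 - t)) (k1' (z.1 - w.1) * (- 1)).
    apply: (@is_derive_compp _ k1 (fun t => z.1 - t)); first exact: d1.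
    exact: is_derive_subl.
  have e2 := is_deriveMp (hhx w aw) (is_deriveZr (k2 (z.2 - w.2)) e1).
  by apply: is_derive_eq e2 _; rewrite -surjective_pairing; ring.
- move=> w aw; apply: cvgB; apply: cvgM => //; try exact: chx; try exact: ch;
  by apply: cvgM; [exact: fst_sub_continuous|exact: snd_sub_continuous].
- by move=> w _ /k0 ->; rewrite mul0r mulr0.
Qed.

Lemma conv_ibp_y p a h hy k1 k2 k2' z : 0 < a -> dy_on (sq p a) h hy ->
  cont_on (sq p a) h -> cont_on (sq p a) hy ->
  continuous k1 -> kder k2 k2' -> continuous k2' ->
  (forall s, `|s - p.2| = a -> k2 (z.2 - s) = 0) ->
  conv p a h k1 k2' z = conv p a hy k1 k2 z.
Proof.
move=> a0 hhy ch chy c1 d2 c2 k0; apply/eqP; rewrite -subr_eq0 -oppr_eq0 opprB; apply/eqP.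
have ck2 := kder_continuous d2.
have [K _ bh] := cont_bmeas ch; have [K' _ bhy] := cont_bmeas chy.
rewrite /conv -RintegralB; [|exact: measurable_sq|exact: conv_integrable bhy c1 ck2|exact: conv_integrable bh c1 c2].
apply: (@sq_integral_dy _ _ _ (fun w => h w * (k1 (z.1 - w.1) * k2 (z.2 - w.2)))) => //.
- move=> w aw /=.
  have e1 : is_derive (w.2 : R) 1 (fun t : R => k2 (z.2 - t)) (k2' (z.2 - w.2) * (- 1)).
    apply: (@is_derive_compp _ k2 (fun t => z.2 - t)); first exact: d2.
    exact: is_derive_subl.
  have e2 := is_deriveMp (hhy w aw) (is_deriveZl (k1 (z.1 - w.1)) e1).
  by apply: is_derive_eq e2 _; rewrite -surjective_pairing; ring.
- move=> w aw; apply: cvgB; apply: cvgM => //; try exact: chy; try exact: ch;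
  by apply: cvgM; [exact: fst_sub_continuous|exact: snd_sub_continuous].
- by move=> w _ /k0 ->; rewrite !mulr0.
Qed.

(** Since [b] is the derivative of [B], each one-dimensional integral is a difference of values of
    [B], namely 1 - 0. No normalising constant has to be carried along. *)
Lemma conv_mass p a (B b : R -> R) (e : R) z : 0 < a -> kder B b -> continuous b ->
  (forall t, t <= - e -> B t = 0) -> (forall t, e <= t -> B t = 1) ->
  sq p (a - e) z -> \int[mu]_(w in sq p a) (b (z.1 - w.1) * b (z.2 - w.2)) = 1.
Proof.
move=> a0 dB cb B0 B1; move=> [] /=; rewrite !ler_distl => /andP[z1 z1'] /andP[z2 z2'].
have dBm (x t : R) : is_derive t 1 (fun s : R => - B (x - s)) (b (x - t)).
  have e1 : is_derive (t : R) 1 (fun s : R => B (x - s)) (b (x - t) * (- 1)).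
    apply: (@is_derive_compp _ B (fun t => x - t)); first exact: dB.
    exact: is_derive_subl.
  apply: is_derive_eq (is_deriveNp e1) _.
  by rewrite mulrN1 opprK.
have cc : cont_on (sq p a) (fun w => b (z.1 - w.1) * b (z.2 - w.2)).
  by move=> w _; apply: cvgM; [exact: fst_sub_continuous|exact: snd_sub_continuous].
have dd : dx_on (sq p a) (fun w => - B (z.1 - w.1) * b (z.2 - w.2)) (fun w => b (z.1 - w.1) * b (z.2 - w.2)).
  by move=> w _ /=; apply: is_deriveZr; exact: dBm.
rewrite /Rintegral (sq_integral_dxE a0 dd cc) /=.
rewrite (B0 (z.1 - (p.1 + a))) ?(B1 (z.1 - (p.1 - a))); [|lra|lra].
under eq_integral do rewrite oppr0 mul0r sub0r mulN1r opprK.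
rewrite (@integral_derive _ (fun s : R => - B (z.2 - s)) (fun s : R => b (z.2 - s))).
- by rewrite (B0 (z.2 - (p.2 + a))) ?(B1 (z.2 - (p.2 - a))) /=; lra.
- by lra.
- move=> t _; apply: (@continuous_comp _ _ _ (fun t : R => z.2 - t) b); last exact: cb.
  by apply: cvgB; [exact: cvg_cst|exact: cvg_id].
Qed.

(** The convolution is an average of [g] against a probability density carried by [sq z e], so any
    bound on [g - c] there passes to the average. Taking [eta] to be 0 yields exact equalities. *)
Lemma conv_close p a g K (B b : R -> R) (e : R) z (c eta : R) : 0 < a -> bmeas p a g K ->
  kder B b -> continuous b -> (forall t, 0 <= b t) ->
  (forall t, t <= - e -> B t = 0) -> (forall t, e <= t -> B t = 1) ->
  (forall t, e < `|t| -> b t = 0) ->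
  sq p (a - e) z -> (forall w, sq z e w -> `|g w - c| <= eta) ->
  `|conv p a g b b z - c| <= eta.
Proof.
move=> a0 bg dB cb b0 B0 B1 bz pz gc.
have m := @measurable_sq R p a.
have M1 := conv_mass a0 dB cb B0 B1 pz.
have b1 (r : R) : bmeas p a (fun=> r) `|r| by split=> //; exact: measurable_cst.
have bgc : bmeas p a (fun w => g w + (-1) * c) (K + `|-1| * `|c|) by exact: bmeas_lin.
have i1 := conv_integrable z bgc cb cb.
have i2 := conv_integrable z (b1 eta) cb cb.
have ir := conv_integrable z (b1 1) cb cb.
have massE (r : R) : conv p a (fun=> r) b b z = r.
  rewrite -[RHS]mulr1 -M1 -RintegralZl//.
  by apply: eq_integrable ir => // w _ /=; rewrite mul1r.
have -> : conv p a g b b z - c = conv p a (fun w => g w + (-1) * c) b b z.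
  rewrite (@conv_lin _ _ _ (fun=> c) K `|c|)//.
  by rewrite massE mulN1r.
rewrite -[eta]massE; apply: le_trans (le_normr_Rintegral m i1) _.
apply: le_Rintegral => //; first exact: integrable_abse i1.
move=> w aw; rewrite normrM [X in _ * X]ger0_norm; last exact: mulr_ge0.
have [zw1|zw1] := leP `|z.1 - w.1| e; last by rewrite (bz _ zw1) mul0r !mulr0.
have [zw2|zw2] := leP `|z.2 - w.2| e; last by rewrite (bz _ zw2) !mulr0.
apply: ler_wpM2r; first exact: mulr_ge0.
by rewrite mulN1r; apply: gc; split; rewrite distrC.
Qed.

End convolution.
Global Opaque conv.

(** * Smooth functions of one variable and the mollifying kernel *)

Section smooth_functions.
Variable R : realType.
Implicit Types (f g : R -> R) (n : nat).

(** One-variable counterpart of [Cn]: a product f(x) g(y) of two functions that satisfy it for every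
    [n] is [smooth], see [tensor_Cn]. *)
Fixpoint C1n n f : Prop := continuous f /\
  if n is m.+1 then (forall x : R, derivable f x 1) /\ C1n m (derive1 f) else True.

Lemma C1n_cont n f : C1n n f -> continuous f. Proof. by case: n => [|n] []. Qed.

Lemma derivable_continuous f : (forall x : R, derivable f x 1) -> continuous f.
Proof. by move=> h x; apply: differentiable_continuous; apply/derivable1_diffP. Qed.

Lemma C1n_intro n f f' : (forall x : R, is_derive x 1 f (f' x)) -> C1n n f' -> C1n n.+1 f.
Proof.
move=> h cf; have d x : derivable f x 1 by have [] := h x.
split; first exact: derivable_continuous.
split => //; suff -> : (derive1 f) = f' by [].
by apply/funext => x; rewrite derive1E; have [_ ->] := h x.
Qed.

Lemma C1n_elim n f : C1n n.+1 f -> (forall x : R, is_derive x 1 f ((derive1 f) x)) /\ C1n n (derive1 f).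
Proof. by move=> [_ [d c]]; split => // x; apply: DeriveDef; rewrite ?derive1E. Qed.

Lemma C1nS n f : C1n n.+1 f -> C1n n f.
Proof.
elim: n f => [|n IH] f; first by move=> /C1n_cont.
by move=> [cf [df /IH h]].
Qed.

Lemma C1n_cst n (c : R) : C1n n (fun=> c).
Proof.
elim: n c => [|n IH] c; first by split => // x; exact: cvg_cst.
apply: (@C1n_intro n _ (fun=> 0)) => // x; exact: is_derive_cst.
Qed.

Lemma C1nD n f g : C1n n f -> C1n n g -> C1n n (fun x => f x + g x).
Proof.
elim: n f g => [|n IH] f g.
  by move=> [cf _] [cg _]; split => // x; apply: cvgD; [exact: cf|exact: cg].
move=> /C1n_elim[df cf] /C1n_elim[dg cg].
apply: (@C1n_intro n _ (fun x => (derive1 f) x + (derive1 g) x)); exact: IH.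
Qed.

Lemma C1nM n f g : C1n n f -> C1n n g -> C1n n (fun x => f x * g x).
Proof.
elim: n f g => [|n IH] f g.
  by move=> [cf _] [cg _]; split => // x; apply: cvgM; [exact: cf|exact: cg].
move=> fS gS; have := C1nS fS; have := C1nS gS.
move: fS gS => /C1n_elim[df cf] /C1n_elim[dg cg] gn fn.
apply: (@C1n_intro n _ (fun x => f x * (derive1 g) x + g x * (derive1 f) x)).
by apply: C1nD; apply: IH.
Qed.

Lemma C1nZ n (c : R) f : C1n n f -> C1n n (fun x => c * f x).
Proof. by move=> h; apply: C1nM => //; exact: C1n_cst. Qed.

Lemma C1nV n f : (forall x, f x != 0) -> C1n n f -> C1n n (fun x => (f x)^-1).
Proof.
move=> f0; elim: n => [|n IH].
  by move=> [cf _]; split => // x; apply: cvgV => //; exact: cf.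
move=> fS; have fn := C1nS fS; have {}IH := IH fn.
move: fS => /C1n_elim[df cf].
have dV (x : R) : is_derive x 1 (fun x => (f x)^-1) (- 1 * (((f x)^-1 * (f x)^-1) * (derive1 f) x)).
  have h := is_deriveV (f0 x) (df x); apply: is_derive_eq h _.
  by rewrite /GRing.scale /= mulN1r mulNr expr2 invfM.
apply: (C1n_intro dV).
by apply: C1nZ; apply: C1nM => //; apply: C1nM.
Qed.

Lemma C1n_affine n f (u v : R) : C1n n f -> C1n n (fun x => f (u * x + v)).
Proof.
elim: n f => [|n IH] f.
  move=> [cf _]; split => // x.
  apply: (@continuous_comp _ _ _ (fun x => u * x + v) f); last exact: cf.
  by apply: cvgD; [apply: cvgM; [exact: cvg_cst|exact: cvg_id]|exact: cvg_cst].
move=> /C1n_elim[df cf].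
apply: (@C1n_intro n _ (fun x => u * (derive1 f) (u * x + v))); last by apply: C1nZ; exact: IH.
move=> x; rewrite mulrC; apply: (@is_derive1_comp _ f (fun x => u * x + v)) => //.
rewrite -[X in is_derive _ _ _ X]addr0 -[X in X + 0]mulr1.
apply: (@is_deriveDp _ (fun t => u * t) (fun=> v)); apply: is_deriveZl.
Qed.

(* [flatexp m t = t^(-m) exp(-1/t)] for [t > 0]: a family stable under differentiation. *)
Definition flatexp m (t : R) : R := if 0 < t then t^-1 ^+ m * expR (- t^-1) else 0.

Lemma flatexp_ge0 m t : 0 <= flatexp m t.
Proof.
rewrite /flatexp; case: ifPn => // t0; apply: mulr_ge0; last exact: expR_ge0.
by rewrite exprn_ge0// invr_ge0 ltW.
Qed.

(** From exp(s) >= 1 + s^(m+1) / (m+1)! at s = 1/t. A bound linear in [t] is enough for continuity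
    at 0 and, used at [m.+1], for the derivative there. *)
Lemma flatexp_le m (t : R) : 0 < t -> flatexp m t <= (m.+1)`!%:R * t.
Proof.
move=> t0; rewrite /flatexp t0 expRN ler_pdivrMr ?expR_gt0//.
have ti : 0 < t^-1 by rewrite invr_gt0.
have := expR_ge1Dxn m (ltW ti); rewrite -(ler_pM2l (_ : 0 < (m.+1)`!%:R * t)); last first.
  by rewrite mulr_gt0// ltr0n fact_gt0.
apply: le_trans; rewrite mulrDr mulr1 exprS.
have -> : (m.+1)`!%:R * t * (t^-1 * t^-1 ^+ m / (m.+1)`!%:R) = t^-1 ^+ m.
  by field; rewrite pnatr_eq0 -lt0n fact_gt0 gt_eqF.
by rewrite lerDr mulr_ge0// ltW.
Qed.

Lemma flatexp_derive m (t : R) : is_derive t 1 (flatexp m) (- (m%:R) * flatexp m.+1 t + flatexp m.+2 t).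
Proof.
have [t0|t0|->] := ltgtP t 0.
- rewrite {2 3}/flatexp ltNge (ltW t0) /= mulr0 addr0.
  have h0 : is_derive t 1 (fun=> 0 : R) (0 : R) by exact: is_derive_cst.
  have hn : \near t, 0 = flatexp m t.
    near=> s; rewrite /flatexp ltNge; suff -> : s <= 0 by [].
    by apply: ltW; near: s; exact: lt_nbhsl.
  exact: (near_eq_is_derive hn h0).
- rewrite {2 3}/flatexp t0.
  have tn0 : t != 0 by rewrite gt_eqF.
  have dV : is_derive t 1 (fun s : R => s^-1) (- (t^-1 ^+ 2)).
    have h := @is_deriveV R (fun s => s) t 1 1 tn0 (is_derive_id t 1); apply: is_derive_eq h _.
    by rewrite /GRing.scale /= mulr1 exprVn.
  have dVN : is_derive t 1 (fun s : R => - s^-1) (t^-1 ^+ 2).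
    by rewrite -[X in is_derive _ _ _ X]opprK; apply: is_deriveN.
  have dE : is_derive t 1 (fun s : R => expR (- s^-1)) (expR (- t^-1) * t^-1 ^+ 2).
    exact: (@is_derive_compp _ expR (fun s : R => - s^-1) t _ _ (is_derive_expR (- t^-1)) dVN).
  have dX : is_derive t 1 (fun s : R => s^-1 ^+ m) (- m%:R * t^-1 ^+ m.+1).
    case: m => [|k].
      rewrite oppr0 mul0r; rewrite (_ : (fun s => _) = (fun=> 1)); first exact: is_derive_cst.
      by apply/funext => s; rewrite expr0.
    have h1 : is_derive t^-1 1 (fun s : R => s ^+ k.+1) (k.+1%:R * t^-1 ^+ k).
      exact: is_derive_expn.
    apply: is_derive_eq (@is_derive_compp _ (fun s : R => s ^+ k.+1) (fun s : R => s^-1) t _ _ h1 dV) _.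
    by rewrite mulrN mulNr -mulrA -exprD addn2.
  have hn : \near t, t^-1 ^+ m * expR (- t^-1) = flatexp m t.
    near=> s; rewrite /flatexp; suff -> : 0 < s by [].
    by near: s; exact: lt_nbhsr.
  apply: (near_eq_is_derive hn); apply: is_derive_eq (is_deriveMp dX dE) _.
  by rewrite !exprS; ring.
- rewrite {2 3}/flatexp ltxx mulr0 addr0.
  suff h : (fun h : R => h^-1 *: (flatexp m (h *: 1 + 0) - flatexp m 0)) @ 0^' --> (0 : R).
    by apply: DeriveDef; [apply/cvg_ex; exists 0|exact/cvg_lim].
  apply/cvgr0Pnorm_le => e e0; near=> h.
  have h0 : h != 0 by near: h; exact: nbhs_dnbhs_neq.
  have he : `|h| <= e / (m.+2)`!%:R.
    by near: h; apply: dnbhs0_norm_le; rewrite divr_gt0// ltr0n fact_gt0.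
  rewrite {2}/flatexp ltxx subr0 addr0 /GRing.scale /= mulr1.
  have [hp|hn] := ltP 0 h; last by rewrite /flatexp ltNge hn /= mulr0 normr0 ltW.
  (* The difference quotient at 0 is the next member of the family, so the previous bound shows that
     it tends to 0. *)
  have -> : h^-1 * flatexp m h = flatexp m.+1 h by rewrite /flatexp hp mulrA -exprS.
  rewrite ger0_norm ?flatexp_ge0//; apply: le_trans (flatexp_le m.+1 hp) _.
  by rewrite mulrC -ler_pdivlMr ?ltr0n ?fact_gt0//; apply: le_trans he; exact: ler_norm.
Unshelve. all: by end_near. Qed.

Lemma flatexp_C1n n m : C1n n (flatexp m).
Proof.
elim: n m => [|n IH] m.
  split => //; apply: derivable_continuous => x; by have [] := flatexp_derive m x.
apply: (C1n_intro (flatexp_derive m)).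
by apply: C1nD => //; apply: C1nZ.
Qed.

(** The usual smooth transition f(1 + t) / (f(1 + t) + f(1 - t)), equal to 0 for t <= -1 and to 1
    for t >= 1. The arguments are spelled as u t + v to fit [C1n_affine]. *)
Definition smoothstep (t : R) : R :=
  flatexp 0 (1 * t + 1) * (flatexp 0 (1 * t + 1) + flatexp 0 (- 1 * t + 1))^-1.

Lemma flatexp_gt0 m (t : R) : 0 < t -> 0 < flatexp m t.
Proof. by move=> t0; rewrite /flatexp t0 mulr_gt0 ?expR_gt0// exprn_gt0// invr_gt0. Qed.

Lemma flatexp_eq0 m (t : R) : t <= 0 -> flatexp m t = 0.
Proof. by move=> t0; rewrite /flatexp ltNge t0. Qed.

Lemma flatexp_nondecreasing (x y : R) : x <= y -> flatexp 0 x <= flatexp 0 y.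
Proof.
move=> xy; have [x0|x0] := ltP 0 x; last by rewrite (flatexp_eq0 _ x0) flatexp_ge0.
rewrite /flatexp x0 (lt_le_trans x0 xy) !expr0 !mul1r ler_expR lerN2 lef_pV2// posrE//.
exact: lt_le_trans xy.
Qed.

Lemma smoothstep_den (t : R) : 0 < flatexp 0 (1 * t + 1) + flatexp 0 (- 1 * t + 1).
Proof.
have [h|h] := ltP 0 t.
  by rewrite ltr_pwDl ?flatexp_ge0// flatexp_gt0; lra.
by rewrite ltr_wpDl ?flatexp_ge0// flatexp_gt0; lra.
Qed.

Lemma smoothstep_C1n n : C1n n smoothstep.
Proof.
apply: C1nM; first exact: C1n_affine (flatexp_C1n n 0).
apply: C1nV; first by move=> t; rewrite gt_eqF// smoothstep_den.
by apply: C1nD; exact: C1n_affine (flatexp_C1n n 0).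
Qed.

Lemma smoothstep_nondecreasing (x y : R) : x <= y -> smoothstep x <= smoothstep y.
Proof.
move=> xy; rewrite /smoothstep.
rewrite ler_pdivrMr ?smoothstep_den// mulrAC ler_pdivlMr ?smoothstep_den//.
have h1 := @flatexp_nondecreasing (1 * x + 1) (1 * y + 1).
have h2 := @flatexp_nondecreasing (- 1 * y + 1) (- 1 * x + 1).
have {}h1 := h1 ltac:(lra); have {}h2 := h2 ltac:(lra).
have := flatexp_ge0 0 (1 * x + 1); have := flatexp_ge0 0 (- 1 * y + 1).
move: (flatexp 0 _) (flatexp 0 _) (flatexp 0 _) (flatexp 0 _) h1 h2 => u1 u2 u3 u4; nra.
Qed.

Lemma derive1_nondecreasing_ge0 f (x : R) : (forall x y, x <= y -> f x <= f y) ->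
  derivable f x 1 -> 0 <= derive1 f x.
Proof.
move=> mf df; rewrite derive1E.
have df' : (fun h : R => h^-1 *: (f (h *: 1 + x) - f x)) @ 0^' --> 'D_1 f x by exact: df.
apply: (@closed_cvg _ _ _ _ (fun h : R => h^-1 *: (f (h *: 1 + x) - f x)) (fun y => 0 <= y) _ _ _ df').
- exact: closed_ge.
- near=> h; rewrite /GRing.scale /= mulr1.
  have h0 : h != 0 by near: h; exact: nbhs_dnbhs_neq.
  have [hp|hn] := ltP 0 h.
    by rewrite mulr_ge0 ?invr_ge0 ?(ltW hp)// subr_ge0 mf// lerDr ltW.
  by rewrite mulr_le0// ?invr_le0// subr_le0 mf// gerDr.
Unshelve. all: by end_near. Qed.

(** The primitive [B] of the kernel is produced rather than the kernel itself: it gives the total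
    mass, the potential [moll_pot], and the nonnegative test function in [moll_curl]. *)
Lemma mollifier (e : R) : 0 < e -> exists B : R -> R,
  [/\ forall n, C1n n B, forall t, 0 <= derive1 B t,
     forall t, t <= - e -> B t = 0, forall t, e <= t -> B t = 1 &
     forall t, e < `|t| -> derive1 B t = 0].
Proof.
move=> e0; pose B t := smoothstep (e^-1 * t + 0).
have CB n : C1n n B by apply: C1n_affine; exact: smoothstep_C1n.
have B0 t : t <= - e -> B t = 0.
  move=> te; rewrite /B /smoothstep flatexp_eq0 ?mul0r//.
  suff : e^-1 * t <= - 1 by lra.
  by rewrite mulrC ler_pdivrMr// mulN1r.
have B1 t : e <= t -> B t = 1.
  move=> te; rewrite /B /smoothstep (@flatexp_eq0 0 (- 1 * _ + 1)).
    rewrite !addr0 divff// gt_eqF// flatexp_gt0// mul1r ltr_wpDl//.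
    by rewrite mulr_ge0 ?invr_ge0 ?(ltW e0)//; apply: le_trans te; exact: ltW.
  suff : 1 <= e^-1 * t by lra.
  by rewrite mulrC ler_pdivlMr// mul1r.
exists B; split => //.
- move=> t; apply: derive1_nondecreasing_ge0.
    move=> x y xy; apply: smoothstep_nondecreasing.
    by rewrite lerD2r ler_pM2l// invr_gt0.
  by have [_ []] := CB 1%N.
- move=> t; rewrite lter_normr derive1E => /orP[te|te].
    have hn : \near t, 1 = B t.
      near=> s; rewrite B1//; apply: ltW; near: s; exact: lt_nbhsr.
    by rewrite -(near_eq_derive (1 : R) hn); exact: derive_cst.
  have hn : \near t, 0 = B t.
    near=> s; rewrite B0//; apply: ltW; near: s; apply: lt_nbhsl; lra.
  by rewrite -(near_eq_derive (1 : R) hn); exact: derive_cst.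
Unshelve. all: by end_near. Qed.

End smooth_functions.

(** * The barrier *)

Section energy.
Variable R : realType.
Implicit Types (p z w : R * R) (a : R) (f g : R * R -> R) (D : set (R * R)).
Local Notation mu := (@lam2 R).

(** No mixed second derivative appears, because only Laplacians are ever integrated. *)
Record C2on D f fx fy fxx fyy : Prop := MkC2on {
  c2_dx : dx_on D f fx; c2_dy : dy_on D f fy;
  c2_dxx : dx_on D fx fxx; c2_dyy : dy_on D fy fyy;
  c2_c : cont_on D f; c2_cx : cont_on D fx; c2_cy : cont_on D fy;
  c2_cxx : cont_on D fxx; c2_cyy : cont_on D fyy }.

Lemma posp_cont_on D f n : cont_on D f -> cont_on D (fun z => posp n.+1 (f z)).
Proof.
move=> cf z Dz; apply: (@continuous_comp _ _ _ f (posp n.+1)); first exact: cf.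
exact: posp_continuous.
Qed.

Lemma cont_onM D f g : cont_on D f -> cont_on D g -> cont_on D (fun z => f z * g z).
Proof. by move=> cf cg z Dz; apply: cvgM; [exact: cf|exact: cg]. Qed.

Lemma cont_onD D f g : cont_on D f -> cont_on D g -> cont_on D (fun z => f z + g z).
Proof. by move=> cf cg z Dz; apply: cvgD; [exact: cf|exact: cg]. Qed.

Lemma cont_onB D f g : cont_on D f -> cont_on D g -> cont_on D (fun z => f z - g z).
Proof. by move=> cf cg z Dz; apply: cvgB; [exact: cf|exact: cg]. Qed.

Lemma cont_on_cst D (c : R) : cont_on D (fun=> c).
Proof. by move=> z _; exact: cvg_cst. Qed.

Lemma cont_onX D f n : cont_on D f -> cont_on D (fun z => f z ^+ n).
Proof.
move=> cf; elim: n => [|n IH]; first exact: cont_on_cst.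
by under eq_fun do rewrite exprS; exact: cont_onM.
Qed.

Lemma cont_on_max D f (c : R) : cont_on D f -> cont_on D (fun z => Num.max (f z) c).
Proof.
move=> cf z Dz; apply: (@continuous_comp _ _ _ f (fun t : R => Num.max t c)); first exact: cf.
by apply: continuous_max; [exact: cvg_id|exact: cvg_cst].
Qed.

Lemma dx_onM D f fx g gx : dx_on D f fx -> dx_on D g gx ->
  dx_on D (fun z => f z * g z) (fun z => f z * gx z + g z * fx z).
Proof.
move=> hf hg z Dz; apply: is_derive_eq (is_deriveMp (hf z Dz) (hg z Dz)) _.
by rewrite -!surjective_pairing.
Qed.

Lemma dy_onM D f fx g gx : dy_on D f fx -> dy_on D g gx ->
  dy_on D (fun z => f z * g z) (fun z => f z * gx z + g z * fx z).
Proof.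
move=> hf hg z Dz; apply: is_derive_eq (is_deriveMp (hf z Dz) (hg z Dz)) _.
by rewrite -!surjective_pairing.
Qed.

Lemma dx_on_comp D (k k' : R -> R) f fx : kder k k' -> dx_on D f fx ->
  dx_on D (fun z => k (f z)) (fun z => k' (f z) * fx z).
Proof.
move=> hk hf z Dz; apply: is_derive_eq (@is_derive_compp _ k (fun t => f (t, z.2)) _ _ _ (hk _) (hf z Dz)) _.
by rewrite -!surjective_pairing.
Qed.

Lemma dy_on_comp D (k k' : R -> R) f fx : kder k k' -> dy_on D f fx ->
  dy_on D (fun z => k (f z)) (fun z => k' (f z) * fx z).
Proof.
move=> hk hf z Dz; apply: is_derive_eq (@is_derive_compp _ k (fun t => f (z.1, t)) _ _ _ (hk _) (hf z Dz)) _.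
by rewrite -!surjective_pairing.
Qed.

(* Testing the lower bound on the Laplacian of [v] against [posp (n+2) v]. *)
Lemma energy p a v vx vy vxx vyy n (C : R) : 0 < a -> C2on (sq p a) v vx vy vxx vyy ->
  (forall z, sq p a z -> `|z.1 - p.1| = a \/ `|z.2 - p.2| = a -> v z <= 0) ->
  (forall z, sq p a z -> - C <= vxx z + vyy z) ->
  \int[mu]_(z in sq p a) (n.+2%:R * posp n.+1 (v z) * (vx z ^+ 2 + vy z ^+ 2)) <=
  \int[mu]_(z in sq p a) (C * posp n.+2 (v z)).
Proof.
move=> a0 [dx dy dxx dyy c cx cy cxx cyy] bd lap.
have m := @measurable_sq R p a.
have c1 := posp_cont_on (n := n) c; have c2 := posp_cont_on (n := n.+1) c.
have kp : kder (posp n.+2) (fun t : R => n.+2%:R * posp n.+1 t) by move=> t; exact: posp_derive.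
have p0 z : v z <= 0 -> posp n.+2 (v z) = 0.
  by move=> v0; rewrite /posp (max_idPr v0) expr0n.
have hx := dx_onM (dx_on_comp kp dx) dxx.
have hy := dy_onM (dy_on_comp kp dy) dyy.
have cgx : cont_on (sq p a) (fun z => posp n.+2 (v z) * vxx z + vx z * (n.+2%:R * posp n.+1 (v z) * vx z)).
  apply: cont_onD; first exact: cont_onM.
  by do ! apply: cont_onM => //; exact: cont_on_cst.
have cgy : cont_on (sq p a) (fun z => posp n.+2 (v z) * vyy z + vy z * (n.+2%:R * posp n.+1 (v z) * vy z)).
  apply: cont_onD; first exact: cont_onM.
  by do ! apply: cont_onM => //; exact: cont_on_cst.
have Ix : \int[mu]_(z in sq p a) (posp n.+2 (v z) * vxx z + vx z * (n.+2%:R * posp n.+1 (v z) * vx z)) = 0.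
  by apply: (sq_integral_dx a0 hx cgx) => z az z1; rewrite p0 ?mul0r//; apply: bd => //; left.
have Iy : \int[mu]_(z in sq p a) (posp n.+2 (v z) * vyy z + vy z * (n.+2%:R * posp n.+1 (v z) * vy z)) = 0.
  by apply: (sq_integral_dy a0 hy cgy) => z az z1; rewrite p0 ?mul0r//; apply: bd => //; right.
have ix := cont_on_integrable cgx; have iy := cont_on_integrable cgy.
have cl : cont_on (sq p a) (fun z => n.+2%:R * posp n.+1 (v z) * (vx z ^+ 2 + vy z ^+ 2)).
  apply: cont_onM; first by apply: cont_onM => //; exact: cont_on_cst.
  by apply: cont_onD; exact: cont_onX.
have cr : cont_on (sq p a) (fun z => C * posp n.+2 (v z)).
  by apply: cont_onM => //; exact: cont_on_cst.
have il := cont_on_integrable cl; have ir := cont_on_integrable cr.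
(* Adding the vanishing integral of the divergence of posp(v) grad v cancels the gradient term, and
   what is left is the pointwise inequality posp(v) (C + Laplacian v) >= 0. *)
have -> : \int[mu]_(z in sq p a) (C * posp n.+2 (v z)) = \int[mu]_(z in sq p a) (C * posp n.+2 (v z) +
   ((posp n.+2 (v z) * vxx z + vx z * (n.+2%:R * posp n.+1 (v z) * vx z)) +
    (posp n.+2 (v z) * vyy z + vy z * (n.+2%:R * posp n.+1 (v z) * vy z)))).
  have ixy := cont_on_integrable (cont_onD cgx cgy).
  by rewrite (RintegralD m ir ixy) (RintegralD m ix iy) Ix Iy !addr0.
apply: le_Rintegral => //.
  by apply: cont_on_integrable; apply: cont_onD => //; exact: cont_onD.
move=> z az; have := lap z az; have := posp_ge0 n.+2 (v z).
move: (posp n.+2 (v z)) (posp n.+1 (v z)) (n.+2%:R : R) (vx z) (vy z) (vxx z) (vyy z).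
move=> P Q N x y xx yy P0 l; rewrite -subr_ge0.
rewrite (_ : _ - _ = P * (C + (xx + yy))); last by ring.
by rewrite mulr_ge0// -lerBlDl sub0r.
Qed.

Lemma ge0_Rintegral_subset p a z0 r f : 0 < r -> cont_on (sq p a) f ->
  sq z0 r `<=` sq p a -> (forall z, sq p a z -> 0 <= f z) ->
  \int[mu]_(z in sq z0 r) f z <= \int[mu]_(z in sq p a) f z.
Proof.
move=> r0 cf sub f0; have cf' : cont_on (sq z0 r) f by move=> z /sub; exact: cf.
have i1 := cont_on_integrable cf; have i2 := cont_on_integrable cf'.
apply: fine_le; [by apply: integrable_fin_num => //; exact: measurable_sq..|].
apply: ge0_subset_integral => //; try exact: measurable_sq.
by case/integrableP: i1.
Qed.

(** Write q for the power n+1 of the positive part of [v]. Where |D0| >= [dl] the gradient is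
    bounded below, so for large n the energy inequality leaves room for at most half of dl^2 int q
    there: the maximum of dl^2 - D0^2 and 0, weighted by q, has integral at least (dl^2 / 2) int q.
    The square around [z0] bounds int q from below by m0^(n+1) (2 r)^2, and q is at most V^(n+1). *)
Lemma energy_lower p a v vx vy vxx vyy n (C Lam dl V : R) (D0 : R * R -> R) z0 (r m0 : R) :
  0 < a -> C2on (sq p a) v vx vy vxx vyy ->
  (forall z, sq p a z -> `|z.1 - p.1| = a \/ `|z.2 - p.2| = a -> v z <= 0) ->
  (forall z, sq p a z -> - C <= vxx z + vyy z) ->
  0 <= C -> 0 < Lam -> 0 < V -> (forall z, sq p a z -> v z <= V) ->
  cont_on (sq p a) D0 ->
  (forall z, sq p a z -> 0 < v z -> D0 z ^+ 2 <= Lam * (vx z ^+ 2 + vy z ^+ 2)) ->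
  2 * C * Lam * V <= n.+2%:R * dl ^+ 2 ->
  0 < r -> sq z0 r `<=` sq p a -> 0 <= m0 -> (forall z, sq z0 r z -> m0 <= v z) ->
  dl ^+ 2 * 2 * r ^+ 2 * m0 ^+ n.+1 <=
  V ^+ n.+1 * \int[mu]_(z in sq p a) Num.max (dl ^+ 2 - D0 z ^+ 2) 0.
Proof.
move=> a0 c2v bd lap C0 L0 V0 vV cD DL nbig r0 sub m00 mv.
have en := energy n a0 c2v bd lap.
have [dx dy dxx dyy c cx cy cxx cyy] := c2v.
have m := @measurable_sq R p a.
pose q z := posp n.+1 (v z); pose E z := Num.max (dl ^+ 2 - D0 z ^+ 2) 0.
pose N : R := n.+2%:R.
have N0 : 0 < N by rewrite ltr0n.
have cq : cont_on (sq p a) q by exact: posp_cont_on.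
have cE : cont_on (sq p a) E.
  by apply: cont_on_max; apply: cont_onB; [exact: cont_on_cst|exact: cont_onX].
have q0 z : 0 <= q z by exact: posp_ge0.
have E0 z : 0 <= E z by rewrite le_max lexx orbT.
have qV z : sq p a z -> q z <= V ^+ n.+1.
  move=> az; rewrite /q /posp; apply: lerXn2r; rewrite ?nnegrE ?le_max ?lexx ?orbT ?(ltW V0)//.
  by rewrite ge_max vV//= ltW.
set J := \int[mu]_(z in sq p a) q z.
set IE := \int[mu]_(z in sq p a) E z.
have cqE : cont_on (sq p a) (fun z => q z * E z) by exact: cont_onM.
have iq := cont_on_integrable cq; have iE := cont_on_integrable cE.
have iqE := cont_on_integrable cqE.
set l := \int[mu]_(z in sq p a) (n.+2%:R * posp n.+1 (v z) * (vx z ^+ 2 + vy z ^+ 2)) in en.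
have cl : cont_on (sq p a) (fun z => n.+2%:R * posp n.+1 (v z) * (vx z ^+ 2 + vy z ^+ 2)).
  apply: cont_onM; first by apply: cont_onM => //; exact: cont_on_cst.
  by apply: cont_onD; exact: cont_onX.
have il := cont_on_integrable cl.
have step1 : N * dl ^+ 2 * J - N * \int[mu]_(z in sq p a) (q z * E z) <= Lam * l.
  rewrite /J /l -!RintegralZl// -RintegralB//.
  - apply: le_Rintegral => //.
    + apply: cont_on_integrable; apply: cont_onB; apply: cont_onM => //; exact: cont_on_cst.
    + by apply: cont_on_integrable; apply: cont_onM => //; exact: cont_on_cst.
    + move=> z az; have [vz|vz] := ltP 0 (v z); last first.
        have -> : q z = 0 by rewrite /q /posp (max_idPr vz) expr0n.
        have -> : posp n.+1 (v z) = 0 by rewrite /posp (max_idPr vz) expr0n.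
        by rewrite !(mul0r, mulr0) subrr.
      have h1 := DL z az vz; have h2 : dl ^+ 2 - D0 z ^+ 2 <= E z by rewrite le_max lexx.
      have qz := q0 z; rewrite -/(q z) -/N.
      have -> : N * dl ^+ 2 * q z - N * (q z * E z) = N * q z * (dl ^+ 2 - E z) by ring.
      rewrite mulrCA; apply: ler_wpM2l; first by rewrite mulr_ge0// ltW.
      by apply: le_trans h1; lra.
  - by apply: cont_on_integrable; apply: cont_onM => //; exact: cont_on_cst.
  - by apply: cont_on_integrable; apply: cont_onM => //; exact: cont_on_cst.
have step2 : \int[mu]_(z in sq p a) (C * posp n.+2 (v z)) <= C * V * J.
  rewrite /J -RintegralZl//; apply: le_Rintegral => //.
  - apply: cont_on_integrable; apply: cont_onM; [exact: cont_on_cst|exact: posp_cont_on].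
  - by apply: cont_on_integrable; apply: cont_onM => //; exact: cont_on_cst.
  - move=> z az; rewrite -mulrA; apply: ler_wpM2l => //; rewrite /q /posp exprS.
    apply: ler_wpM2r; first exact: posp_ge0.
    by rewrite ge_max vV//= ltW.
have J0 : 0 <= J by apply: Rintegral_ge0.
have step3 : dl ^+ 2 / 2 * J <= \int[mu]_(z in sq p a) (q z * E z).
  have h : Lam * l <= Lam * (C * V * J) by rewrite ler_wpM2l ?(ltW L0)//; exact: le_trans step2.
  have h2 : 2 * C * Lam * V * J <= N * dl ^+ 2 * J by rewrite ler_wpM2r.
  rewrite -(ler_pM2l N0).
  move: (\int[mu]_(z in sq p a) (q z * E z)) step1 h h2 => I; move: (dl ^+ 2) => d; nra.
have step4 : \int[mu]_(z in sq p a) (q z * E z) <= V ^+ n.+1 * IE.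
  rewrite /IE -RintegralZl//; apply: le_Rintegral => //.
  - by apply: cont_on_integrable; apply: cont_onM => //; exact: cont_on_cst.
  - by move=> z az; apply: ler_wpM2r => //; exact: qV.
have step5 : m0 ^+ n.+1 * (r *+ 2) ^+ 2 <= J.
  apply: le_trans (ge0_Rintegral_subset r0 cq sub _) => //.
  have -> : (r *+ 2) ^+ 2 = fine (mu (sq z0 r)) by rewrite lam2_sq// ltW.
  rewrite -Rintegral_cst; last exact: measurable_sq.
  apply: le_Rintegral; first exact: measurable_sq.
  - by apply: cont_on_integrable; exact: cont_on_cst.
  - by apply: cont_on_integrable => z /sub; exact: cq.
  - move=> z rz; rewrite /q /posp; apply: lerXn2r; rewrite ?nnegrE ?le_max ?lexx ?orbT//.
    by rewrite mv.
apply: le_trans step4; apply: le_trans step3.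
have := ler_wpM2l (_ : 0 <= dl ^+ 2 / 2) step5; rewrite divr_ge0 ?sqr_ge0// => /(_ isT).
by apply: le_trans; rewrite le_eqVlt; apply/orP; left; apply/eqP; field.
Qed.
End energy.

Section barrier.
Variable R : realType.
Implicit Types (p z w : R * R) (a : R) (f g : R * R -> R) (D : set (R * R)).
Local Notation mu := (@lam2 R).

Lemma dx_onD D f fx g gx : dx_on D f fx -> dx_on D g gx ->
  dx_on D (fun z => f z + g z) (fun z => fx z + gx z).
Proof. by move=> hf hg z Dz; exact: is_deriveDp (hf z Dz) (hg z Dz). Qed.

Lemma dy_onD D f fx g gx : dy_on D f fx -> dy_on D g gx ->
  dy_on D (fun z => f z + g z) (fun z => fx z + gx z).
Proof. by move=> hf hg z Dz; exact: is_deriveDp (hf z Dz) (hg z Dz). Qed.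

Lemma C2onD D f fx fy fxx fyy g gx gy gxx gyy :
  C2on D f fx fy fxx fyy -> C2on D g gx gy gxx gyy ->
  C2on D (fun z => f z + g z) (fun z => fx z + gx z) (fun z => fy z + gy z)
    (fun z => fxx z + gxx z) (fun z => fyy z + gyy z).
Proof.
move=> [f1 f2 f3 f4 f5 f6 f7 f8 f9] [g1 g2 g3 g4 g5 g6 g7 g8 g9].
by split; first [exact: dx_onD|exact: dy_onD|exact: cont_onD].
Qed.

Lemma cont_on_comp D (k : R -> R) f : continuous k -> cont_on D f -> cont_on D (fun z => k (f z)).
Proof. by move=> ck cf z Dz; apply: (@continuous_comp _ _ _ f k); [exact: cf|exact: ck]. Qed.

Lemma C2on_comp D (k k' k'' : R -> R) f fx fy fxx fyy : kder k k' -> kder k' k'' -> continuous k'' ->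
  C2on D f fx fy fxx fyy ->
  C2on D (fun z => k (f z)) (fun z => k' (f z) * fx z) (fun z => k' (f z) * fy z)
    (fun z => k' (f z) * fxx z + fx z * (k'' (f z) * fx z))
    (fun z => k' (f z) * fyy z + fy z * (k'' (f z) * fy z)).
Proof.
move=> d1 d2 c [f1 f2 f3 f4 f5 f6 f7 f8 f9].
have c1 := kder_continuous d1; have c2 := kder_continuous d2.
split.
- exact: dx_on_comp.
- exact: dy_on_comp.
- by apply: dx_onM => //; exact: dx_on_comp.
- by apply: dy_onM => //; exact: dy_on_comp.
- exact: cont_on_comp.
- by apply: cont_onM => //; exact: cont_on_comp.
- by apply: cont_onM => //; exact: cont_on_comp.
- by apply: cont_onD; apply: cont_onM => //; [exact: cont_on_comp|apply: cont_onM => //; exact: cont_on_comp].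
- by apply: cont_onD; apply: cont_onM => //; [exact: cont_on_comp|apply: cont_onM => //; exact: cont_on_comp].
Qed.

(* Affine with slope [s] on [-tau, X1], and cubically penalised outside. *)
Definition cap (s tau X1 K t : R) : R :=
  s * t + s * tau / 2 - K * (posp 3 (- tau - t) + posp 3 (t - X1)).
Definition cap' (s tau X1 K t : R) : R :=
  s - K * (- (3 * posp 2 (- tau - t)) + 3 * posp 2 (t - X1)).
Definition cap'' (tau X1 K t : R) : R :=
  - (K * (3 * (2 * posp 1 (- tau - t)) + 3 * (2 * posp 1 (t - X1)))).

Lemma posp_subl_derive n (c t : R) :
  is_derive t 1 (fun t => posp n.+2 (c - t)) (- (n.+2%:R * posp n.+1 (c - t))).
Proof.
rewrite -[X in is_derive _ _ _ X]mulrN1.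
exact: (@is_derive_compp _ (posp n.+2) (fun t => c - t) _ _ _ (posp_derive _ _) (is_derive_subl _ _)).
Qed.

Lemma posp_subr_derive n (c t : R) :
  is_derive t 1 (fun t => posp n.+2 (t - c)) (n.+2%:R * posp n.+1 (t - c)).
Proof.
exact: (@is_derive_shift R (posp n.+2) (fun t => n.+2%:R * posp n.+1 t) c t (fun s => posp_derive _ s)).
Qed.

Lemma cap_kder s tau X1 K : kder (cap s tau X1 K) (cap' s tau X1 K).
Proof.
move=> t; rewrite /cap /cap'.
apply: is_deriveBp.
  rewrite -[X in is_derive _ _ _ X]addr0 -[X in is_derive _ _ _ (X + _)]mulr1.
  by apply: is_deriveDp; apply: is_deriveZl; exact: is_derive_id.
apply: is_deriveZl; apply: is_deriveDp; [exact: posp_subl_derive|exact: posp_subr_derive].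
Qed.

Lemma cap'_kder s tau X1 K : kder (cap' s tau X1 K) (cap'' tau X1 K).
Proof.
move=> t; rewrite /cap' /cap''.
have h1 := is_deriveNp (is_deriveZl 3 (posp_subl_derive 0 (- tau) t)).
have h2 := is_deriveZl 3 (posp_subr_derive 0 X1 t).
apply: is_derive_eq (is_deriveBp (is_derive_cst s t 1) (is_deriveZl K (is_deriveDp h1 h2))) _.
by ring.
Qed.

Lemma cap''_continuous tau X1 K : continuous (cap'' tau X1 K).
Proof.
move=> t; apply: cvgN; apply: cvgM; first exact: cvg_cst.
apply: cvgD; apply: cvgM; try exact: cvg_cst; apply: cvgM; try exact: cvg_cst.
  apply: (@continuous_comp _ _ _ (fun t : R => - tau - t) (posp 1)); last exact: posp_continuous.
  by apply: cvgB; [exact: cvg_cst|exact: cvg_id].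
apply: (@continuous_comp _ _ _ (fun t : R => t - X1) (posp 1)); last exact: posp_continuous.
by apply: cvgB; [exact: cvg_id|exact: cvg_cst].
Qed.

Lemma posp_eq0 n (t : R) : t <= 0 -> posp n.+1 t = 0.
Proof. by move=> t0; rewrite /posp (max_idPr t0) expr0n. Qed.

Lemma posp_le n (t c : R) : 0 <= c -> t <= c -> posp n t <= c ^+ n.
Proof.
move=> c0 tc; rewrite /posp; apply: lerXn2r; rewrite ?nnegrE ?le_max ?lexx ?orbT//.
by rewrite ge_max tc.
Qed.

Lemma posp_ge n (t c : R) : 0 <= c -> c <= t -> c ^+ n <= posp n t.
Proof.
move=> c0 tc; rewrite /posp; apply: lerXn2r; rewrite ?nnegrE ?le_max ?lexx ?orbT//.
by rewrite tc.
Qed.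

Lemma cap_le (XM tau s X1 K2 X : R) : 0 <= s -> 0 <= K2 -> X <= XM ->
  cap s tau X1 K2 X <= s * XM + s * tau / 2.
Proof.
move=> s0 K20 XXM; rewrite /cap lerBlDr -[leLHS]addr0; apply: lerD; first by rewrite lerD2r ler_wpM2l.
by rewrite mulr_ge0 ?addr_ge0 ?posp_ge0.
Qed.

(* Where the barrier is positive, the cap is in its affine regime. *)
Lemma cap_pos (Lu XM tau b s kap X1 V K2 K u X Y : R) :
  0 < tau -> 0 < b -> 0 < s -> s * (X1 + 2 * tau) <= kap / 2 -> V = Lu + s * XM + s * tau ->
  0 < K2 -> 0 < K -> K * b ^+ 2 = V -> K2 * tau ^+ 3 = V -> u <= Lu -> X <= XM ->
  (`|X| <= 2 * tau -> `|Y| <= b -> u = 0) ->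
  (`|X - X1| <= tau -> `|Y| <= b -> u <= - (kap / 2)) ->
  0 < u + cap s tau X1 K2 X + - K * Y ^+ 2 ->
  [/\ `|Y| < b, - tau <= X & X <= X1].
Proof.
move=> tau0 b0 s0 sk VE K20 K0 KE K2E uL XXM near0 near1; rewrite mulNr => v0.
have cX := cap_le tau X1 (ltW s0) (ltW K20) XXM.
have st0 : 0 < s * tau by exact: mulr_gt0.
have KY : b <= `|Y| -> V <= K * Y ^+ 2.
  move=> bY; rewrite -KE; apply: ler_wpM2l; first exact: ltW.
  by rewrite -[Y ^+ 2]real_normK ?num_real// lerXn2r ?nnegrE ?(ltW b0).
have K2t t : tau <= t -> V <= K2 * posp 3 t.
  move=> tt; rewrite -K2E; apply: ler_wpM2l; first exact: ltW.
  by apply: posp_ge => //; exact: ltW.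
have Yb : `|Y| < b.
  by rewrite ltNge; apply/negP => /KY; rewrite VE; clear -v0 cX st0 uL; lra.
have v1 : 0 < u + cap s tau X1 K2 X.
  have : 0 <= K * Y ^+ 2 by rewrite mulr_ge0 ?sqr_ge0// ltW.
  by clear -v0; lra.
have kp1 : 0 <= K2 * posp 3 (- tau - X) by rewrite mulr_ge0 ?posp_ge0// ltW.
have kp2 : 0 <= K2 * posp 3 (X - X1) by rewrite mulr_ge0 ?posp_ge0// ltW.
have sXM : s * X <= s * XM by rewrite ler_wpM2l// ltW.
rewrite /cap mulrDr in v1.
split => //.
  rewrite leNgt; apply/negP => Xt.
  have sXt : s * X <= s * - tau by rewrite ler_wpM2l ?(ltW s0)// ltW.
  have [X2t|X2t] := leP (- (2 * tau)) X.
    have u0 : u = 0 by apply: near0; [rewrite ler_norml; clear -X2t Xt tau0; lra|exact: ltW].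
    by rewrite u0 in v1; clear -v1 sXt kp1 kp2 st0; lra.
  have /K2t : tau <= - tau - X by clear -X2t; lra.
  by rewrite VE; clear -v1 sXt kp1 kp2 st0 uL sXM; lra.
rewrite leNgt; apply/negP => X1X.
have [X2t|X2t] := leP X (X1 + tau).
  have u0 : u <= - (kap / 2) by apply: near1; [rewrite ler_norml; clear -X2t X1X tau0; lra|exact: ltW].
  have : s * X <= s * (X1 + tau) by rewrite ler_wpM2l ?(ltW s0)//.
  by clear -v1 kp1 kp2 st0 u0 sk; lra.
have /K2t : tau <= X - X1 by clear -X2t; lra.
by rewrite VE; clear -v1 kp1 kp2 st0 uL sXM; lra.
Qed.

Lemma cap''_ge (tau X1 K2 XM X : R) : 0 < K2 -> 0 <= XM -> 0 < tau -> 0 <= X1 -> `|X| <= XM ->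
  - (12 * K2 * XM) <= cap'' tau X1 K2 X.
Proof.
move=> K20 XM0 tau0 X10; rewrite ler_norml => /andP[Xl Xr]; rewrite /cap'' lerN2.
have q1 : posp 1 (- tau - X) <= XM by rewrite -[leRHS]expr1; apply: posp_le => //; lra.
have q2 : posp 1 (X - X1) <= XM by rewrite -[leRHS]expr1; apply: posp_le => //; lra.
have h1 := ler_wpM2l (ltW K20) q1; have h2 := ler_wpM2l (ltW K20) q2.
by clear -h1 h2; lra.
Qed.

(** The order of quantifiers is the point: [c] depends only on the listed constants, so it can be
    fixed before the mollification parameter tends to 0, while the integral on the right will tend
    to 0. The squared expression is the product of grad X with the gradient of u + s X. *)
Lemma barrier p a z0 (r0 Lu XM Lam LX tau b s kap X1 dl : R) :
  0 < a -> 0 < r0 -> sq z0 r0 `<=` sq p a -> 0 <= Lu -> 0 <= XM -> 0 < Lam -> 0 < LX ->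
  0 < tau -> 0 < b -> 0 < s -> tau <= X1 -> 0 < dl -> s * (X1 + 2 * tau) <= kap / 2 ->
  exists2 c : R, 0 < c & forall u ux uy uxx uyy X Xx Xy Xxx Xyy Y Yx Yy Yxx Yyy,
   C2on (sq p a) u ux uy uxx uyy -> C2on (sq p a) X Xx Xy Xxx Xyy -> C2on (sq p a) Y Yx Yy Yxx Yyy ->
   (forall z, sq p a z -> 0 <= uxx z + uyy z) ->
   (forall z, sq p a z -> [/\ Xxx z + Xyy z = 0, Yxx z + Yyy z = 0, Yx z = - Xy z & Yy z = Xx z]) ->
   (forall z, sq p a z -> [/\ `|u z| <= Lu, `|X z| <= XM, `|Y z| <= XM & Xx z ^+ 2 + Xy z ^+ 2 <= Lam]) ->
   (forall z, sq p a z -> `|X z| <= LX * (`|z.1 - z0.1| + `|z.2 - z0.2|) /\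
                          `|Y z| <= LX * (`|z.1 - z0.1| + `|z.2 - z0.2|)) ->
   (forall z, sq p a z -> `|X z| <= 2 * tau -> `|Y z| <= b -> u z = 0) ->
   (forall z, sq p a z -> `|X z - X1| <= tau -> `|Y z| <= b -> u z <= - (kap / 2)) ->
   (forall z, sq p a z -> `|z.1 - p.1| = a \/ `|z.2 - p.2| = a ->
      b <= `|Y z| \/ X z < - tau \/ X1 < X z) ->
   c <= \int[mu]_(z in sq p a)
      Num.max (dl ^+ 2 - (ux z * Xx z + uy z * Xy z + s * (Xx z ^+ 2 + Xy z ^+ 2)) ^+ 2) 0.
Proof.
move=> a0 r00 subr Lu0 XM0 Lam0 LX0 tau0 b0 s0 tX1 dl0 sk.
pose V := Lu + s * XM + s * tau.
have V0 : 0 < V by rewrite /V ltr_wpDl ?mulr_gt0// addr_ge0// mulr_ge0// ltW.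
have VE : V = Lu + s * XM + s * tau by [].
clearbody V.
(* [V] exceeds every value of [u] plus the tilt, and these coefficients make each penalty reach [V]
   at distance [tau] beyond the affine range of X, respectively at |Y| = [b]. *)
pose K2 := V / tau ^+ 3; pose K := V / b ^+ 2.
have K20 : 0 < K2 by rewrite divr_gt0// exprn_gt0.
have K0 : 0 < K by rewrite divr_gt0// exprn_gt0.
have K2E : K2 * tau ^+ 3 = V by rewrite divfK// expf_neq0// gt_eqF.
have KE : K * b ^+ 2 = V by rewrite divfK// expf_neq0// gt_eqF.
clearbody K2 K.
have KK0 : 0 <= 12 * K2 * XM + 2 * K by have := mulr_ge0 (ltW K20) XM0; lra.
(* The Laplacian of the cap of X is its second derivative, at least -12 K2 XM, times |grad X|^2;
   that of -K Y^2 is -2 K |grad Y|^2. Both squared gradients are at most [Lam]. *)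
pose C := (12 * K2 * XM + 2 * K) * Lam.
have C0 : 0 <= C by exact: mulr_ge0 KK0 (ltW Lam0).
have CE : C = (12 * K2 * XM + 2 * K) * Lam by [].
clearbody C.
pose n := Num.bound (2 * C * Lam * V / dl ^+ 2).
have nbig : 2 * C * Lam * V <= n.+2%:R * dl ^+ 2.
  rewrite -ler_pdivrMr ?exprn_gt0//.
  apply: le_trans (ltW (archi_boundP _)) _; first by rewrite !mulr_ge0// ?invr_ge0 ?exprn_ge0 ?ltW.
  by rewrite ler_nat -/n; exact: leq_trans (leqnSn _) (leqnSn _).
clearbody n.
(* On the square of half-side [r] around [z0] these bounds give |X| <= tau/8, |Y| <= b and K Y^2 <=
   s tau/8. As [u] vanishes there, v >= s tau/2 - s tau/8 - s tau/8, which is the value of [m0]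
   below. *)
pose r := Num.min r0 (Num.min (tau / (16 * LX)) (Num.min (b / (2 * LX)) (s * tau / (16 * LX * (K * XM + 1))))).
have KX1 : 0 < K * XM + 1 by rewrite ltr_wpDl// mulr_ge0// ltW.
have r0' : 0 < r.
  by rewrite !lt_min r00 !divr_gt0 ?mulr_gt0//.
have rr0 : r <= r0 by rewrite /r ge_min lexx.
have rt : 2 * LX * r <= tau / 8.
  have : r <= tau / (16 * LX) by rewrite /r !ge_min lexx !orbT.
  by rewrite ler_pdivlMr ?mulr_gt0//; nra.
have rb : 2 * LX * r <= b.
  have : r <= b / (2 * LX) by rewrite /r !ge_min lexx !orbT.
  by rewrite ler_pdivlMr ?mulr_gt0//; nra.
have rK : K * XM * (2 * LX * r) <= s * tau / 8.
  have : r <= s * tau / (16 * LX * (K * XM + 1)) by rewrite /r !ge_min lexx !orbT.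
  rewrite ler_pdivlMr ?mulr_gt0// => h.
  have : 0 <= r * LX by rewrite mulr_ge0 ?ltW.
  by move: (K * XM) h => k h; nra.
clearbody r.
pose m0 := s * tau / 4.
have m00 : 0 < m0 by rewrite divr_gt0// mulr_gt0.
have mE : m0 = s * tau / 4 by [].
clearbody m0.
exists (dl ^+ 2 * 2 * r ^+ 2 * m0 ^+ n.+1 / V ^+ n.+1).
  have e0 (x : R) m : 0 < x -> 0 < x ^+ m by exact: exprn_gt0.
  have h1 := e0 _ 2 dl0; have h2 := e0 _ 2 r0'; have h3 := e0 _ n.+1 m00; have h4 := e0 _ n.+1 V0.
  exact: divr_gt0 (mulr_gt0 (mulr_gt0 (mulr_gt0 h1 _) h2) h3) h4.
move=> u ux uy uxx uyy X Xx Xy Xxx Xyy Y Yx Yy Yxx Yyy cu cX cY lu har bnd lipX near0 near1 bd.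
rewrite ler_pdivrMr ?exprn_gt0// [leRHS]mulrC.
have cc := cap_kder s tau X1 K2; have cc' := cap'_kder s tau X1 K2.
have c1 : kder (fun t : R => - K * t ^+ 2) (fun t => - K * (2 * t)).
  by move=> t; apply: is_deriveZl; have := is_derive_expn 1 t; rewrite expr1.
have c2 : kder (fun t : R => - K * (2 * t)) (fun=> - K * 2).
  move=> t; apply: is_derive_eq (is_deriveZl (- K) (is_deriveZl 2 (is_derive_id t 1))) _.
  by rewrite mulr1.
have cK : continuous (fun _ : R => - K * 2) by move=> t; exact: cvg_cst.
have C2v := C2onD (C2onD cu (C2on_comp cc cc' (@cap''_continuous tau X1 K2) cX))
              (C2on_comp c1 c2 cK cY).
have capX z : sq p a z -> cap s tau X1 K2 (X z) <= s * XM + s * tau / 2.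
  move=> az; have [_ XL _ _] := bnd z az.
  exact: cap_le (ltW s0) (ltW K20) (le_trans (ler_norm _) XL).
have vpos z : sq p a z -> 0 < u z + cap s tau X1 K2 (X z) + - K * Y z ^+ 2 ->
    [/\ `|Y z| < b, - tau <= X z & X z <= X1].
  move=> az; have [uL XL YM _] := bnd z az.
  apply: (cap_pos tau0 b0 s0 sk VE K20 K0 KE K2E (le_trans (ler_norm _) uL) (le_trans (ler_norm _) XL)).
    by move=> h1 h2; apply: near0.
  by move=> h1 h2; apply: near1.
apply: (@energy_lower R p a _ _ _ _ _ n C Lam dl V
  (fun z => ux z * Xx z + uy z * Xy z + s * (Xx z ^+ 2 + Xy z ^+ 2)) z0 r m0 a0 C2v) => //.
- move=> z az zb; rewrite leNgt; apply/negP => /(vpos z az)[h1 h2 h3].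
  case: (bd z az zb) => [|[]]; [by rewrite leNgt h1|by rewrite ltNge h2|by rewrite ltNge h3].
- move=> z az; have [h1 h2 h3 h4] := har z az; have [_ XL _ gL] := bnd z az.
  have := lu z az; rewrite h3 h4.
  set T1 := cap' _ _ _ _ _; set T2 := cap'' _ _ _ _.
  have T2l : - (12 * K2 * XM) <= T2.
    by apply: cap''_ge => //; apply: le_trans tX1; exact: ltW.
  have : 0 <= (12 * K2 * XM + T2) * (Xx z ^+ 2 + Xy z ^+ 2).
    by apply: mulr_ge0; [rewrite -lerBlDl sub0r|rewrite addr_ge0 ?sqr_ge0].
  have : 0 <= (12 * K2 * XM + 2 * K) * (Lam - (Xx z ^+ 2 + Xy z ^+ 2)).
    by rewrite mulr_ge0 ?subr_ge0.
  have e1 : T1 * Xxx z + T1 * Xyy z = 0 by rewrite -mulrDr h1 mulr0.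
  have e2 : - K * (2 * Y z) * Yxx z + - K * (2 * Y z) * Yyy z = 0 by rewrite -mulrDr h2 mulr0.
  rewrite CE; move: e1 e2.
  move: (T1 * Xxx z) (T1 * Xyy z) (- K * (2 * Y z) * Yxx z) (- K * (2 * Y z) * Yyy z) => e1 e2 e3 e4; clear.
  by lra.
- move=> z az; have [+ _ _ _] := bnd z az; rewrite ler_norml => /andP[_ uL].
  have := capX z az; have : 0 <= K * Y z ^+ 2 by rewrite mulr_ge0 ?sqr_ge0// ltW.
  have st0 : 0 < s * tau by exact: mulr_gt0.
  by rewrite VE mulNr; clear -uL st0; lra.
- have [_ _ _ _ _ ? ? _ _] := cu; have [_ _ _ _ _ ? ? _ _] := cX.
  apply: cont_onD; first by apply: cont_onD; exact: cont_onM.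
  by apply: cont_onM; [exact: cont_on_cst|apply: cont_onD; exact: cont_onX].
- move=> z az /(vpos z az)[h1 h2 h3]; have [_ _ Yx_ Yy_] := har z az; have [_ _ _ gL] := bnd z az.
  have q1 : - tau - X z <= 0 by clear -h2; lra.
  have q2 : X z - X1 <= 0 by clear -h3; lra.
  have -> : cap' s tau X1 K2 (X z) = s by rewrite /cap' (posp_eq0 1 q1) (posp_eq0 1 q2); ring.
  rewrite Yx_ Yy_; set k := - K * (2 * Y z).
  (* Cauchy-Schwarz for grad v and grad X, with the square of their cross product as explicit
     remainder. The term with [k] comes from the penalty in Y and is orthogonal to grad X. *)
  apply: (@le_trans _ _ ((Xx z ^+ 2 + Xy z ^+ 2) * ((ux z + s * Xx z + k * - Xy z) ^+ 2 + (uy z + s * Xy z + k * Xx z) ^+ 2))).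
    rewrite -subr_ge0.
    have -> : (Xx z ^+ 2 + Xy z ^+ 2) * ((ux z + s * Xx z + k * - Xy z) ^+ 2 + (uy z + s * Xy z + k * Xx z) ^+ 2) -
      (ux z * Xx z + uy z * Xy z + s * (Xx z ^+ 2 + Xy z ^+ 2)) ^+ 2 =
      ((ux z + s * Xx z + k * - Xy z) * Xy z - (uy z + s * Xy z + k * Xx z) * Xx z) ^+ 2 by ring.
    exact: sqr_ge0.
  by apply: ler_wpM2r => //; rewrite addr_ge0 ?sqr_ge0.
- by move=> z [z1 z2]; apply: subr; split; [exact: le_trans z1 _|exact: le_trans z2 _].
- exact: ltW.
- move=> z rz; have az : sq p a z.
    by case: rz => z1 z2; apply: subr; split; [exact: le_trans z1 _|exact: le_trans z2 _].
  have dr : LX * (`|z.1 - z0.1| + `|z.2 - z0.2|) <= 2 * LX * r.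
    by case: rz => z1 z2; rewrite (mulrC 2) -mulrA; apply: ler_wpM2l; [exact: ltW|clear -z1 z2; lra].
  have [X_ Y_] := lipX z az.
  have Xs : `|X z| <= tau / 8 by apply: le_trans X_ _; exact: le_trans dr _.
  have Ys : `|Y z| <= 2 * LX * r by exact: le_trans Y_ _.
  have u0 : u z = 0.
    apply: near0 => //; last exact: le_trans Ys _.
    by apply: le_trans Xs _; clear -tau0; lra.
  have [_ _ YM _] := bnd z az.
  have KYs : K * Y z ^+ 2 <= s * tau / 8.
    apply: le_trans rK; rewrite -mulrA; apply: ler_wpM2l; first exact: ltW.
    by rewrite -[Y z ^+ 2]real_normK ?num_real// expr2; apply: ler_pM.
  move: Xs; rewrite ler_norml => /andP[Xl Xr].
  have q1 : - tau - X z <= 0 by clear -Xl tau0; lra.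
  have q2 : X z - X1 <= 0 by clear -Xr tau0 tX1; lra.
  rewrite u0 /cap (posp_eq0 2 q1) (posp_eq0 2 q2).
  have : s * - (tau / 8) <= s * X z by rewrite ler_wpM2l// ltW.
  by rewrite mE mulNr; clear -KYs tau0 s0; lra.
Qed.
End barrier.

(** * Mollified potentials *)

(* Real and imaginary parts of the positivity of [dzbar (P + i N)], tested on products [f(x) g(y)]. *)
Definition weak_Sigma (R : realType) (p : R * R) (a : R) (P N : R * R -> R) :=
  forall f g : R -> R, (forall n, C1n n f) -> (forall n, C1n n g) ->
  (forall s, 0 <= f s) -> (forall s, 0 <= g s) ->
  (forall s, a <= `|s - p.1| -> f s = 0) -> (forall s, a <= `|s - p.2| -> g s = 0) ->
  \int[@lam2 R]_(w in sq p a) (P w * (derive1 f w.1 * g w.2) - N w * (f w.1 * derive1 g w.2)) <= 0 /\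
  \int[@lam2 R]_(w in sq p a) (P w * (f w.1 * derive1 g w.2) + N w * (derive1 f w.1 * g w.2)) = 0.

Section mollified_family.
Variable R : realType.
Implicit Types (z w : R * R) (D : set (R * R)).
Local Notation mR := (measurableTypeR R).
Local Notation R2 := (mR * mR)%type.
Local Notation mu := (@lam2 R).

Section linearity.
Variables (q : R * R) (c : R) (f g : R * R -> R).
Hypotheses (fi : mu.-integrable (sq q c) (EFin \o f)) (gi : mu.-integrable (sq q c) (EFin \o g)).

Lemma sq_integrableD : mu.-integrable (sq q c) (EFin \o (fun z => f z + g z)).
Proof. by have := integrableD (measurable_sq q c) fi gi; apply: eq_integrable; [exact: measurable_sq|]. Qed.

Lemma sq_integrableB : mu.-integrable (sq q c) (EFin \o (fun z => f z - g z)).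
Proof. by have := integrableB (measurable_sq q c) fi gi; apply: eq_integrable; [exact: measurable_sq|]. Qed.

Lemma sq_integrableZ (k : R) : mu.-integrable (sq q c) (EFin \o (fun z => k * f z)).
Proof. by have := integrableZl (measurable_sq q c) k fi; apply: eq_integrable; [exact: measurable_sq|]. Qed.

Lemma sq_integralD : \int[mu]_(z in sq q c) (f z + g z) =
  \int[mu]_(z in sq q c) f z + \int[mu]_(z in sq q c) g z.
Proof. exact: (RintegralD (measurable_sq q c) fi gi). Qed.

Lemma sq_integralB : \int[mu]_(z in sq q c) (f z - g z) =
  \int[mu]_(z in sq q c) f z - \int[mu]_(z in sq q c) g z.
Proof. exact: (RintegralB (measurable_sq q c) fi gi). Qed.

Lemma sq_integralZ (k : R) : \int[mu]_(z in sq q c) (k * f z) = k * \int[mu]_(z in sq q c) f z.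
Proof. exact: (RintegralZl k (measurable_sq q c) fi). Qed.
End linearity.

Lemma C2on_lin D (c1 c2 c3 : R) f fx fy fxx fyy g gx gy gxx gyy :
  C2on D f fx fy fxx fyy -> C2on D g gx gy gxx gyy ->
  C2on D (fun z => c1 * f z + c2 * g z + c3) (fun z => c1 * fx z + c2 * gx z)
    (fun z => c1 * fy z + c2 * gy z)
    (fun z => c1 * fxx z + c2 * gxx z) (fun z => c1 * fyy z + c2 * gyy z).
Proof.
move=> [f1 f2 f3 f4 f5 f6 f7 f8 f9] [g1 g2 g3 g4 g5 g6 g7 g8 g9].
have cl h k : cont_on D h -> cont_on D k -> cont_on D (fun z => c1 * h z + c2 * k z).
  by move=> ch ck; apply: cont_onD; apply: cont_onM => //; exact: cont_on_cst.
split; try exact: cl.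
- move=> z Dz; rewrite -[X in is_derive _ _ _ X]addr0; apply: is_deriveDp.
  by apply: is_deriveDp; apply: is_deriveZl; [exact: f1|exact: g1].
- move=> z Dz; rewrite -[X in is_derive _ _ _ X]addr0; apply: is_deriveDp.
  by apply: is_deriveDp; apply: is_deriveZl; [exact: f2|exact: g2].
- by move=> z Dz; apply: is_deriveDp; apply: is_deriveZl; [exact: f3|exact: g3].
- by move=> z Dz; apply: is_deriveDp; apply: is_deriveZl; [exact: f4|exact: g4].
- by apply: cont_onD; [exact: cl|exact: cont_on_cst].
Qed.

Variables (p : R * R) (a : R).
Hypothesis a0 : 0 < a.
Variables (e : R) (B b b' b'' : R -> R).
Hypothesis e0 : 0 < e.
Hypothesis ea : e <= a / 8.
Hypothesis CB : forall n, C1n n B.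
Hypotheses (dB : kder B b) (db : kder b b') (db' : kder b' b'') (cb'' : continuous b'').
Hypothesis b_ge0 : forall t, 0 <= b t.
Hypothesis B0 : forall t, t <= - e -> B t = 0.
Hypothesis B1 : forall t, e <= t -> B t = 1.
Hypothesis bz : forall t, e < `|t| -> b t = 0.
Local Notation Q := (sq p a).
Local Notation S := (sq p (a / 2)).

Let cB : continuous B. Proof. exact: kder_continuous dB. Qed.
Let cb : continuous b. Proof. exact: kder_continuous db. Qed.
Let cb' : continuous b'. Proof. exact: kder_continuous db'. Qed.

Lemma moll_b'0 t : e < `|t| -> b' t = 0.
Proof.
move=> te; have [_ <-] := db t.
have hn : \near t, 0 = b t.
  near=> s; rewrite bz//; near: s.
  have : {for t, continuous (fun s : R => `|s|)} by exact: norm_continuous.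
  by move=> /(_ _ (lt_nbhsr te)).
by rewrite -(near_eq_derive (1 : R) hn); exact: derive_cst.
Unshelve. all: by end_near. Qed.

(** The kernel centred at a point of the half square vanishes before reaching the sides of the full
    one, which removes every boundary term below. *)
Lemma dist_out (x s c : R) : `|x - c| <= a / 2 -> a <= `|s - c| -> e < `|x - s|.
Proof.
rewrite ler_distl => /andP[x1 x2]; rewrite ler_normr lter_normr => /orP[h|h]; apply/orP.
  by right; have := a0; have := ea; lra.
by left; have := a0; have := ea; lra.
Qed.

Lemma kernel_out x (c s : R) : `|x - c| <= a / 2 -> `|s - c| = a -> b (x - s) = 0 /\ b' (x - s) = 0.
Proof.
move=> xc sa; have es : e < `|x - s| by apply: (dist_out xc); rewrite sa.
by split; [exact: bz|exact: moll_b'0].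
Qed.

Lemma convN g K k1 k2 z : bmeas p a g K -> continuous k1 -> continuous k2 ->
  conv p a (fun w => - g w) k1 k2 z = - conv p a g k1 k2 z.
Proof.
move=> bg c1 c2; rewrite !convE -mulN1r -(sq_integralZ (conv_integrable z bg c1 c2)).
by apply: eq_Rintegral => w _; rewrite mulN1r mulNr.
Qed.

Section harmonic_pair.
Variables (h g al be : R * R -> R).
Hypotheses (ch : cont_on Q h) (cg : cont_on Q g) (cal : cont_on Q al) (cbe : cont_on Q be).
Hypotheses (hx : dx_on Q h al) (hy : dy_on Q h (fun z => - be z)).
Hypotheses (gx : dx_on Q g be) (gy : dy_on Q g al).

(** The first derivatives fall on [h], the second ones on the kernel: [al] and [be] are only assumed
    continuous. *)
Lemma moll_harmonic : C2on S (conv p a h b b) (conv p a al b b) (fun z => - conv p a be b b z)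
    (conv p a al b' b) (fun z => - conv p a be b b' z).
Proof.
have [Kh _ bh] := cont_bmeas ch; have [Ka _ ba] := cont_bmeas cal; have [Kb _ bb] := cont_bmeas cbe.
have cnb : cont_on Q (fun z => - be z) by move=> z Qz; apply: cvgN; exact: cbe.
split.
- move=> z [z1 z2]; apply: is_derive_eq (conv_dx bh db cb' cb (I : setT z)) _.
  by apply: (conv_ibp_x a0 hx ch cal db cb' cb) => s /(kernel_out z1)[].
- move=> z [z1 z2]; apply: is_derive_eq (conv_dy bh cb db cb' (I : setT z)) _.
  rewrite -(convN _ bb cb cb).
  by apply: (conv_ibp_y a0 hy ch cnb cb db cb') => s /(kernel_out z2)[].
- exact: conv_dx ba db cb' cb.
- by move=> z Sz; apply: is_deriveNp; exact: (conv_dy bb cb db cb' Sz).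
- exact: (conv_cont_on bh db cb' db cb').
- exact: (conv_cont_on ba db cb' db cb').
- by move=> z Sz; apply: cvgN; exact: (conv_cont_on bb db cb' db cb' Sz).
- exact: (conv_cont_on ba db' cb'' db cb').
- by move=> z Sz; apply: cvgN; exact: (conv_cont_on bb db cb' db' cb'' Sz).
Qed.

(** By the Cauchy-Riemann equations [al] and [be] are the two partials of [g], so both terms equal
    the convolution of [g] with the kernel b'(x) b'(y). *)
Lemma moll_laplace z : S z -> conv p a al b' b z - conv p a be b b' z = 0.
Proof.
move=> [z1 z2].
rewrite -(conv_ibp_y a0 gy cg cal cb' db cb'); last by move=> s /(kernel_out z2)[].
rewrite -(conv_ibp_x a0 gx cg cbe db cb' cb'); last by move=> s /(kernel_out z1)[].
exact: subrr.
Qed.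
End harmonic_pair.

Variables (P N : R * R -> R) (K : R).
Hypotheses (bP : bmeas p a P K) (bN : bmeas p a N K).
Hypothesis Sig : weak_Sigma p a P N.

Lemma C1n_b n : C1n n b.
Proof.
have -> : b = derive1 B by apply/funext => t; rewrite derive1E; have [_ ->] := dB t.
by have [] := C1n_elim (CB n.+1).
Qed.

Lemma C1n_refl n f (x : R) : C1n n f -> C1n n (fun s => f (x - s)).
Proof.
move=> cf; have := C1n_affine (-1) x cf; congr (C1n _ _).
by apply/funext => s; rewrite mulN1r addrC.
Qed.

Lemma derive1_refl k k' (x s : R) : kder k k' -> derive1 (fun s => k (x - s)) s = - k' (x - s).
Proof.
move=> dk; rewrite derive1E.
by have [_ ->] := @is_derive_compp _ k (fun s => x - s) s _ _ (dk _) (is_derive_subl x s); rewrite mulrN1.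
Qed.

(** The real part of [weak_Sigma] on the kernel reflected about [z]; the reflection turns
    derivatives into -b' and so reverses the inequality. *)
Lemma moll_subharmonic z : S z -> 0 <= conv p a P b' b z - conv p a N b b' z.
Proof.
move=> [z1 z2]; have [h _] := @Sig (fun s => b (z.1 - s)) (fun s => b (z.2 - s))
  (fun n => C1n_refl _ (C1n_b n)) (fun n => C1n_refl _ (C1n_b n)) (fun=> b_ge0 _) (fun=> b_ge0 _)
  (fun s hs => bz (dist_out z1 hs)) (fun s hs => bz (dist_out z2 hs)).
rewrite -oppr_le0 opprB; apply: le_trans h.
have iN := conv_integrable z bN cb cb'; have iP := conv_integrable z bP cb' cb.
rewrite !convE le_eqVlt; apply/orP; left; apply/eqP.
apply: etrans (esym (sq_integralB iN iP)) _; apply: eq_Rintegral => w _.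
by rewrite !(derive1_refl _ _ db) mulNr !mulrN opprK addrC.
Qed.

(** Vanishing curl of the mollified field, integrated from [x] to [y]. The test function is the
    difference B(y - s) - B(x - s) times the kernel in the other variable. It is nonnegative because
    [B] is nondecreasing and x <= y, and it has bounded support because [B] is constant beyond
    distance [e] on each side. *)
Lemma moll_curl (x y t : R) : `|x - p.1| <= a / 2 -> `|y - p.1| <= a / 2 -> `|t - p.2| <= a / 2 ->
  x <= y ->
  conv p a P B b' (y, t) - conv p a P B b' (x, t) +
  (conv p a N b b (y, t) - conv p a N b b (x, t)) = 0.
Proof.
move=> x1 y1 t2 xy.
have mB (u v : R) : u <= v -> B u <= B v.
  move=> uv; have [//|->//] : u < v \/ u = v by move: uv; rewrite le_eqVlt => /orP[/eqP|]; [right|left].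
  move=> {}uv.
  have [c _ E] := MVT_segment (ltW uv) (fun t _ => dB t) (continuous_subspaceT cB).
  by rewrite -subr_ge0 E mulr_ge0 ?subr_ge0 ?(ltW uv)//; exact: b_ge0.
pose f (s : R) := B (y - s) - B (x - s).
have fE : f = fun s => B (y - s) + (- 1) * B (x - s).
  by apply/funext => s; rewrite mulN1r.
have Cf n : C1n n f.
  by rewrite fE; apply: C1nD; [|apply: C1nZ]; apply: C1n_refl.
have f0 s : 0 <= f s by rewrite subr_ge0 mB// lerD2r.
have fz s : a <= `|s - p.1| -> f s = 0.
  rewrite ler_normr /f; move: x1 y1; rewrite !ler_distl => /andP[? ?] /andP[? ?] /orP[h|h].
    by rewrite !B0 ?subrr//; have := a0; have := ea; lra.
  by rewrite !B1 ?subrr//; have := a0; have := ea; lra.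
have df s : derive1 f s = - b (y - s) + b (x - s).
  rewrite derive1E.
  have h1 := @is_derive_compp _ B (fun s => y - s) s _ _ (dB _) (is_derive_subl y s).
  have h2 := @is_derive_compp _ B (fun s => x - s) s _ _ (dB _) (is_derive_subl x s).
  by have [_ ->] := is_deriveBp h1 h2; rewrite !mulrN1 opprK.
have [_ h] := @Sig f (fun s => b (t - s)) Cf (fun n => C1n_refl _ (C1n_b n)) f0 (fun=> b_ge0 _)
  fz (fun s hs => bz (dist_out t2 hs)).
have i1 := conv_integrable (y, t) bP cB cb'; have i2 := conv_integrable (x, t) bP cB cb'.
have i3 := conv_integrable (y, t) bN cb cb; have i4 := conv_integrable (x, t) bN cb cb.
have i12 := sq_integrableB i1 i2; have i34 := sq_integrableB i3 i4.
transitivity (- \int[mu]_(w in Q) (P w * (f w.1 * derive1 (fun s : R => b (t - s)) w.2) +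
        N w * (derive1 f w.1 * b (t - w.2)))); last by rewrite h oppr0.
have E : conv p a P B b' (y, t) - conv p a P B b' (x, t) +
  (conv p a N b b (y, t) - conv p a N b b (x, t)) =
  \int[mu]_(w in Q) (P w * (B (y - w.1) * b' (t - w.2)) - P w * (B (x - w.1) * b' (t - w.2)) +
    (N w * (b (y - w.1) * b (t - w.2)) - N w * (b (x - w.1) * b (t - w.2)))).
  rewrite !convE; apply: esym; apply: etrans (sq_integralD i12 i34) _.
  by congr (_ + _); [exact: sq_integralB i1 i2|exact: sq_integralB i3 i4].
rewrite E -mulN1r; apply: etrans _ (sq_integralZ _ (-1)); last first.
  by have := sq_integrableZ (sq_integrableD i12 i34) (-1); apply: eq_integrable;
    [exact: measurable_sq|move=> w _ /=; rewrite df (derive1_refl _ _ db) /f; congr EFin; ring].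
apply: eq_Rintegral => w _ /=.
by rewrite df (derive1_refl _ _ db) /f; ring.
Qed.

(** A line integral of the field (P_e, -N_e), with P_e and N_e the mollified [P] and [N], along the
    vertical line x = p.1 and then horizontally to [z]. Using [B] as a kernel turns both integrals
    into convolutions, so the derivative rules for [conv] apply; [moll_curl] moves the y-derivative
    from the vertical line to [z]. *)
Definition moll_pot z := conv p a P B b z - conv p a P B b (p.1, z.2) - conv p a N b B (p.1, z.2).

Lemma snd_cont_on (f : R * R -> R) D : cont_on setT f -> cont_on D (fun z => f (p.1, z.2)).
Proof.
move=> cf z _; apply: (@continuous_comp _ _ _ (fun z : R * R => (p.1, z.2)) f); last exact: cf.
move=> A /nbhs_ballP [r /= r0 rA]; apply/nbhs_ballP; exists r => //= w [_ w2].
by apply: rA; split => //=; exact: ballxx.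
Qed.

Lemma moll_pot_C2 : C2on S moll_pot (conv p a P b b) (fun z => - conv p a N b b z)
    (conv p a P b' b) (fun z => - conv p a N b b' z).
Proof.
split.
- move=> z Sz; rewrite /moll_pot /=.
  have h := conv_dx bP dB cb cb Sz.
  have h1 := is_derive_cst (conv p a P B b (p.1, z.2)) z.1 1.
  have h2 := is_derive_cst (conv p a N b B (p.1, z.2)) z.1 1.
  apply: is_derive_eq (is_deriveBp (is_deriveBp h h1) h2) _.
  by rewrite !subr0.
- move=> z Sz; rewrite /moll_pot /=.
  have h1 := conv_dy bP cB db cb' Sz.
  have h2 := conv_dy bP cB db cb' (I : setT (p.1, z.2)).
  have h3 := conv_dy bN cb dB cb (I : setT (p.1, z.2)).
  apply: is_derive_eq (is_deriveBp (is_deriveBp h1 h2) h3) _.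
  have : conv p a P B b' z - conv p a P B b' (p.1, z.2) +
      (conv p a N b b z - conv p a N b b (p.1, z.2)) = 0.
    have [z1 z2] := Sz; have p1 : `|p.1 - p.1| <= a / 2 by rewrite subrr normr0 divr_ge0// ltW.
    rewrite [in X in X - _ + _](surjective_pairing z) [in X in _ + (X - _)](surjective_pairing z).
    have [pz|/ltW pz] := leP p.1 z.1; first exact: moll_curl.
    have := moll_curl z1 p1 z2 pz.
    by move=> h; lra.
  by rewrite addrA [_ + conv p a N b b z]addrC -addrA => /eqP; rewrite addr_eq0 => /eqP ->; rewrite opprK.
- exact: conv_dx bP db cb' cb.
- by move=> z Sz; apply: is_deriveNp; exact: (conv_dy bN cb db cb' Sz).
- apply: cont_onB; first (apply: cont_onB; first exact: (conv_cont_on bP dB cb db cb')).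
    by apply: snd_cont_on; exact: (conv_cont_on bP dB cb db cb').
  by apply: snd_cont_on; exact: (conv_cont_on bN db cb' dB cb).
- exact: (conv_cont_on bP db cb' db cb').
- by move=> z Sz; apply: cvgN; exact: (conv_cont_on bN db cb' db cb' Sz).
- exact: (conv_cont_on bP db' cb'' db cb').
- by move=> z Sz; apply: cvgN; exact: (conv_cont_on bN db cb' db' cb'' Sz).
Qed.

Lemma moll_close g L z (c eta : R) : bmeas p a g L -> S z ->
  (forall w, sq z e w -> `|g w - c| <= eta) -> `|conv p a g b b z - c| <= eta.
Proof.
move=> bg [z1 z2] gc.
apply: (conv_close a0 bg dB cb b_ge0 B0 B1 bz) => //.
by have := a0; have := ea; split; lra.
Qed.
End mollified_family.

(** * The comparison principle *)

Section conformal_estimates.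
Variable R : realType.
Implicit Types (p z w : R * R).
Local Notation mu := (@lam2 R).
Local Notation mR := (measurableTypeR R).

Lemma harmonic_affine p (c : R) h g al be (a1 a2 eta : R) :
  dx_on (sq p c) h al -> dy_on (sq p c) h (fun z => - be z) ->
  dx_on (sq p c) g be -> dy_on (sq p c) g al ->
  (forall z, sq p c z -> `|al z - a1| <= eta /\ `|be z - a2| <= eta) ->
  forall z w, sq p c z -> sq p c w ->
  `|h z - h w - (a1 * (z.1 - w.1) - a2 * (z.2 - w.2))| <= eta * (`|z.1 - w.1| + `|z.2 - w.2|) /\
  `|g z - g w - (a2 * (z.1 - w.1) + a1 * (z.2 - w.2))| <= eta * (`|z.1 - w.1| + `|z.2 - w.2|).
Proof.
move=> hx hy gx gy clo z w cz cw.
have id1 (c1 c2 : R) : dx_on (sq p c) (fun z => c1 * z.1 + c2 * z.2) (fun=> c1).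
  move=> u _ /=; have h1 := is_deriveZl c1 (is_derive_id u.1 1).
  apply: is_derive_eq (is_deriveDp h1 (is_derive_cst (c2 * u.2) u.1 1)) _.
  by rewrite mulr1 addr0.
have id2 (c1 c2 : R) : dy_on (sq p c) (fun z => c1 * z.1 + c2 * z.2) (fun=> c2).
  move=> u _ /=; have h1 := is_deriveZl c2 (is_derive_id u.2 1).
  apply: is_derive_eq (is_deriveDp (is_derive_cst (c1 * u.1) u.2 1) h1) _.
  by rewrite mulr1 add0r.
split.
- have hK u : sq p c u -> `|al u + - a1| <= eta /\ `|- be u + a2| <= eta.
    by move=> /clo[h1 h2]; split; [|rewrite addrC distrC].
  apply: le_trans _ (sq_lip (dx_onD hx (id1 (- a1) a2)) (dy_onD hy (id2 (- a1) a2)) hK cz cw).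
  by rewrite le_eqVlt; apply/orP; left; apply/eqP; congr `|_|; ring.
- have hK u : sq p c u -> `|be u + - a2| <= eta /\ `|al u + - a1| <= eta by move=> /clo[].
  apply: le_trans _ (sq_lip (dx_onD gx (id1 (- a2) (- a1))) (dy_onD gy (id2 (- a2) (- a1))) hK cz cw).
  by rewrite le_eqVlt; apply/orP; left; apply/eqP; congr `|_|; ring.
Qed.

(** Multiplication by a1 + i a2 is inverted through its conjugate. The condition on [eta] absorbs
    half of the left-hand side. *)
Lemma conformal_lower (V c0 eta a1 a2 dx dy hd gd : R) : 0 < c0 -> 0 <= V -> 0 <= eta ->
  `|a1| <= V -> `|a2| <= V -> c0 <= a1 ^+ 2 + a2 ^+ 2 ->
  `|hd - (a1 * dx - a2 * dy)| <= eta * (`|dx| + `|dy|) ->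
  `|gd - (a2 * dx + a1 * dy)| <= eta * (`|dx| + `|dy|) -> 8 * eta * V <= c0 ->
  c0 * (`|dx| + `|dy|) <= 4 * V * (`|hd| + `|gd|).
Proof.
move=> c00 V0 e0 A1 A2 ca e1 e2 ev.
set L1 := a1 * dx - a2 * dy in e1 *; set L2 := a2 * dx + a1 * dy in e2 *.
set dl := `|dx| + `|dy| in e1 e2 *.
have l1 : `|L1| <= `|hd| + eta * dl.
  have := ler_normB hd (hd - L1); rewrite opprB addrCA subrr addr0; lra.
have l2 : `|L2| <= `|gd| + eta * dl.
  have := ler_normB gd (gd - L2); rewrite opprB addrCA subrr addr0; lra.
have a20 : 0 <= a1 ^+ 2 + a2 ^+ 2 by rewrite addr_ge0 ?sqr_ge0.
have nx : (a1 ^+ 2 + a2 ^+ 2) * `|dx| <= V * (`|L1| + `|L2|).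
  rewrite -{1}(ger0_norm a20) -normrM (_ : _ * dx = a1 * L1 + a2 * L2); last by rewrite /L1 /L2; ring.
  by apply: le_trans (ler_normD _ _) _; rewrite !normrM mulrDr; apply: lerD; apply: ler_wpM2r.
have ny : (a1 ^+ 2 + a2 ^+ 2) * `|dy| <= V * (`|L1| + `|L2|).
  rewrite -{1}(ger0_norm a20) -normrM (_ : _ * dy = - a2 * L1 + a1 * L2); last by rewrite /L1 /L2; ring.
  apply: le_trans (ler_normD _ _) _; rewrite !normrM normrN mulrDr.
  by apply: lerD; apply: ler_wpM2r.
have dl0 : 0 <= dl by exact: addr_ge0.
have h1 : c0 * dl <= (a1 ^+ 2 + a2 ^+ 2) * dl by exact: ler_wpM2r.
have h2 : 8 * eta * V * dl <= c0 * dl by exact: ler_wpM2r.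
have h3 : V * (`|L1| + `|L2|) <= V * (`|hd| + `|gd| + 2 * (eta * dl)).
  by apply: ler_wpM2l => //; clear -l1 l2; lra.
have h4 : (a1 ^+ 2 + a2 ^+ 2) * dl = (a1 ^+ 2 + a2 ^+ 2) * `|dx| + (a1 ^+ 2 + a2 ^+ 2) * `|dy|.
  by rewrite -mulrDr.
by clearbody dl L1 L2; clear -nx ny h1 h2 h3 h4; lra.
Qed.

Lemma prod3_dist (V eta dl x d y l D k : R) : 0 <= V -> 0 <= eta -> eta <= V -> 0 <= dl ->
  `|x - l| <= eta -> `|l| <= V -> `|y - k| <= eta -> `|k| <= V ->
  `|d - D| <= eta * dl -> `|D| <= V * dl ->
  `|x * d * y - l * D * k| <= 7 * eta * V ^+ 2 * dl.
Proof.
move=> V0 e0 eV dl0 xl lV yk kV dD DV.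
have yV : `|y| <= 2 * V.
  by have := ler_normD (y - k) k; rewrite subrK; clear -yk kV eV; lra.
have dV : `|d| <= 2 * V * dl.
  have : eta * dl <= V * dl by exact: ler_wpM2r.
  by have := ler_normD (d - D) D; rewrite subrK; clear -dD DV; lra.
(* Replacing one factor at a time costs 4, 2 and 1 times eta V^2 dl, because the factors not yet
   replaced are bounded by twice their limits; hence the constant 7. *)
have -> : x * d * y - l * D * k = (x - l) * (d * y) + l * ((d - D) * y) + l * (D * (y - k)) by ring.
have t1 : `|(x - l) * (d * y)| <= eta * (2 * V * dl * (2 * V)).
  by rewrite !normrM; apply: ler_pM => //; apply: ler_pM.
have t2 : `|l * ((d - D) * y)| <= V * (eta * dl * (2 * V)).
  by rewrite !normrM; apply: ler_pM => //; apply: ler_pM.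
have t3 : `|l * (D * (y - k))| <= V * (V * dl * eta).
  by rewrite !normrM; apply: ler_pM => //; apply: ler_pM.
apply: le_trans (ler_normD _ _) _; apply: le_trans (lerD (ler_normD _ _) (lexx _)) _.
by apply: le_trans (lerD (lerD t1 t2) t3) _; rewrite le_eqVlt; apply/orP; left; apply/eqP; ring.
Qed.

(** In complex notation the expression is Re(x d conj(y)). For x = l, y = k and d = k (dx + i dy) it
    equals |k|^2 Re(l (dx + i dy)), where transversality applies. The four monomials together are
    off by 28 eta V^2 dl, and 224 = 2 * 4 * 28 makes this error at most half of the main term. *)
Lemma trilinear_lower (V c0 eta l1 l2 k1 k2 dx dy d1 d2 x1 x2 y1 y2 : R) :
  0 < c0 -> 0 < V -> 0 <= eta -> eta <= V ->
  `|l1| <= V -> `|l2| <= V -> `|k1| <= V -> `|k2| <= V -> c0 <= k1 ^+ 2 + k2 ^+ 2 ->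
  `|x1 - l1| <= eta -> `|x2 - l2| <= eta -> `|y1 - k1| <= eta -> `|y2 - k2| <= eta ->
  `|d1 - (k1 * dx - k2 * dy)| <= eta * (`|dx| + `|dy|) ->
  `|d2 - (k2 * dx + k1 * dy)| <= eta * (`|dx| + `|dy|) ->
  c0 * (`|dx| + `|dy|) <= 4 * V * `|l1 * dx - l2 * dy| ->
  224 * eta * V ^+ 3 <= c0 ^+ 2 ->
  c0 ^+ 2 * (`|dx| + `|dy|) <= 8 * V * `|x1 * (d1 * y1 + d2 * y2) + x2 * (d1 * y2 - d2 * y1)|.
Proof.
move=> c00 V0 e0 eV L1 L2 K1 K2 ck X1 X2 Y1 Y2 e1 e2 low small.
set dl := `|dx| + `|dy| in e1 e2 low *.
have dl0 : 0 <= dl by exact: addr_ge0.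
set D1 := k1 * dx - k2 * dy in e1; set D2 := k2 * dx + k1 * dy in e2.
have DV1 : `|D1| <= V * dl.
  rewrite /dl mulrDr; apply: le_trans (ler_normB _ _) _; rewrite !normrM.
  by apply: lerD; apply: ler_wpM2r.
have DV2 : `|D2| <= V * dl.
  rewrite /dl mulrDr; apply: le_trans (ler_normD _ _) _; rewrite !normrM.
  by apply: lerD; apply: ler_wpM2r.
have p1 := prod3_dist (ltW V0) e0 eV dl0 X1 L1 Y1 K1 e1 DV1.
have p2 := prod3_dist (ltW V0) e0 eV dl0 X1 L1 Y2 K2 e2 DV2.
have p3 := prod3_dist (ltW V0) e0 eV dl0 X2 L2 Y2 K2 e1 DV1.
have p4 := prod3_dist (ltW V0) e0 eV dl0 X2 L2 Y1 K1 e2 DV2.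
set E := x1 * _ + _; set lam := l1 * dx - l2 * dy in low *.
have main : l1 * D1 * k1 + l1 * D2 * k2 + (l2 * D1 * k2 - l2 * D2 * k1) = (k1 ^+ 2 + k2 ^+ 2) * lam.
  by rewrite /D1 /D2 /lam; ring.
have EE : (k1 ^+ 2 + k2 ^+ 2) * lam = E - ((x1 * d1 * y1 - l1 * D1 * k1) + (x1 * d2 * y2 - l1 * D2 * k2) +
    ((x2 * d1 * y2 - l2 * D1 * k2) - (x2 * d2 * y1 - l2 * D2 * k1))).
  by rewrite -main /E; ring.
have h1 : (k1 ^+ 2 + k2 ^+ 2) * `|lam| <= `|E| + 28 * eta * V ^+ 2 * dl.
  have k0 : 0 <= k1 ^+ 2 + k2 ^+ 2 by rewrite addr_ge0 ?sqr_ge0.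
  rewrite -{1}(ger0_norm k0) -normrM EE; apply: le_trans (ler_normB _ _) _.
  rewrite lerD2l; apply: le_trans (ler_normD _ _) _.
  have := lerD (le_trans (ler_normD _ _) (lerD p1 p2)) (le_trans (ler_normB _ _) (lerD p3 p4)).
  by move=> /le_trans; apply; clear; lra.
have h2 : c0 * `|lam| <= (k1 ^+ 2 + k2 ^+ 2) * `|lam| by exact: ler_wpM2r.
have h3 : c0 * (c0 * dl) <= c0 * (4 * V * `|lam|) by rewrite ler_pM2l.
have h4 : 224 * eta * V ^+ 3 * dl <= c0 ^+ 2 * dl by exact: ler_wpM2r.
have h5 : 4 * V * (c0 * `|lam|) <= 4 * V * (`|E| + 28 * eta * V ^+ 2 * dl).
  by apply: ler_wpM2l; [rewrite mulr_ge0// ltW|exact: le_trans h2 h1].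
by clear -h3 h4 h5; lra.
Qed.

Lemma bounded_cvg_integral p (c : R) (f : nat -> R * R -> R) (K : R) (Z : set (R * R)) :
  (forall n, measurable_fun (sq p c : set (mR * mR)) (f n : _ -> mR)) ->
  (forall n z, sq p c z -> `|f n z| <= K) ->
  mu.-negligible Z -> (forall z, sq p c z -> ~ Z z -> f n z @[n --> \oo] --> (0 : R)) ->
  (\int[mu]_(z in sq p c) f n z) @[n --> \oo] --> (0 : R).
Proof.
move=> cf bf nZ cv.
have m := @measurable_sq R p c.
have mf n : measurable_fun (sq p c) (EFin \o f n).
  by case/integrableP: (sq_integrable (cf n) (bf n)).
have iK : mu.-integrable (sq p c) (EFin \o (fun=> K)).
  by apply: cont_on_integrable; exact: cont_on_cst.
have [] := @dominated_convergence _ _ R mu (sq p c) m (fun n => EFin \o f n) (cst 0) (EFin \o (fun=> K)).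
- exact: mf.
- exact: measurable_cst.
- apply: negligibleS nZ => z /= /not_implyP[cz h]; apply: contrapT => nz; apply: h.
  by apply: cvg_EFin; [exact: nearW|exact: cv].
- exact: iK.
- by apply/aeW => z n cz /=; rewrite lee_fin; exact: bf.
move=> _ _; rewrite integral0 => h.
by apply: fine_cvg.
Qed.
End conformal_estimates.

Section comparison.
Variable R : realType.
Implicit Types (z w : R * R).
Local Notation mu := (@lam2 R).

(** Cramer's rule expresses dx and dy by the two products with l and k; the larger product then
    bounds both. *)
Lemma independent_lower (V c0 l1 l2 k1 k2 dx dy : R) : 0 <= V ->
  `|l1| <= V -> `|l2| <= V -> `|k1| <= V -> `|k2| <= V -> c0 <= `|l1 * k2 - l2 * k1| ->
  `|k1 * dx - k2 * dy| <= `|l1 * dx - l2 * dy| ->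
  c0 * (`|dx| + `|dy|) <= 4 * V * `|l1 * dx - l2 * dy|.
Proof.
move=> V0 L1 L2 K1 K2 cc; set lk := k1 * dx - _; set ll := l1 * dx - _ => lkl.
have nx : `|l1 * k2 - l2 * k1| * `|dx| <= 2 * V * `|ll|.
  rewrite -normrM (_ : _ * dx = k2 * ll - l2 * lk); last by rewrite /ll /lk; ring.
  apply: le_trans (ler_normB _ _) _; rewrite !normrM.
  have h1 : `|k2| * `|ll| <= V * `|ll| by exact: ler_wpM2r.
  have h2 : `|l2| * `|lk| <= V * `|ll| by exact: ler_pM.
  by clear -h1 h2; lra.
have ny : `|l1 * k2 - l2 * k1| * `|dy| <= 2 * V * `|ll|.
  rewrite -normrM (_ : _ * dy = k1 * ll - l1 * lk); last by rewrite /ll /lk; ring.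
  apply: le_trans (ler_normB _ _) _; rewrite !normrM.
  have h1 : `|k1| * `|ll| <= V * `|ll| by exact: ler_wpM2r.
  have h2 : `|l1| * `|lk| <= V * `|ll| by exact: ler_pM.
  by clear -h1 h2; lra.
have h : c0 * (`|dx| + `|dy|) <= `|l1 * k2 - l2 * k1| * (`|dx| + `|dy|).
  by apply: ler_wpM2r => //; exact: addr_ge0.
apply: le_trans h _; rewrite mulrDr; clear -nx ny; lra.
Qed.

(** The affine function of s has only one zero, so one of [s1] and its half will do. *)
Lemma choose_slope (s1 d1 dd : R) : 0 < s1 -> 0 < dd -> exists s, [/\ 0 < s, s <= s1 & d1 + s * dd != 0].
Proof.
move=> s10 dd0; have [h|h] := eqVneq (d1 + s1 * dd) 0; last by exists s1; split.
exists (s1 / 2); split; [lra|lra|].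
have -> : d1 + s1 / 2 * dd = - (s1 * dd / 2) by lra.
by rewrite oppr_eq0 gt_eqF// divr_gt0// mulr_gt0.
Qed.

Lemma affine_upper (V eta l1 l2 dx dy q : R) : 0 <= eta -> eta <= V -> `|l1| <= V -> `|l2| <= V ->
  `|q - (l1 * dx + l2 * dy)| <= eta * (`|dx| + `|dy|) -> `|q| <= 2 * V * (`|dx| + `|dy|).
Proof.
move=> e0 eV L1 L2 qq.
have h1 : `|l1 * dx + l2 * dy| <= V * (`|dx| + `|dy|).
  rewrite mulrDr; apply: le_trans (ler_normD _ _) _; rewrite !normrM.
  by apply: lerD; apply: ler_wpM2r.
have h2 : eta * (`|dx| + `|dy|) <= V * (`|dx| + `|dy|) by apply: ler_wpM2r => //; exact: addr_ge0.
have := ler_normD (q - (l1 * dx + l2 * dy)) (l1 * dx + l2 * dy).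
by rewrite subrK => h3; clear -qq h1 h2 h3; lra.
Qed.

Lemma norm_lowerD (E t m : R) : 2 * m <= `|E| -> t <= m -> 0 <= t -> m <= `|E + t|.
Proof. by move=> h1 h2 h3; have := ler_normB (E + t) t; rewrite addrK (ger0_norm h3); lra. Qed.

(** The product of grad X with the gradient of u + s X when u is the real part of a function with
    derivative x1 + i x2, and X is the real part of conj(d1 + i d2) times a function with derivative
    y1 + i y2. The last term is s |grad X|^2. *)
Definition slopes (d1 d2 s x1 x2 y1 y2 : R) : R :=
  x1 * (d1 * y1 + d2 * y2) + x2 * (d1 * y2 - d2 * y1) + s * ((d1 ^+ 2 + d2 ^+ 2) * (y1 ^+ 2 + y2 ^+ 2)).

Lemma rot_lower (d1 d2 h g X Y : R) : X = d1 * h + d2 * g -> Y = d1 * g - d2 * h ->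
  (d1 ^+ 2 + d2 ^+ 2) * (`|h| + `|g|) <= (`|d1| + `|d2|) * (`|X| + `|Y|).
Proof.
move=> -> ->; set X' := d1 * h + _; set Y' := d1 * g - _.
have dd0 : 0 <= d1 ^+ 2 + d2 ^+ 2 by rewrite addr_ge0 ?sqr_ge0.
have n1 : (d1 ^+ 2 + d2 ^+ 2) * `|h| <= `|d1| * `|X'| + `|d2| * `|Y'|.
  rewrite -{1}(ger0_norm dd0) -normrM (_ : _ * h = d1 * X' - d2 * Y'); last by rewrite /X' /Y'; ring.
  by apply: le_trans (ler_normB _ _) _; rewrite !normrM.
have n2 : (d1 ^+ 2 + d2 ^+ 2) * `|g| <= `|d2| * `|X'| + `|d1| * `|Y'|.
  rewrite -{1}(ger0_norm dd0) -normrM (_ : _ * g = d2 * X' + d1 * Y'); last by rewrite /X' /Y'; ring.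
  by apply: le_trans (ler_normD _ _) _; rewrite !normrM.
by rewrite mulrDr; clear -n1 n2; lra.
Qed.

(** Quantitative injectivity of the coordinate X + i Y: [rot_lower] undoes the factor conj(d1 + i
    d2), and the lower bound on the increment h + i g undoes the function behind it. *)
Lemma rot_close (c0 V t q dl d1 d2 h g X Y : R) : 0 < c0 -> 0 < V -> 0 < d1 ^+ 2 + d2 ^+ 2 ->
  X = d1 * h + d2 * g -> Y = d1 * g - d2 * h -> `|X| + `|Y| <= q ->
  c0 * dl <= 4 * V * (`|h| + `|g|) ->
  4 * V * ((`|d1| + `|d2|) * q) <= t * (c0 * (d1 ^+ 2 + d2 ^+ 2)) -> dl <= t.
Proof.
move=> c00 V0 dd0 XE YE XYq low sm.
have cd : 0 < c0 * (d1 ^+ 2 + d2 ^+ 2) by exact: mulr_gt0.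
rewrite -(ler_pM2r cd); apply: le_trans sm.
have h1 := rot_lower XE YE.
have h2 : (`|d1| + `|d2|) * (`|X| + `|Y|) <= (`|d1| + `|d2|) * q.
  by apply: ler_wpM2l => //; exact: addr_ge0.
have h3 : (d1 ^+ 2 + d2 ^+ 2) * (c0 * dl) <= (d1 ^+ 2 + d2 ^+ 2) * (4 * V * (`|h| + `|g|)).
  by apply: ler_wpM2l => //; exact: ltW.
have -> : dl * (c0 * (d1 ^+ 2 + d2 ^+ 2)) = (d1 ^+ 2 + d2 ^+ 2) * (c0 * dl) by ring.
apply: le_trans h3 _.
have -> : (d1 ^+ 2 + d2 ^+ 2) * (4 * V * (`|h| + `|g|)) = 4 * V * ((d1 ^+ 2 + d2 ^+ 2) * (`|h| + `|g|)) by ring.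
apply: ler_wpM2l; first by rewrite mulr_ge0// ltW.
exact: le_trans h1 h2.
Qed.

Lemma rot_upper (d1 d2 h g q : R) : `|h| <= q -> `|g| <= q ->
  `|d1 * h + d2 * g| <= (`|d1| + `|d2|) * q /\ `|d1 * g - d2 * h| <= (`|d1| + `|d2|) * q.
Proof.
move=> hq gq; rewrite mulrDl; split.
  by apply: le_trans (ler_normD _ _) _; rewrite !normrM; apply: lerD; apply: ler_wpM2l.
by apply: le_trans (ler_normB _ _) _; rewrite !normrM; apply: lerD; apply: ler_wpM2l.
Qed.

Lemma open_sq (O : set (R * R)) z : open O -> O z -> exists2 t : R, 0 < t & sq z t `<=` O.
Proof.
move=> oO Oz; have /nbhs_ballP[e e0 he] : nbhs z O by exact: open_nbhs_nbhs.
exists (e / 2); first by rewrite divr_gt0.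
move=> w [w1 w2]; apply: he; split; rewrite -ball_normE /= distrC.
  by apply: le_lt_trans w1 _; rewrite ltr_pdivrMr// ltr_pMr// ltr1n.
by apply: le_lt_trans w2 _; rewrite ltr_pdivrMr// ltr_pMr// ltr1n.
Qed.

Lemma sq_le (p : R * R) (a b : R) : a <= b -> sq p a `<=` sq p b.
Proof. by move=> ab z [z1 z2]; split; exact: le_trans ab. Qed.

Lemma ler_normB2 (x y c : R) : `|x| <= c -> `|y| <= c -> `|x - y| <= 2 * c.
Proof. by move=> xc yc; apply: le_trans (ler_normB _ _) _; lra. Qed.

Lemma ler_normD2 (x y c : R) : `|x| <= c -> `|y| <= c -> `|x + y| <= 2 * c.
Proof. by move=> xc yc; apply: le_trans (ler_normD _ _) _; lra. Qed.

Lemma norm_sum4 (x y t : R) : 0 <= t -> `|x| <= 2 * t -> `|y| <= t -> `|x| + `|y| <= 4 * t.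
Proof. lra. Qed.

Lemma dist_sum4 (x x' y y' d t : R) : `|x - d| <= t -> `|x' - d| <= t -> `|y| <= t -> `|y'| <= t ->
  `|x - x'| + `|y - y'| <= 4 * t.
Proof.
move=> h1 h2 h3 h4; have := ler_normB2 h1 h2; have := ler_normB2 h3 h4.
by rewrite opprB addrA subrK; lra.
Qed.

Lemma norm_sum_sq z w (t : R) : `|w.1 - z.1| + `|w.2 - z.2| <= t -> sq z t w.
Proof.
by move=> h; split; apply: le_trans h; rewrite ?lerDl ?lerDr.
Qed.

Lemma drop_half (u u1 k m kap : R) : u - u1 <= 2 * k -> 2 * k <= 2 * m -> 4 * m <= kap -> u1 < - kap ->
  u <= - (kap / 2).
Proof. lra. Qed.

Lemma norm_away (x y q rh b : R) : `|x - q| <= rh -> `|y - q| = b -> b - rh <= `|y - x|.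
Proof. by move=> h1 h2; have := ler_normD (y - x) (x - q); rewrite addrA subrK h2; lra. Qed.

Lemma sum32 (x y t d : R) : `|x| <= d -> `|y| < t -> t <= d / 2 -> `|x| + `|y| <= 3 / 2 * d.
Proof. lra. Qed.

Lemma sq_sub (p z : R * R) (a b : R) : sq p (a - b) z -> sq z b `<=` sq p a.
Proof.
move=> [z1 z2] w [w1 w2]; split.
  by have := ler_normD (w.1 - z.1) (z.1 - p.1); rewrite addrA subrK; lra.
by have := ler_normD (w.2 - z.2) (z.2 - p.2); rewrite addrA subrK; lra.
Qed.

Lemma sq_diam (p z w : R * R) (a : R) : sq p a z -> sq p a w -> `|z.1 - w.1| + `|z.2 - w.2| <= 4 * a.
Proof.
move=> [z1 z2] [w1 w2].
have -> : z.1 - w.1 = (z.1 - p.1) - (w.1 - p.1) by ring.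
have -> : z.2 - w.2 = (z.2 - p.2) - (w.2 - p.2) by ring.
have := ler_normB (z.1 - p.1) (w.1 - p.1); have := ler_normB (z.2 - p.2) (w.2 - p.2); lra.
Qed.

Variables (r : nat) (p : R * R) (a : R).
Variables (M : 'I_r -> set (R * R)) (al be H G : 'I_r -> R * R -> R).
Variables (v1 v2 : 'I_r -> R) (K V c0 eta : R).
Local Notation S := (sq p a).
Hypotheses (a0 : 0 < a) (K0 : 0 < K) (V0 : 0 < V) (c00 : 0 < c0) (eta0 : 0 <= eta).
Hypotheses (eta1 : 2 * eta <= V) (eta2 : 16 * eta * V <= c0) (eta3 : 448 * eta * V ^+ 3 <= c0 ^+ 2).
Hypothesis oM : forall i, open (M i).
Hypothesis cov : mu.-negligible (S `\` \bigcup_i M i).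
Hypothesis vV : forall i j, `|v1 i - v1 j| <= V /\ `|v2 i - v2 j| <= V.
Hypothesis vc : forall i j, i != j -> c0 <= (v1 i - v1 j) ^+ 2 + (v2 i - v2 j) ^+ 2.
Hypothesis vx : forall i j k, i != j -> j != k -> i != k ->
  c0 <= `|(v1 i - v1 k) * (v2 j - v2 k) - (v2 i - v2 k) * (v1 j - v1 k)|.
Hypothesis Hx : forall i, dx_on S (H i) (al i).
Hypothesis Hy : forall i, dy_on S (H i) (fun z => - be i z).
Hypothesis Gx : forall i, dx_on S (G i) (be i).
Hypothesis Gy : forall i, dy_on S (G i) (al i).
Hypothesis clo : forall i z, S z -> `|al i z - v1 i| <= eta /\ `|be i z - v2 i| <= eta.

(** Solves 128 V^2 rho / c0 = a - 2 rho. For [z0] and [z1] in the square of half-side [rho], the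
    strip on which the barrier lives then stays within distance a - 2 rho of [z0], away from the
    sides of the large square. *)
Definition rho := a / (2 * (1 + 64 * V ^+ 2 / c0)).

Lemma rho_gt0 : 0 < rho.
Proof.
rewrite /rho divr_gt0// mulr_gt0// ltr_pwDl// divr_ge0 ?mulr_ge0 ?sqr_ge0// ltW//.
Qed.

Lemma rho_small : 64 * V ^+ 2 / c0 * rho + rho <= a / 2.
Proof.
have h : 0 < 1 + 64 * V ^+ 2 / c0 by rewrite ltr_pwDl// divr_ge0 ?mulr_ge0 ?sqr_ge0// ltW.
rewrite -[X in _ + X]mul1r -mulrDl addrC /rho le_eqVlt; apply/orP; left; apply/eqP.
by field; rewrite ?gt_eqF//; rewrite -[X in 0 < X]/_; have := mulr_gt0 h c00; rewrite mulrDl mul1r divfK ?gt_eqF//.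
Qed.

(* The direction of [d] can be nearly orthogonal to at most one of the vectors [v_l - v_j]. *)
Lemma select_index j k0 (dx dy : R) : k0 != j -> exists2 k, k != j &
  forall l, l != j -> l != k ->
  c0 * (`|dx| + `|dy|) <= 4 * V * `|(v1 l - v1 j) * dx - (v2 l - v2 j) * dy|.
Proof.
move=> k0j; pose lam k := `|(v1 k - v1 j) * dx - (v2 k - v2 j) * dy|.
have [k kj kmin] := @Order.TotalTheory.arg_minP _ _ _ k0 (fun k => k != j) lam k0j.
exists k => // l lj lk.
have [l1 l2] := vV l j; have [k1 k2] := vV k j.
by apply: (@independent_lower V c0 _ _ (v1 k - v1 j) (v2 k - v2 j)) => //; [exact: ltW|exact: vx|exact: kmin].
Qed.

Lemma pair_clo i j z : S z -> `|al i z - al j z - (v1 i - v1 j)| <= 2 * eta /\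
  `|be i z - be j z - (v2 i - v2 j)| <= 2 * eta.
Proof.
move=> Sz; have [i1 i2] := clo i Sz; have [j1 j2] := clo j Sz; split.
  rewrite (_ : _ - _ = (al i z - v1 i) - (al j z - v1 j)); last by ring.
  by apply: le_trans (ler_normB _ _) _; lra.
rewrite (_ : _ - _ = (be i z - v2 i) - (be j z - v2 j)); last by ring.
by apply: le_trans (ler_normB _ _) _; lra.
Qed.

Lemma sqnorm_lower i j (y1 y2 : R) : i != j -> `|y1 - (v1 i - v1 j)| <= 2 * eta ->
  `|y2 - (v2 i - v2 j)| <= 2 * eta -> c0 / 2 <= y1 ^+ 2 + y2 ^+ 2 /\ y1 ^+ 2 + y2 ^+ 2 <= 8 * V ^+ 2.
Proof.
move=> ij Y1 Y2; have := vc ij; have [A1 A2] := vV i j.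
set a1 := v1 i - v1 j in Y1 A1 *; set a2 := v2 i - v2 j in Y2 A2 *.
have yV (y b : R) : `|y - b| <= 2 * eta -> `|b| <= V -> `|y| <= 2 * V.
  by move=> h1 h2; have := ler_normD (y - b) b; rewrite subrK; have := eta1; lra.
have sq_le (y : R) : `|y| <= 2 * V -> y ^+ 2 <= 4 * V ^+ 2.
  move=> h; rewrite -[y ^+ 2]real_normK ?num_real//.
  have -> : 4 * V ^+ 2 = (2 * V) ^+ 2 by ring.
  by apply: lerXn2r; rewrite ?nnegrE// mulr_ge0// ltW.
have low (y b : R) : `|y - b| <= 2 * eta -> `|b| <= V -> b ^+ 2 - 4 * eta * V <= y ^+ 2.
  move=> h1 h2; have -> : y ^+ 2 = b ^+ 2 + 2 * (b * (y - b)) + (y - b) ^+ 2 by ring.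
  have : `|b * (y - b)| <= V * (2 * eta) by rewrite normrM; apply: ler_pM.
  by rewrite ler_norml => /andP[h3 _]; have := sqr_ge0 (y - b); lra.
move=> ca; split; last first.
  by have := sq_le _ (yV _ _ Y1 A1); have := sq_le _ (yV _ _ Y2 A2); lra.
by have := low _ _ Y1 A1; have := low _ _ Y2 A2; have := eta2; lra.
Qed.

(** Three cases. For l = j only the term with [s] remains. For l = k the expression factors as (d1 +
    s |d|^2) |y|^2, nonzero by the choice of [s]. For any other l the trilinear part is at least
    twice what the term with [s] can reach. *)
Lemma slopes_lower j k (dx dy d1 d2 s : R) : k != j -> 0 < `|dx| + `|dy| ->
  (forall l, l != j -> l != k ->
    c0 * (`|dx| + `|dy|) <= 4 * V * `|(v1 l - v1 j) * dx - (v2 l - v2 j) * dy|) ->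
  `|d1 - ((v1 k - v1 j) * dx - (v2 k - v2 j) * dy)| <= 2 * eta * (`|dx| + `|dy|) ->
  `|d2 - ((v2 k - v2 j) * dx + (v1 k - v1 j) * dy)| <= 2 * eta * (`|dx| + `|dy|) ->
  0 < d1 ^+ 2 + d2 ^+ 2 -> 0 < s -> d1 + s * (d1 ^+ 2 + d2 ^+ 2) != 0 ->
  s * ((d1 ^+ 2 + d2 ^+ 2) * (8 * V ^+ 2)) <= c0 ^+ 2 * (`|dx| + `|dy|) / (16 * V) ->
  exists2 dl : R, 0 < dl & forall l z, S z ->
    dl <= `|slopes d1 d2 s (al l z - al j z) (be l z - be j z) (al k z - al j z) (be k z - be j z)|.
Proof.
move=> kj dl0 lamlow e1 e2 dd0 s0 sne ssmall.
set dd := d1 ^+ 2 + d2 ^+ 2 in dd0 sne ssmall *.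
set m1 := c0 ^+ 2 * (`|dx| + `|dy|) / (16 * V) in ssmall.
have m10 : 0 < m1 by rewrite /m1 divr_gt0 ?mulr_gt0 ?exprn_gt0.
pose dl := Num.min (s * dd * (c0 / 2)) (Num.min (`|d1 + s * dd| * (c0 / 2)) m1).
have c2 : 0 < c0 / 2 by rewrite divr_gt0.
exists dl.
  by rewrite !lt_min m10 !mulr_gt0 ?normr_gt0.
move=> l z Sz; have [Y1 Y2] := pair_clo k j Sz.
have [ylo yhi] := sqnorm_lower kj Y1 Y2.
have [X1 X2] := pair_clo l j Sz.
set y1 := al k z - al j z in Y1 ylo yhi *; set y2 := be k z - be j z in Y2 ylo yhi *.
have yy0 : 0 <= y1 ^+ 2 + y2 ^+ 2 by rewrite addr_ge0 ?sqr_ge0.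
have [lj|lj] := eqVneq l j.
  rewrite lj !subrr /slopes !mul0r !add0r -/dd.
  apply: (@le_trans _ _ (s * dd * (c0 / 2))); first by rewrite /dl ge_min lexx.
  rewrite [X in `|X|]mulrA ger0_norm; last by rewrite mulr_ge0// mulr_ge0// ltW.
  by apply: ler_wpM2l => //; rewrite mulr_ge0// ltW.
have [lk|lk] := eqVneq l k.
  rewrite lk -/y1 -/y2 /slopes -/dd.
  have -> : y1 * (d1 * y1 + d2 * y2) + y2 * (d1 * y2 - d2 * y1) + s * (dd * (y1 ^+ 2 + y2 ^+ 2)) =
    (d1 + s * dd) * (y1 ^+ 2 + y2 ^+ 2) by ring.
  apply: (@le_trans _ _ (`|d1 + s * dd| * (c0 / 2))); first by rewrite /dl !ge_min lexx orbT.
  by rewrite normrM (ger0_norm yy0); apply: ler_wpM2l.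
set x1 := al l z - al j z in X1 *; set x2 := be l z - be j z in X2 *.
have [l1 l2] := vV l j; have [k1 k2] := vV k j.
have e20 : 0 <= 2 * eta by rewrite mulr_ge0.
have sm : 224 * (2 * eta) * V ^+ 3 <= c0 ^+ 2 by have := eta3; lra.
have := trilinear_lower c00 V0 e20 eta1 l1 l2 k1 k2 (vc kj) X1 X2 Y1 Y2 e1 e2 (lamlow l lj lk) sm.
rewrite /slopes -/dd; set E := x1 * _ + _ => tl.
have E2 : 2 * m1 <= `|E|.
  rewrite /m1 mulrA ler_pdivrMr ?mulr_gt0//; move: tl; set q := c0 ^+ 2 * _; move: `|E| => ee; lra.
have sy : s * (dd * (y1 ^+ 2 + y2 ^+ 2)) <= m1.
  apply: le_trans ssmall; apply: ler_wpM2l; first exact: ltW.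
  by apply: ler_wpM2l => //; exact: ltW.
have sy0 : 0 <= s * (dd * (y1 ^+ 2 + y2 ^+ 2)) by apply: mulr_ge0; [exact: ltW|apply: mulr_ge0 => //; exact: ltW].
apply: (@le_trans _ _ m1); first by rewrite /dl !ge_min lexx !orbT.
exact: norm_lowerD.
Qed.

(** Stated for arbitrary families because it is applied both to [H], [G] and to their
    mollifications, with the same constants. *)
Lemma pair_affine (h g A E : 'I_r -> R * R -> R) k j z w :
  (forall i, dx_on S (h i) (A i)) -> (forall i, dy_on S (h i) (fun z => - E i z)) ->
  (forall i, dx_on S (g i) (E i)) -> (forall i, dy_on S (g i) (A i)) ->
  (forall i z, S z -> `|A i z - v1 i| <= eta /\ `|E i z - v2 i| <= eta) ->
  k != j -> S z -> S w ->
  let hd := (h k z - h j z) - (h k w - h j w) in let gd := (g k z - g j z) - (g k w - g j w) in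
  let dl := `|z.1 - w.1| + `|z.2 - w.2| in
  [/\ `|hd - ((v1 k - v1 j) * (z.1 - w.1) - (v2 k - v2 j) * (z.2 - w.2))| <= 2 * eta * dl,
      `|gd - ((v2 k - v2 j) * (z.1 - w.1) + (v1 k - v1 j) * (z.2 - w.2))| <= 2 * eta * dl,
      c0 * dl <= 4 * V * (`|hd| + `|gd|), `|hd| <= 2 * V * dl & `|gd| <= 2 * V * dl].
Proof.
move=> hx hy gx gy cl kj Sz Sw hd gd dl.
have cl2 u : S u -> `|(A k u - A j u) - (v1 k - v1 j)| <= 2 * eta /\
    `|(E k u - E j u) - (v2 k - v2 j)| <= 2 * eta.
  move=> Su; have [i1 i2] := cl k u Su; have [j1 j2] := cl j u Su; split.
    rewrite (_ : _ - _ = (A k u - v1 k) - (A j u - v1 j)); last by ring.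
    by apply: le_trans (ler_normB _ _) _; lra.
  rewrite (_ : _ - _ = (E k u - v2 k) - (E j u - v2 j)); last by ring.
  by apply: le_trans (ler_normB _ _) _; lra.
have hx' : dx_on S (fun z => h k z - h j z) (fun z => A k z - A j z).
  by move=> u Su; apply: is_deriveBp (hx k u Su) (hx j u Su).
have hy' : dy_on S (fun z => h k z - h j z) (fun z => - (E k z - E j z)).
  by move=> u Su; apply: is_derive_eq (is_deriveBp (hy k u Su) (hy j u Su)) _; rewrite opprB opprK addrC.
have gx' : dx_on S (fun z => g k z - g j z) (fun z => E k z - E j z).
  by move=> u Su; apply: is_deriveBp (gx k u Su) (gx j u Su).
have gy' : dy_on S (fun z => g k z - g j z) (fun z => A k z - A j z).
  by move=> u Su; apply: is_deriveBp (gy k u Su) (gy j u Su).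
have [e1 e2] := harmonic_affine hx' hy' gx' gy' cl2 Sz Sw.
have [k1 k2] := vV k j.
have dl0 : 0 <= dl by exact: addr_ge0.
have e20 : 0 <= 2 * eta by rewrite mulr_ge0.
have bd l1 l2 dx dy q := @affine_upper V (2 * eta) l1 l2 dx dy q e20 eta1.
split => //.
- apply: (conformal_lower c00 (ltW V0) e20 k1 k2 (vc kj) e1 e2).
  by have := eta2; lra.
- by apply: (bd (v1 k - v1 j) (- (v2 k - v2 j)) (z.1 - w.1) (z.2 - w.2)) => //; rewrite ?normrN// mulNr.
- exact: (bd (v2 k - v2 j) (v1 k - v1 j) (z.1 - w.1) (z.2 - w.2)).
Qed.

Variables (pot PP NN pxx pyy : nat -> R * R -> R).
Variables (h g A E hxx hyy gxx gyy : nat -> 'I_r -> R * R -> R).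
Hypothesis potC2 : forall n, C2on S (pot n) (PP n) (fun z => - NN n z) (pxx n) (pyy n).
Hypothesis potL : forall n z, S z -> 0 <= pxx n z + pyy n z.
Hypothesis hC2 : forall n i, C2on S (h n i) (A n i) (fun z => - E n i z) (hxx n i) (hyy n i).
Hypothesis gC2 : forall n i, C2on S (g n i) (E n i) (A n i) (gxx n i) (gyy n i).
Hypothesis hL : forall n i z, S z -> hxx n i z + hyy n i z = 0.
Hypothesis gL : forall n i z, S z -> gxx n i z + gyy n i z = 0.
Hypothesis PNK : forall n z, S z -> `|PP n z| <= K /\ `|NN n z| <= K.
Hypothesis AEK : forall n i z, S z -> `|A n i z| <= K /\ `|E n i z| <= K.
Hypothesis AEclo : forall n i z, S z -> `|A n i z - v1 i| <= eta /\ `|E n i z - v2 i| <= eta.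
Hypothesis h_cvg : forall i z, S z -> h n i z @[n --> \oo] --> H i z.
Hypothesis g_cvg : forall i z, S z -> g n i z @[n --> \oo] --> G i z.
Hypothesis A_cvg : forall i z, S z -> A n i z @[n --> \oo] --> al i z.
Hypothesis E_cvg : forall i z, S z -> E n i z @[n --> \oo] --> be i z.
Hypothesis PP_cvg : forall i z, S z -> M i z -> PP n z @[n --> \oo] --> al i z.
Hypothesis NN_cvg : forall i z, S z -> M i z -> NN n z @[n --> \oo] --> be i z.
Hypothesis PN_eq : forall i z0 (t : R), 0 < t -> sq z0 t `<=` M i -> sq z0 t `<=` S ->
  \forall n \near \oo, forall z, sq z0 (t / 2) z -> PP n z = A n i z /\ NN n z = E n i z.

(** The quantity tested by [barrier] at stage n; at a point of [M l] it converges to the value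
    bounded below in [slopes_lower]. *)
Definition Dn n j k (d1 d2 s : R) z := slopes d1 d2 s (PP n z - A n j z) (NN n z - E n j z)
  (A n k z - A n j z) (E n k z - E n j z).

Lemma Dn_cont n j k (d1 d2 s : R) : cont_on S (Dn n j k d1 d2 s).
Proof.
have [_ _ _ _ _ cP cN _ _] := potC2 n.
have [_ _ _ _ _ cAj _ _ _] := hC2 n j; have [_ _ _ _ _ cAk _ _ _] := hC2 n k.
have [_ _ _ _ _ cEj _ _ _] := gC2 n j; have [_ _ _ _ _ cEk _ _ _] := gC2 n k.
have cN' : cont_on S (NN n).
  rewrite (_ : NN n = fun z => - - NN n z); last by apply/funext => z; rewrite opprK.
  by move=> z Sz; apply: cvgN; exact: cN.
have c1 := cont_onB cP cAj; have c2 := cont_onB cN' cEj.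
have c3 := cont_onB cAk cAj; have c4 := cont_onB cEk cEj.
have cst (c : R) f : cont_on S f -> cont_on S (fun z => c * f z).
  by move=> cf; apply: cont_onM => //; exact: cont_on_cst.
rewrite /Dn /slopes; apply: cont_onD; first apply: cont_onD.
- by apply: cont_onM => //; apply: cont_onD; exact: cst.
- by apply: cont_onM => //; apply: cont_onB; exact: cst.
- apply: (cst s (fun z => (d1 ^+ 2 + d2 ^+ 2) * _)); apply: (cst (d1 ^+ 2 + d2 ^+ 2) (fun z => _ + _)).
  by apply: cont_onD; exact: cont_onX.
Qed.

(** Almost every point lies in some [M l], where the limit of [Dn] has modulus at least [dl]; the
    integrand tends to 0 there and never exceeds dl^2. *)
Lemma error_cvg j k (d1 d2 s dl : R) : 0 < dl ->
  (forall l z, S z ->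
    dl <= `|slopes d1 d2 s (al l z - al j z) (be l z - be j z) (al k z - al j z) (be k z - be j z)|) ->
  (\int[mu]_(z in S) Num.max (dl ^+ 2 - (Dn n j k d1 d2 s z) ^+ 2) 0) @[n --> \oo] --> (0 : R).
Proof.
move=> dl0 low; apply: (@bounded_cvg_integral _ _ _ _ (dl ^+ 2) _ _ _ cov).
- move=> n; apply: measurable_cont_on; first exact: measurable_sq.
  apply: cont_on_max; apply: cont_onB; first exact: cont_on_cst.
  by apply: cont_onX; exact: Dn_cont.
- move=> n z Sz; rewrite ger0_norm ?le_max ?lexx ?orbT// ge_max sqr_ge0 andbT.
  by rewrite gerBl sqr_ge0.
move=> z Sz; rewrite /setD /= => /not_andP[//|/contrapT[l _ Ml]].
set L := slopes d1 d2 s (al l z - al j z) (be l z - be j z) (al k z - al j z) (be k z - be j z).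
have DL : Dn n j k d1 d2 s z @[n --> \oo] --> L.
  have x1 : PP n z - A n j z @[n --> \oo] --> al l z - al j z.
    by apply: cvgB; [exact: PP_cvg|exact: A_cvg].
  have x2 : NN n z - E n j z @[n --> \oo] --> be l z - be j z.
    by apply: cvgB; [exact: NN_cvg|exact: E_cvg].
  have y1 : A n k z - A n j z @[n --> \oo] --> al k z - al j z by apply: cvgB; exact: A_cvg.
  have y2 : E n k z - E n j z @[n --> \oo] --> be k z - be j z by apply: cvgB; exact: E_cvg.
  have Z (c q : R) (f : nat -> R) : f n @[n --> \oo] --> q -> c * f n @[n --> \oo] --> c * q.
    by move=> fl; apply: cvgM => //; exact: cvg_cst.
  have X2 (q : R) (f : nat -> R) : f n @[n --> \oo] --> q -> f n ^+ 2 @[n --> \oo] --> q ^+ 2.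
    by move=> fl; under eq_fun do rewrite expr2; rewrite expr2; exact: cvgM.
  rewrite /Dn /L /slopes; apply: cvgD; first apply: cvgD.
  - by apply: cvgM => //; apply: cvgD; apply: Z.
  - by apply: cvgM => //; apply: cvgB; apply: Z.
  - apply: (Z s _ (fun n => (d1 ^+ 2 + d2 ^+ 2) * _)); apply: (Z (d1 ^+ 2 + d2 ^+ 2) _ (fun n => _ + _)).
    by apply: cvgD; apply: X2.
have Ldl : dl ^+ 2 - L ^+ 2 <= 0.
  rewrite subr_le0 -[L ^+ 2]real_normK ?num_real//.
  by apply: lerXn2r; rewrite ?nnegrE ?(ltW dl0)//; exact: low.
have cf : Num.max (dl ^+ 2 - x ^+ 2) 0 @[x --> L] --> Num.max (dl ^+ 2 - L ^+ 2) 0.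
  apply: (@continuous_max _ _ (fun x : R => dl ^+ 2 - x ^+ 2) (fun=> 0) L); last exact: cvg_cst.
  by apply: cvgB; [exact: cvg_cst|exact: exprn_continuous].
by move: cf; rewrite (max_idPr Ldl) => cf; exact: (cvg_comp _ _ DL cf).
Qed.

Lemma comparison_aux j k z0 z1 (kap t d1 d2 : R) : k != j ->
  sq p rho z0 -> sq p rho z1 -> 0 < kap -> 0 < t -> sq z0 t `<=` M j -> sq z0 t `<=` S ->
  0 < `|z1.1 - z0.1| + `|z1.2 - z0.2| ->
  (forall l, l != j -> l != k ->
    c0 * (`|z1.1 - z0.1| + `|z1.2 - z0.2|) <=
    4 * V * `|(v1 l - v1 j) * (z1.1 - z0.1) - (v2 l - v2 j) * (z1.2 - z0.2)|) ->
  d1 = (H k z1 - H j z1) - (H k z0 - H j z0) -> d2 = (G k z1 - G j z1) - (G k z0 - G j z0) ->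
  \forall n \near \oo, - kap <= (pot n z1 - h n j z1) - (pot n z0 - h n j z0).
Proof.
move=> kj z0r z1r kap0 t0 tM tS dl10 klow d1E d2E.
have ra : rho <= a / 2.
  have := rho_small; have : 0 <= 64 * V ^+ 2 / c0 * rho.
    by rewrite mulr_ge0 ?(ltW rho_gt0)// divr_ge0 ?mulr_ge0 ?sqr_ge0// ltW.
  lra.
have rS : sq p rho `<=` S by move=> z [zz1 zz2]; have := a0; split; lra.
have Sz0 := rS _ z0r; have Sz1 := rS _ z1r.
have [e1 e2 low up1 up2] := pair_affine Hx Hy Gx Gy clo kj Sz1 Sz0.
rewrite -d1E -d2E in e1 e2 low up1 up2.
set dl1 := `|z1.1 - z0.1| + `|z1.2 - z0.2| in dl10 klow e1 e2 low up1 up2.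
have dl1r : dl1 <= 4 * rho by exact: (sq_diam z1r z0r).
pose nd := `|d1| + `|d2|; rewrite -/nd in low.
have nd0 : 0 < nd.
  have := mulr_gt0 c00 dl10; move=> /lt_le_trans/(_ low); rewrite pmulr_rgt0// mulr_gt0//.
have nd4 : nd <= 4 * V * dl1 by rewrite /nd; lra.
set dd := d1 ^+ 2 + d2 ^+ 2.
have dd0 : 0 < dd.
  have dge : 0 <= dd by rewrite addr_ge0 ?sqr_ge0.
  rewrite lt_neqAle dge andbT eq_sym; apply/eqP => /eqP.
  rewrite paddr_eq0 ?sqr_ge0// !sqrf_eq0 => /andP[/eqP q1 /eqP q2].
  by move: nd0; rewrite /nd q1 q2 normr0 addr0 ltxx.
(* The hypothesis of [rot_close] for the whole strip: the conditions |X| <= dd and |Y| < tau <= dd/2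
   give |X| + |Y| <= (3/2) dd. *)
have sm : 4 * V * (nd * (3 / 2 * dd)) <= (a - 2 * rho) * (c0 * dd).
  have n1 : 4 * V * (nd * (3 / 2)) <= (a - 2 * rho) * c0.
    have rs : 128 * V ^+ 2 * rho <= (a - 2 * rho) * c0.
      rewrite -ler_pdivrMr//; have := rho_small.
      have -> : 64 * V ^+ 2 / c0 * rho = (128 * V ^+ 2 * rho / c0) / 2 by field; rewrite gt_eqF.
      lra.
    apply: le_trans rs.
    have n2 : nd * V <= (4 * V * (4 * rho)) * V.
      apply: ler_wpM2r; first exact: ltW.
      by apply: le_trans nd4 _; apply: ler_wpM2l => //; rewrite mulr_ge0// ltW.
    have -> : 4 * V * (nd * (3 / 2)) = 6 * (nd * V) by field.
    have n3 : 0 <= V ^+ 2 * rho by rewrite mulr_ge0 ?sqr_ge0// ltW// rho_gt0.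
    have n4 : 4 * V * (4 * rho) * V = 16 * (V ^+ 2 * rho) by ring.
    have -> : 128 * V ^+ 2 * rho = 128 * (V ^+ 2 * rho) by ring.
    lra.
  have -> : 4 * V * (nd * (3 / 2 * dd)) = 4 * V * (nd * (3 / 2)) * dd by ring.
  by rewrite mulrA; apply: ler_wpM2r => //; exact: ltW.
(* Within [m] of [z0] the function [u] vanishes, since field and branch agree there; within [m] of
   [z1] it stays below -kap/2, since its partials are bounded by 2 K. *)
pose m := Num.min (t / 2) (kap / (4 * K)).
have m0 : 0 < m by rewrite lt_min !divr_gt0 ?mulr_gt0.
have mt : m <= t / 2 by rewrite /m ge_min lexx.
have mK : 4 * K * m <= kap.
  by rewrite mulrC -ler_pdivlMr ?mulr_gt0// /m ge_min lexx orbT.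
(* Two points whose coordinates X and Y differ by at most 4 tau in total are within [m] of each
   other. *)
pose tau := Num.min (dd / 2) (m * c0 * dd / (16 * V * nd)).
have Vnd : 0 < 16 * V * nd by rewrite !mulr_gt0.
have tau0 : 0 < tau by rewrite lt_min !divr_gt0 ?mulr_gt0.
have taud : tau <= dd / 2 by rewrite /tau ge_min lexx.
have taum : 4 * V * (nd * (4 * tau)) <= m * (c0 * dd).
  rewrite (_ : 4 * V * _ = tau * (16 * V * nd)); last by ring.
  by rewrite -ler_pdivlMr// mulrA /tau ge_min lexx orbT.
clearbody m tau.
have dt0 : 0 < dd + 2 * tau by lra.
(* The first bound keeps the tilt below the drop of [u] at [z1]; the second keeps it below the
   transversality of the other branches. *)
pose s1 := Num.min (kap / 2 / (dd + 2 * tau)) (c0 ^+ 2 * dl1 / (16 * V) / (dd * (8 * V ^+ 2))).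
have s10 : 0 < s1.
  by rewrite lt_min !divr_gt0 ?mulr_gt0 ?exprn_gt0.
have [s [s0 ss1 sne]] := choose_slope d1 s10 dd0.
have sk : s * (dd + 2 * tau) <= kap / 2.
  by rewrite -ler_pdivlMr//; apply: le_trans ss1 _; rewrite /s1 ge_min lexx.
have sV : s * (dd * (8 * V ^+ 2)) <= c0 ^+ 2 * dl1 / (16 * V).
  rewrite -ler_pdivlMr ?mulr_gt0 ?exprn_gt0//.
  by apply: le_trans ss1 _; rewrite /s1 ge_min lexx orbT.
have [dl dl0 dlow] := slopes_lower kj dl10 klow e1 e2 dd0 s0 sne sV.
pose Lu := 2 * K * (4 * a); pose LX := nd * (2 * V); pose XM := LX * (4 * a).
have Lu0 : 0 <= Lu by rewrite !mulr_ge0// ltW.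
have LX0 : 0 < LX by rewrite !mulr_gt0.
have XM0 : 0 <= XM by rewrite mulr_ge0 ?(ltW LX0)// mulr_ge0// ltW.
pose Lam := dd * (8 * V ^+ 2).
have Lam0 : 0 < Lam by rewrite !mulr_gt0 ?exprn_gt0.
have t20 : 0 < t / 2 by rewrite divr_gt0.
have tt2 : sq z0 (t / 2) `<=` sq z0 t by apply: sq_le; rewrite ler_pdivrMr// ler_peMr ?ler1n// ltW.
have tX1 : tau <= dd by apply: le_trans taud _; rewrite ler_pdivrMr// ler_peMr ?ler1n// ltW.
(* The end of the affine range is [dd], the limit of X at [z1], and [tau] also serves as the width
   in Y. *)
have [c c_gt0 bar] := @barrier R p a z0 (t / 2) Lu XM Lam LX tau tau s kap dd dl a0 t20
  (subset_trans tt2 tS) Lu0 XM0 Lam0 LX0 tau0 tau0 s0 tX1 dl0 sk.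
have d1_cvg : (h n k z1 - h n j z1) - (h n k z0 - h n j z0) @[n --> \oo] --> d1.
  by rewrite d1E; apply: cvgB; apply: cvgB; exact: h_cvg.
have d2_cvg : (g n k z1 - g n j z1) - (g n k z0 - g n j z0) @[n --> \oo] --> d2.
  by rewrite d2E; apply: cvgB; apply: cvgB; exact: g_cvg.
have X1_cvg : d1 * ((h n k z1 - h n j z1) - (h n k z0 - h n j z0)) +
    d2 * ((g n k z1 - g n j z1) - (g n k z0 - g n j z0)) @[n --> \oo] --> dd.
  rewrite /dd !expr2; apply: cvgD; apply: cvgM => //; exact: cvg_cst.
have Y1_cvg : d1 * ((g n k z1 - g n j z1) - (g n k z0 - g n j z0)) -
    d2 * ((h n k z1 - h n j z1) - (h n k z0 - h n j z0)) @[n --> \oo] --> (0 : R).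
  have -> : (0 : R) = d1 * d2 - d2 * d1 by ring.
  by apply: cvgB; apply: cvgM => //; exact: cvg_cst.
have int_cvg := error_cvg dl0 dlow.
near=> n.
have Xn1 : `|dd - (d1 * ((h n k z1 - h n j z1) - (h n k z0 - h n j z0)) +
    d2 * ((g n k z1 - g n j z1) - (g n k z0 - g n j z0)))| <= tau.
  by near: n; move/cvgrPdist_le : X1_cvg; apply.
have Yn1 : `|d1 * ((g n k z1 - g n j z1) - (g n k z0 - g n j z0)) -
    d2 * ((h n k z1 - h n j z1) - (h n k z0 - h n j z0))| <= tau.
  have -> : forall x : R, `|x| = `|0 - x| by move=> x; rewrite sub0r normrN.
  by near: n; move/cvgrPdist_le : Y1_cvg; apply.
have intn : \int[mu]_(z in S) Num.max (dl ^+ 2 - (Dn n j k d1 d2 s z) ^+ 2) 0 < c.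
  by near: n; apply: (cvgr_lt _ int_cvg).
have PNn : forall z, sq z0 (t / 2) z -> PP n z = A n j z /\ NN n z = E n j z.
  by near: n; exact: PN_eq.
rewrite leNgt; apply/negP => un1.
have aff z w (Sz : S z) (Sw : S w) := pair_affine (fun i => c2_dx (hC2 n i))
  (fun i => c2_dy (hC2 n i)) (fun i => c2_dx (gC2 n i)) (fun i => c2_dy (gC2 n i)) (@AEclo n) kj Sz Sw.
(* The differences are spelled as linear combinations so that they match [C2on_lin] literally. *)
pose hd z := 1 * h n k z + (-1) * h n j z + 0; pose gd z := 1 * g n k z + (-1) * g n j z + 0.
have hdE z w : hd z - hd w = (h n k z - h n j z) - (h n k w - h n j w) by rewrite /hd; ring.
have gdE z w : gd z - gd w = (g n k z - g n j z) - (g n k w - g n j w) by rewrite /gd; ring.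
have uC := C2on_lin 1 (-1) (- (pot n z0 - h n j z0)) (potC2 n) (hC2 n j).
have hC := C2on_lin 1 (-1) 0 (hC2 n k) (hC2 n j).
have gC := C2on_lin 1 (-1) 0 (gC2 n k) (gC2 n j).
have XC := C2on_lin d1 d2 (- (d1 * hd z0 + d2 * gd z0)) hC gC.
have YC := C2on_lin (- d2) d1 (- (d1 * gd z0 - d2 * hd z0)) hC gC.
rewrite -/hd -/gd in XC YC.
have XE z w : (d1 * hd z + d2 * gd z - (d1 * hd z0 + d2 * gd z0)) -
   (d1 * hd w + d2 * gd w - (d1 * hd z0 + d2 * gd z0)) = d1 * (hd z - hd w) + d2 * (gd z - gd w) by ring.
have YE z w : (- d2 * hd z + d1 * gd z - (d1 * gd z0 - d2 * hd z0)) -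
   (- d2 * hd w + d1 * gd w - (d1 * gd z0 - d2 * hd z0)) = d1 * (gd z - gd w) - d2 * (hd z - hd w) by ring.
pose X z := d1 * hd z + d2 * gd z - (d1 * hd z0 + d2 * gd z0).
pose Y z := - d2 * hd z + d1 * gd z - (d1 * gd z0 - d2 * hd z0).
pose u z := 1 * pot n z + (-1) * h n j z - (pot n z0 - h n j z0).
have X0 z : X z = d1 * (hd z - hd z0) + d2 * (gd z - gd z0) by rewrite /X; ring.
have Y0 z : Y z = d1 * (gd z - gd z0) - d2 * (hd z - hd z0) by rewrite /Y; ring.
have near_pt z w (q q' : R) : S z -> S w -> `|X z - X w| + `|Y z - Y w| <= q' ->
    4 * V * (nd * q') <= q * (c0 * dd) -> `|z.1 - w.1| + `|z.2 - w.2| <= q.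
  move=> Sz Sw XYq qsm; have [_ _ lw _ _] := aff _ _ Sz Sw.
  rewrite -hdE -gdE in lw.
  exact: (rot_close c00 V0 dd0 (XE z w) (YE z w) XYq lw qsm).
have uz0 : u z0 = 0 by rewrite /u; ring.
have Xz0 : X z0 = 0 by rewrite /X; ring.
have Yz0 : Y z0 = 0 by rewrite /Y; ring.
have u1 : u z1 < - kap by apply: le_lt_trans un1; rewrite /u mul1r mulN1r.
have X1 : `|X z1 - dd| <= tau by rewrite distrC X0 hdE gdE.
have Y1 : `|Y z1| <= tau by rewrite Y0 hdE gdE.
have ulip z w : S z -> S w -> `|u z - u w| <= 2 * K * (`|z.1 - w.1| + `|z.2 - w.2|).
  apply: (sq_lip (c2_dx uC) (c2_dy uC)) => y Sy.
  have [p1 p2] := PNK n Sy; have [q1 q2] := AEK n j Sy; rewrite !mul1r !mulN1r opprK.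
  by split; [exact: ler_normB2|apply: ler_normD2 => //; rewrite normrN].
have grad2 z : S z -> (d1 * (1 * A n k z + -1 * A n j z) + d2 * (1 * E n k z + -1 * E n j z)) ^+ 2 +
    (d1 * (1 * - E n k z + -1 * - E n j z) + d2 * (1 * A n k z + -1 * A n j z)) ^+ 2 =
    dd * ((A n k z - A n j z) ^+ 2 + (E n k z - E n j z) ^+ 2).
  by move=> Sz; rewrite /dd; ring.
have lowint := bar _ _ _ _ _ _ _ _ _ _ _ _ _ _ _ uC XC YC.
suff : c <= \int[mu]_(z in S) Num.max (dl ^+ 2 - (Dn n j k d1 d2 s z) ^+ 2) 0 by rewrite leNgt intn.
apply: le_trans (lowint _ _ _ _ _ _ _) _ => [z Sz|z Sz|z Sz|z Sz|z Sz Xt Yt|z Sz Xt Yt|z Sz bz|].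
- have := potL n Sz; have := hL n j Sz; set q1 := pxx _ _; set q2 := pyy _ _; set q3 := hxx _ _ _; set q4 := hyy _ _ _.
  move=> q34 q12; suff -> : 1 * q1 + -1 * q3 + (1 * q2 + -1 * q4) = q1 + q2 - (q3 + q4) by rewrite q34 subr0.
  by ring.
- have := hL n j Sz; have := hL n k Sz; have := gL n j Sz; have := gL n k Sz => G1 G2 H1 H2.
  split; [| |ring|ring].
    rewrite [LHS](_ : _ = d1 * ((hxx n k z + hyy n k z) - (hxx n j z + hyy n j z)) +
      d2 * ((gxx n k z + gyy n k z) - (gxx n j z + gyy n j z))); last by ring.
    by rewrite G1 G2 H1 H2; ring.
  rewrite [LHS](_ : _ = - d2 * ((hxx n k z + hyy n k z) - (hxx n j z + hyy n j z)) +
      d1 * ((gxx n k z + gyy n k z) - (gxx n j z + gyy n j z))); last by ring.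
  by rewrite G1 G2 H1 H2; ring.
- have [_ _ _ hup gup] := aff _ _ Sz Sz0; rewrite -hdE -gdE in hup gup.
  have [Xup Yup] := rot_upper d1 d2 hup gup; have dia := sq_diam Sz Sz0.
  have XMd : (`|d1| + `|d2|) * (2 * V * (`|z.1 - z0.1| + `|z.2 - z0.2|)) <= XM.
    by rewrite mulrA mulrA -(mulrA nd) -/LX; apply: ler_wpM2l => //; exact: ltW.
  split.
  + have := ulip _ _ Sz Sz0; rewrite uz0 subr0 => /le_trans; apply.
    by apply: ler_wpM2l => //; rewrite mulr_ge0// ltW.
  + by rewrite -/(X z) X0; exact: le_trans Xup XMd.
  + by rewrite -/(Y z) Y0; exact: le_trans Yup XMd.
  + rewrite grad2//; apply: ler_wpM2l; first exact: ltW.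
    have cl i : `|A n i z - v1 i| <= eta /\ `|E n i z - v2 i| <= eta by exact: AEclo.
    have [k1 k2] := cl k; have [j1 j2] := cl j.
    suff [] : c0 / 2 <= (A n k z - A n j z) ^+ 2 + (E n k z - E n j z) ^+ 2 /\
      (A n k z - A n j z) ^+ 2 + (E n k z - E n j z) ^+ 2 <= 8 * V ^+ 2 by [].
    apply: (sqnorm_lower kj).
      rewrite (_ : _ - _ = (A n k z - v1 k) - (A n j z - v1 j)); last by ring.
      exact: ler_normB2.
    rewrite (_ : _ - _ = (E n k z - v2 k) - (E n j z - v2 j)); last by ring.
    exact: ler_normB2.
- have [_ _ _ hup gup] := aff _ _ Sz Sz0; rewrite -hdE -gdE in hup gup.
  have [Xup Yup] := rot_upper d1 d2 hup gup.
  have LE : (`|d1| + `|d2|) * (2 * V * (`|z.1 - z0.1| + `|z.2 - z0.2|)) =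
     LX * (`|z.1 - z0.1| + `|z.2 - z0.2|) by rewrite /LX /nd; ring.
  by rewrite -/(X z) -/(Y z) X0 Y0 -LE.
- rewrite -/(X z) in Xt; rewrite -/(Y z) in Yt; rewrite -/(u z).
  have dz : `|z.1 - z0.1| + `|z.2 - z0.2| <= m.
    apply: (near_pt _ _ _ (4 * tau) Sz Sz0); last exact: taum.
    by rewrite Xz0 Yz0 !subr0; apply: norm_sum4 => //; exact: ltW.
  have sz : sq z0 (t / 2) z by apply: norm_sum_sq; exact: le_trans dz mt.
  have sz0 : sq z0 (t / 2) z0 by split; rewrite subrr normr0 ltW.
  have sub y : sq z0 (t / 2) y -> S y by move=> /tt2/tS.
  have ux0 : dx_on (sq z0 (t / 2)) u (fun y => 1 * PP n y + -1 * A n j y).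
    by move=> y sy; apply: (c2_dx uC); exact: sub.
  have uy0 : dy_on (sq z0 (t / 2)) u (fun y => 1 * - NN n y + -1 * - E n j y).
    by move=> y sy; apply: (c2_dy uC); exact: sub.
  (* Lipschitz constant 0: both partials of [u] vanish on this square, and [u] vanishes at its
     centre. *)
  have := @sq_lip _ z0 (t / 2) u _ _ 0 ux0 uy0 _ z z0 sz sz0.
  rewrite mul0r uz0 subr0 normr_le0 => q; apply/eqP; apply: q => y sy.
  by have [-> ->] := PNn _ sy; split; rewrite normr_le0; apply/eqP; ring.
- rewrite -/(X z) in Xt; rewrite -/(Y z) in Yt; rewrite -/(u z).
  have dz : `|z.1 - z1.1| + `|z.2 - z1.2| <= m.
    apply: (near_pt _ _ _ (4 * tau) Sz Sz1); last exact: taum.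
    exact: (dist_sum4 Xt X1 Yt Y1).
  have := ulip _ _ Sz Sz1; rewrite ler_norml => /andP[_ ub].
  have Km : 2 * (K * (`|z.1 - z1.1| + `|z.2 - z1.2|)) <= 2 * (K * m).
    by apply: ler_wpM2l => //; apply: ler_wpM2l => //; exact: ltW.
  by rewrite -!mulrA in ub mK; exact: drop_half ub Km mK u1.
(* A boundary point in the strip would be within a - 2 rho of [z0], whereas every boundary point is
   at distance at least a - rho from it. *)
- rewrite -/(X z) -/(Y z); have [|Ylt] := leP tau `|Y z|; first by left.
  right; have [|Xge] := ltP (X z) (- tau); [by left|right].
  rewrite ltNge; apply/negP => Xle.
  have Xd : `|X z| <= dd by rewrite ler_norml Xle andbT; apply: le_trans Xge; rewrite lerN2.
  have away : a - rho <= `|z.1 - z0.1| + `|z.2 - z0.2|.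
    have [q1 q2] := z0r; case: bz => bz.
      by apply: le_trans (norm_away q1 bz) _; rewrite lerDl.
    by apply: le_trans (norm_away q2 bz) _; rewrite lerDr.
  have := near_pt z z0 (a - 2 * rho) (3 / 2 * dd) Sz Sz0; rewrite Xz0 Yz0 !subr0 => q.
  have := q (sum32 Xd Ylt taud) sm; rewrite leNgt => /negP; apply.
  by apply: lt_le_trans away; rewrite ltrD2l ltrN2 ltr_pMl ?rho_gt0// ltr1n.
- rewrite le_eqVlt; apply/orP; left; apply/eqP; apply: eq_Rintegral => z _.
  by congr (Num.max (_ - _ ^+ 2) 0); rewrite /Dn /slopes; ring.
Unshelve. all: end_near. Qed.

Lemma comparison j k0 z0 z1 (kap : R) : k0 != j -> M j z0 -> sq p rho z0 -> sq p rho z1 -> 0 < kap ->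
  \forall n \near \oo, - kap <= (pot n z1 - h n j z1) - (pot n z0 - h n j z0).
Proof.
move=> k0j Mz0 z0r z1r kap0.
have [|dl0] := leP (`|z1.1 - z0.1| + `|z1.2 - z0.2|) 0.
  move=> le0; have /eqP : `|z1.1 - z0.1| + `|z1.2 - z0.2| = 0 by apply/eqP; rewrite eq_le le0 addr_ge0.
  rewrite paddr_eq0// !normr_eq0 !subr_eq0 => /andP[/eqP e1 /eqP e2].
  have -> : z1 = z0 by rewrite [z1]surjective_pairing [z0]surjective_pairing e1 e2.
  by near=> n; rewrite subrr oppr_le0 ltW.
have [k kj klow] := select_index (z1.1 - z0.1) (z1.2 - z0.2) k0j.
have [t t0 tM] := open_sq (@oM j) Mz0.
have ra : rho <= a / 2.
  have := rho_small; have : 0 <= 64 * V ^+ 2 / c0 * rho.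
    by rewrite mulr_ge0 ?(ltW rho_gt0)// divr_ge0 ?mulr_ge0 ?sqr_ge0// ltW.
  lra.
pose t' := Num.min t (a / 2).
have t'0 : 0 < t' by rewrite lt_min t0 divr_gt0.
have t't : t' <= t by rewrite /t' ge_min lexx.
have t'a : t' <= a / 2 by rewrite /t' ge_min lexx orbT.
apply: (comparison_aux kj z0r z1r kap0 t'0 _ _ dl0 klow erefl erefl).
  by move=> w [w1 w2]; apply: tM; split; lra.
apply: sq_sub; case: z0r => q1 q2; split; lra.
Unshelve. all: end_near. Qed.
End comparison.

Lemma rho_le (R : realType) (a V c0 : R) : 0 < a -> 0 < V -> 0 < c0 -> rho a V c0 <= a / 2.
Proof.
move=> a0 V0 c00; apply: le_trans (rho_small a V0 c00).
rewrite lerDr mulr_ge0//; last by rewrite ltW// rho_gt0.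
by rewrite divr_ge0 ?mulr_ge0 ?sqr_ge0// ltW.
Qed.

Lemma sum_lower (R : realType) (k x y s t u v : R) : - (k / 2) <= (x - y) - (s - t) ->
  - (k / 2) <= (s - u) - (x - v) -> 0 - ((v - y) - (u - t) + k) <= 0.
Proof. lra. Qed.

(** * Ordering of the branches on the pieces *)

Section piecewise_order.
Variable R : realType.
Implicit Types (z w : R * R).
Local Notation mu := (@lam2 R).
Variables (r : nat) (p : R * R) (a : R).
Variables (M : 'I_r -> set (R * R)) (al be H G : 'I_r -> R * R -> R) (P N : R * R -> R).
Variables (v1 v2 : 'I_r -> R) (K V c0 eta : R).
Local Notation Q := (sq p a).
Local Notation S := (sq p (a / 2)).
Hypotheses (a0 : 0 < a) (K0 : 0 < K) (V0 : 0 < V) (c00 : 0 < c0) (eta0 : 0 <= eta).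
Hypotheses (eta1 : 2 * eta <= V) (eta2 : 16 * eta * V <= c0) (eta3 : 448 * eta * V ^+ 3 <= c0 ^+ 2).
Hypothesis oM : forall i, open (M i).
Hypothesis cov : mu.-negligible (S `\` \bigcup_i M i).
Hypothesis vV : forall i j, `|v1 i - v1 j| <= V /\ `|v2 i - v2 j| <= V.
Hypothesis vc : forall i j, i != j -> c0 <= (v1 i - v1 j) ^+ 2 + (v2 i - v2 j) ^+ 2.
Hypothesis vx : forall i j k, i != j -> j != k -> i != k ->
  c0 <= `|(v1 i - v1 k) * (v2 j - v2 k) - (v2 i - v2 k) * (v1 j - v1 k)|.
Hypothesis cH : forall i, cont_on Q (H i).
Hypothesis cG : forall i, cont_on Q (G i).
Hypothesis cal : forall i, cont_on Q (al i).
Hypothesis cbe : forall i, cont_on Q (be i).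
Hypothesis Hx : forall i, dx_on Q (H i) (al i).
Hypothesis Hy : forall i, dy_on Q (H i) (fun z => - be i z).
Hypothesis Gx : forall i, dx_on Q (G i) (be i).
Hypothesis Gy : forall i, dy_on Q (G i) (al i).
Hypothesis clo : forall i z, Q z -> `|al i z - v1 i| <= eta /\ `|be i z - v2 i| <= eta.
Hypothesis abK : forall i z, Q z -> `|al i z| <= K /\ `|be i z| <= K.
Hypotheses (bP : bmeas p a P K) (bN : bmeas p a N K).
Hypothesis PNM : forall i z, M i z -> P z = al i z /\ N z = be i z.
Hypothesis Sig : weak_Sigma p a P N.

Variables (e : nat -> R) (B : nat -> R -> R).
Hypotheses (ea : forall n, e n <= a / 8) (e_cvg : e n @[n --> \oo] --> (0 : R)).
Hypothesis CB : forall n m, C1n m (B n).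
Hypothesis b_ge0 : forall n t, 0 <= derive1 (B n) t.
Hypothesis B0 : forall n t, t <= - e n -> B n t = 0.
Hypothesis B1 : forall n t, e n <= t -> B n t = 1.
Hypothesis bz : forall n t, e n < `|t| -> derive1 (B n) t = 0.
Let b n := derive1 (B n).
Let b' n := derive1 (b n).
Let b'' n := derive1 (b' n).

Let dB n : kder (B n) (b n). Proof. by have [] := C1n_elim (CB n 1). Qed.
Let Cb n m : C1n m (b n). Proof. by have [] := C1n_elim (CB n m.+1). Qed.
Let db n : kder (b n) (b' n). Proof. by have [] := C1n_elim (Cb n 1). Qed.
Let Cb' n m : C1n m (b' n). Proof. by have [] := C1n_elim (Cb n m.+1). Qed.
Let db' n : kder (b' n) (b'' n). Proof. by have [] := C1n_elim (Cb' n 1). Qed.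
Let cb n : continuous (b n). Proof. exact: C1n_cont (Cb n 0). Qed.
Let cb' n : continuous (b' n). Proof. exact: C1n_cont (Cb' n 0). Qed.
Let cb'' n : continuous (b'' n).
Proof. by have [_ h] := C1n_elim (Cb' n 1); exact: C1n_cont h. Qed.
Let SQ : S `<=` Q. Proof. by apply: sq_le; rewrite ler_pdivrMr// ler_peMr ?ler1n// ltW. Qed.
Let bal i : bmeas p a (al i) K.
Proof.
split; last by move=> z Qz; have [] := abK i Qz.
by apply: measurable_cont_on (@cal i); exact: measurable_sq.
Qed.
Let bbe i : bmeas p a (be i) K.
Proof.
split; last by move=> z Qz; have [] := abK i Qz.
by apply: measurable_cont_on (@cbe i); exact: measurable_sq.
Qed.

Let sub_e n z : S z -> sq z (e n) `<=` Q.
Proof.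
move=> [z1 z2]; apply: sq_sub; have := ea n; have := a0.
by split; lra.
Qed.

Let closeS n g L z (c d : R) : bmeas p a g L -> S z ->
  (forall w, sq z (e n) w -> `|g w - c| <= d) -> `|conv p a g (b n) (b n) z - c| <= d.
Proof.
exact: (moll_close a0 (ea n) (dB n) (db n) (@b_ge0 n) (@B0 n) (@B1 n) (@bz n)).
Qed.

Lemma conv_near_cvg f g L z (t : R) : bmeas p a g L -> S z -> 0 < t ->
  (forall w, sq z t w -> g w = f w) -> {for z, continuous f} ->
  conv p a g (b n) (b n) z @[n --> \oo] --> f z.
Proof.
move=> bg Sz t0 gf cf; apply/cvgrPdist_le => d d0.
have /nbhs_ballP[q /= q0 hq] : nbhs z [set w | `|f z - f w| <= d] by move/cvgrPdist_le : cf; apply.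
near=> n; rewrite distrC; apply: (closeS bg Sz) => w [w1 w2].
have en : e n < q.
  by near: n; exact: (cvgr_lt _ e_cvg).
have ent : e n <= t by near: n; exact: (cvgr_le _ e_cvg).
rewrite gf; last by split; exact: le_trans ent.
rewrite distrC; apply: hq; split; rewrite /ball /= distrC.
  exact: le_lt_trans en.
exact: le_lt_trans en.
Unshelve. all: end_near. Qed.

Lemma conv_cvg g z : cont_on Q g -> S z -> conv p a g (b n) (b n) z @[n --> \oo] --> g z.
Proof.
move=> cg Sz; have [L _ bg] := cont_bmeas cg.
exact: (conv_near_cvg bg Sz ltr01 (fun _ _ => erefl) (cg _ (SQ Sz))).
Qed.

Lemma conv_eq_near f g L1 L2 z0 (t : R) : bmeas p a g L1 -> bmeas p a f L2 -> 0 < t ->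
  sq z0 t `<=` S -> (forall w, sq z0 t w -> g w = f w) ->
  \forall n \near \oo, forall z, sq z0 (t / 2) z ->
     conv p a g (b n) (b n) z = conv p a f (b n) (b n) z.
Proof.
move=> bg bf t0 tS gf; near=> n => z zt.
have t2 : t / 2 <= t by rewrite ler_pdivrMr// ler_peMr ?ler1n// ltW.
have Sz : S z by apply: tS; exact: sq_le zt.
have ent : e n <= t / 2 by near: n; apply: (cvgr_le _ e_cvg); rewrite divr_gt0.
have bgf := bmeas_lin (-1) bg bf.
(* The averaging bound with tolerance 0, applied to the difference of the two functions. *)
have := @closeS n _ _ z 0 0 bgf Sz; rewrite (conv_lin _ _ bg bf)// mulN1r subr0 normr_le0 subr_eq0.
move=> h; apply/eqP; apply: h => w zw; rewrite subr0 gf ?mulN1r ?subrr ?normr0//.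
have zt' : sq z0 (t - t / 2) z by have -> : t - t / 2 = t / 2 by lra.
by apply: (sq_sub zt'); exact: sq_le zw.
Unshelve. all: end_near. Qed.

Let h n i := conv p a (H i) (b n) (b n).
Let g n i := conv p a (G i) (b n) (b n).
Let A n i := conv p a (al i) (b n) (b n).
Let E n i := conv p a (be i) (b n) (b n).
Let pot n := moll_pot p a (B n) (b n) P N.

Lemma bound_conv n f z : bmeas p a f K -> S z -> `|conv p a f (b n) (b n) z| <= K.
Proof.
move=> bf Sz; rewrite -[X in `|X|]subr0; apply: (closeS bf Sz) => w wz.
by rewrite subr0; have [_] := bf; apply; exact: sub_e wz.
Qed.

Lemma moll_comparison j i z0 z1 (kap : R) : i != j -> M j z0 ->
  sq p (rho (a / 2) V c0) z0 -> sq p (rho (a / 2) V c0) z1 -> 0 < kap ->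
  \forall n \near \oo, - kap <= (pot n z1 - h n j z1) - (pot n z0 - h n j z0).
Proof.
move=> ij Mz0 z0r z1r kap0.
have a20 : 0 < a / 2 by rewrite divr_gt0.
have hC n k := moll_harmonic a0 (ea n) (db n) (db' n) (@cb'' n) (@bz n)
  (@cH k) (@cal k) (@cbe k) (@Hx k) (@Hy k).
(* [G k] is the real part of -i (H + i G), whose derivative is be - i al, so the lemma for [H]
   applies to [G] with the pair (be, -al). *)
have cnal k : cont_on Q (fun z => - al k z) by move=> z Qz; apply: cvgN; exact: cal.
have Gy' k : dy_on Q (G k) (fun z => - - al k z).
  by move=> z Qz; rewrite opprK; exact: (Gy k Qz).
have gC n k : C2on S (g n k) (E n k) (A n k) (conv p a (be k) (b' n) (b n))
    (conv p a (al k) (b n) (b' n)).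
  have := moll_harmonic a0 (ea n) (db n) (db' n) (@cb'' n) (@bz n)
    (@cG k) (@cbe k) (@cnal k) (@Gx k) (@Gy' k).
  congr C2on; apply/funext => z; rewrite (convN _ (@bal k)) ?opprK//.
apply: (@comparison _ r p (a / 2) M al be H G v1 v2 K V c0 eta a20 K0 V0 c00 eta0 eta1 eta2 eta3 oM cov
  vV vc vx _ _ _ _ _ pot (fun n => conv p a P (b n) (b n)) (fun n => conv p a N (b n) (b n))
  (fun n => conv p a P (b' n) (b n)) (fun n z => - conv p a N (b n) (b' n) z) h g A E
  (fun n i => conv p a (al i) (b' n) (b n)) (fun n i z => - conv p a (be i) (b n) (b' n) z)
  (fun n k => conv p a (be k) (b' n) (b n)) (fun n k => conv p a (al k) (b n) (b' n))
  _ _ _ _ _ _ _ _ _ _ _ _ _ _ _ _ j i z0 z1 kap) => //.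
- by move=> k z Sz; apply: (@Hx k); exact: SQ.
- by move=> k z Sz; apply: (@Hy k); exact: SQ.
- by move=> k z Sz; apply: (@Gx k); exact: SQ.
- by move=> k z Sz; apply: (@Gy k); exact: SQ.
- by move=> k z Sz; apply: (clo k); exact: SQ.
- by move=> n; exact: (moll_pot_C2 a0 (ea n) (CB n) (dB n) (db n) (db' n) (@cb'' n) (@b_ge0 n)
    (@B0 n) (@B1 n) (@bz n) bP bN Sig).
- by move=> n z Sz; exact: (moll_subharmonic a0 (ea n) (CB n) (dB n) (db n) (db' n) (@b_ge0 n)
    (@bz n) bP bN Sig Sz).
- by move=> n k z Sz; exact: (moll_laplace a0 (ea n) (db n) (db' n) (@bz n)
    (@cG k) (@cal k) (@cbe k) (@Gx k) (@Gy k) Sz).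
- move=> n k z Sz.
  have cnH : cont_on Q (fun z => - H k z) by move=> w Qw; apply: cvgN; exact: cH.
  have Hx' : dx_on Q (fun z => - H k z) (fun z => - al k z).
    by move=> w Qw; apply: is_deriveNp; exact: (Hx k Qw).
  have Hy' : dy_on Q (fun z => - H k z) (be k).
    by move=> w Qw; apply: is_derive_eq (is_deriveNp (Hy k Qw)) _; rewrite opprK.
  have := moll_laplace a0 (ea n) (db n) (db' n) (@bz n) cnH (@cbe k) (@cnal k) Hx' Hy' Sz.
  by rewrite (convN _ (@bal k)) ?opprK.
- by move=> n z Sz; split; exact: bound_conv.
- by move=> n k z Sz; split; exact: bound_conv.
- move=> n k z Sz; split; apply: closeS => // w wz; have [] := clo k (sub_e Sz wz) => //.
- by move=> k z Sz; exact: conv_cvg.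
- by move=> k z Sz; exact: conv_cvg.
- by move=> k z Sz; exact: conv_cvg.
- by move=> k z Sz; exact: conv_cvg.
- move=> k z Sz Mz; have [t t0 tM] := open_sq (@oM k) Mz.
  by apply: (conv_near_cvg bP Sz t0 _ (cal (i := k) (SQ Sz))) => w /tM/PNM[].
- move=> k z Sz Mz; have [t t0 tM] := open_sq (@oM k) Mz.
  by apply: (conv_near_cvg bN Sz t0 _ (cbe (i := k) (SQ Sz))) => w /tM/PNM[].
- move=> k w t t0 tM tS; near=> n => z zt; split; move: z zt; near: n.
    by apply: (conv_eq_near bP (@bal k) t0 tS) => z /tM/PNM[].
  by apply: (conv_eq_near bN (@bbe k) t0 tS) => z /tM/PNM[].
Unshelve. all: end_near. Qed.

(** The comparison for j from [z] to [w] and the one for i from [w] to [z] are added: the potential,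
    whose limit is not known, cancels, and only mollified branches remain, which converge. *)
Lemma moll_order i j z w : i != j -> M j z -> M i w -> sq p (rho (a / 2) V c0) z ->
  sq p (rho (a / 2) V c0) w -> H i z - H j z <= H i w - H j w.
Proof.
move=> ij Mz Mw zr wr.
have rS : sq p (rho (a / 2) V c0) `<=` S.
  have a20 : 0 < a / 2 by rewrite divr_gt0.
  apply: sq_le; apply: le_trans (rho_le a20 V0 c00) _.
  by rewrite ler_pdivrMr// ler_peMr ?ler1n// ltW.
rewrite -subr_ge0; apply/ler_addgt0Pr => kap kap0; rewrite -subr_le0.
have cv : 0 - ((h n i w - h n j w) - (h n i z - h n j z) + kap) @[n --> \oo] -->
    0 - ((H i w - H j w) - (H i z - H j z) + kap).
  apply: cvgB; first exact: cvg_cst.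
  apply: cvgD; last exact: cvg_cst.
  by apply: cvgB; apply: cvgB; apply: conv_cvg => //; exact: rS.
have k20 : 0 < kap / 2 by rewrite divr_gt0.
have ji : j != i by rewrite eq_sym.
have C1 := moll_comparison ij Mz zr wr k20.
have C2 := moll_comparison ji Mw wr zr k20.
apply: (cvgr_to_le cv); apply: filterS2 C1 C2 => n.
exact: sum_lower.
Qed.

Lemma moll_max i j z : H i p = 0 -> H j p = 0 -> closure (M i) p -> M j z ->
  sq p (rho (a / 2) V c0) z -> H i z <= H j z.
Proof.
move=> Hi Hj clM Mz zr; have [->//|ij] := eqVneq i j.
have a20 : 0 < a / 2 by rewrite divr_gt0.
have r0 : 0 < rho (a / 2) V c0 by exact: rho_gt0.
have Qp : Q p by split; rewrite subrr normr0 ltW.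
rewrite -subr_le0; apply/ler_addgt0Pr => d d0; rewrite add0r.
have cd : {for p, continuous (fun w => H i w - H j w)}.
  by apply: cvgB; [exact: (cH (i := i) Qp)|exact: (cH (i := j) Qp)].
have n1 : nbhs p [set w | H i w - H j w <= d].
  have := cvgr_le _ cd d; rewrite Hi Hj subrr; exact.
have n2 : nbhs p (sq p (rho (a / 2) V c0)).
  apply/nbhs_ballP; exists (rho (a / 2) V c0) => //= w [w1 w2].
  by split; rewrite distrC ltW.
have [w [Mw [w1 w2]]] := clM _ (filterI n1 n2).
exact: le_trans (moll_order ij Mz Mw zr w2) w1.
Qed.
End piecewise_order.

Lemma fin_pos_lower (R : realType) (T : finType) (D : pred T) (f : T -> R) :
  (forall t, D t -> 0 < f t) -> exists2 c : R, 0 < c & forall t, D t -> c <= f t.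
Proof.
move=> f0; exists (\big[Num.min/1]_(t | D t) f t); first exact: lt_bigmin.
by move=> t Dt; exact: bigmin_le_cond.
Qed.

Lemma piecewise_max (R : realType) (r : nat) (p : R * R) (a1 : R) (M : 'I_r -> set (R * R))
    (al be H G : 'I_r -> R * R -> R) (P N : R * R -> R) :
  0 < a1 ->
  (forall i, open (M i)) -> (@lam2 R).-negligible (sq p a1 `\` \bigcup_i M i) ->
  (forall i, closure (M i) p) ->
  (forall i j, i != j -> 0 < (al i p - al j p) ^+ 2 + (be i p - be j p) ^+ 2) ->
  (forall i j k, i != j -> j != k -> i != k ->
    (al i p - al k p) * (be j p - be k p) - (be i p - be k p) * (al j p - al k p) != 0) ->
  (forall i, cont_on (sq p a1) (H i)) -> (forall i, cont_on (sq p a1) (G i)) ->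
  (forall i, cont_on (sq p a1) (al i)) -> (forall i, cont_on (sq p a1) (be i)) ->
  (forall i, dx_on (sq p a1) (H i) (al i)) -> (forall i, dy_on (sq p a1) (H i) (fun z => - be i z)) ->
  (forall i, dx_on (sq p a1) (G i) (be i)) -> (forall i, dy_on (sq p a1) (G i) (al i)) ->
  (forall i, H i p = 0) ->
  measurable_fun (sq p a1 : set (measurableTypeR R * measurableTypeR R)) (P : _ -> measurableTypeR R) ->
  measurable_fun (sq p a1 : set (measurableTypeR R * measurableTypeR R)) (N : _ -> measurableTypeR R) ->
  (forall i z, M i z -> P z = al i z /\ N z = be i z) ->
  (forall z, ~ (\bigcup_i M i) z -> P z = 0 /\ N z = 0) ->
  (forall a, 0 < a -> a <= a1 -> weak_Sigma p a P N) ->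
  exists2 d : R, 0 < d <= a1 & forall i j z, M j z -> sq p d z -> H i z <= H j z.
Proof.
move=> a10 oM cov clM ne cross cH cG cal cbe Hx Hy Gx Gy H0 mP mN PNM PN0 Sig.
(* Each coordinate of a value at [p] is at most V/2, hence each coordinate of a difference at most
   [V]; the 1 keeps [V] positive even for an empty family. *)
pose V := 1 + 2 * \sum_i (`|al i p| + `|be i p|).
have S0 : 0 <= \sum_i (`|al i p| + `|be i p|) by apply: sumr_ge0 => i _; exact: addr_ge0.
have V0 : 0 < V by rewrite ltr_pwDl// mulr_ge0.
have vb i : `|al i p| <= V / 2 /\ `|be i p| <= V / 2.
  have : `|al i p| + `|be i p| <= \sum_i (`|al i p| + `|be i p|).
    by rewrite (bigD1 i)//= lerDl; apply: sumr_ge0 => j _; exact: addr_ge0.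
  by move: (normr_ge0 (al i p)) (normr_ge0 (be i p)); rewrite /V; split; lra.
have vV i j : `|al i p - al j p| <= V /\ `|be i p - be j p| <= V.
  have [i1 i2] := vb i; have [j1 j2] := vb j.
  by have := ler_normB2 i1 j1; have := ler_normB2 i2 j2; split; lra.
have [c1 c10 hc1] := @fin_pos_lower R _ (fun t : 'I_r * 'I_r => t.1 != t.2)
  (fun t => (al t.1 p - al t.2 p) ^+ 2 + (be t.1 p - be t.2 p) ^+ 2) (fun t => ne t.1 t.2).
have [c2 c20 hc2] := @fin_pos_lower R _ (fun t : 'I_r * 'I_r * 'I_r =>
    [&& t.1.1 != t.1.2, t.1.2 != t.2 & t.1.1 != t.2])
  (fun t => `|(al t.1.1 p - al t.2 p) * (be t.1.2 p - be t.2 p) - (be t.1.1 p - be t.2 p) * (al t.1.2 p - al t.2 p)|)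
  (fun t => ltac:(by case/and3P => ? ? ?; rewrite normr_gt0; exact: cross)).
pose c0 := Num.min c1 c2.
have c00 : 0 < c0 by rewrite lt_min c10.
have vc i j : i != j -> c0 <= (al i p - al j p) ^+ 2 + (be i p - be j p) ^+ 2.
  by move=> ij; apply: le_trans (hc1 (i, j) ij); rewrite /c0 ge_min lexx.
have vx i j k : i != j -> j != k -> i != k ->
  c0 <= `|(al i p - al k p) * (be j p - be k p) - (be i p - be k p) * (al j p - al k p)|.
  move=> ij jk ik; have := hc2 (i, j, k); rewrite /= ij jk ik => /(_ isT); apply: le_trans.
  by rewrite /c0 ge_min lexx orbT.
clearbody c0.
(* A difference of two branches is known up to 2 [eta], so these are the conditions of
   [affine_upper], [conformal_lower] and [trilinear_lower] with [eta] doubled. *)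
pose eta := Num.min (V / 2) (Num.min (c0 / (16 * V)) (c0 ^+ 2 / (448 * V ^+ 3))).
have V3 : 0 < 448 * V ^+ 3 by apply: mulr_gt0; [exact: ltr0Sn|exact: exprn_gt0].
have eta0 : 0 < eta.
  rewrite !lt_min; apply/andP; split; first exact: divr_gt0.
  by apply/andP; split; apply: divr_gt0 => //; [exact: mulr_gt0|exact: exprn_gt0].
have eta1 : 2 * eta <= V by rewrite mulrC -ler_pdivlMr// /eta ge_min lexx.
have eta2 : 16 * eta * V <= c0.
  by rewrite mulrAC mulrC -ler_pdivlMr ?mulr_gt0// /eta !ge_min lexx orbT.
have eta3 : 448 * eta * V ^+ 3 <= c0 ^+ 2.
  by rewrite mulrAC mulrC -ler_pdivlMr// /eta !ge_min lexx !orbT.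
clearbody eta.
have Qp : sq p a1 p by split; rewrite subrr normr0 ltW.
have : \forall z \near p, forall i, `|al i p - al i z| <= eta /\ `|be i p - be i z| <= eta.
  apply: (@filter_forall _ _ (fun i z => `|al i p - al i z| <= eta /\ `|be i p - be i z| <= eta) (nbhs p)) => i.
  near=> z; split; near: z.
    by have /cvgrPdist_le := cal i _ Qp; apply.
  by have /cvgrPdist_le := cbe i _ Qp; apply.
move=> /nbhs_ballP[d /= d0 hd].
pose a := Num.min a1 (d / 2).
have a0 : 0 < a by rewrite lt_min a10 divr_gt0.
have aa1 : a <= a1 by rewrite /a ge_min lexx.
have ad : a < d.
  apply: (@le_lt_trans _ _ (d / 2)); first by rewrite /a ge_min lexx orbT.
  by rewrite ltr_pdivrMr// ltr_pMr// ltr1n.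
have Qa : sq p a `<=` sq p a1 by exact: sq_le.
have clo i z : sq p a z -> `|al i z - al i p| <= eta /\ `|be i z - be i p| <= eta.
  move=> [z1 z2]; have [|h1 h2] := hd z _ i; last by split; rewrite distrC.
  by split; rewrite /ball /= distrC; exact: le_lt_trans ad.
pose K := V + eta.
have K0 : 0 < K by rewrite addr_gt0.
have normK (x y : R) : `|x - y| <= eta -> `|y| <= V / 2 -> `|x| <= K.
  by move=> h1 h2; have := ler_normD (x - y) y; rewrite subrK /K; lra.
have abK i z : sq p a z -> `|al i z| <= K /\ `|be i z| <= K.
  by move=> /(clo i)[h1 h2]; have [b1 b2] := vb i; split; [exact: normK b1|exact: normK b2].
have [bP bN] : bmeas p a P K /\ bmeas p a N K.
  split; split.
  - exact: (measurable_funS (measurable_sq p a1) Qa mP).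
  - move=> z az; have [[i _ Mz]|nM] := pselect ((\bigcup_i M i) z).
      by have [-> _] := PNM i z Mz; have [] := abK i z az.
    by have [-> _] := PN0 _ nM; rewrite normr0 ltW.
  - exact: (measurable_funS (measurable_sq p a1) Qa mN).
  - move=> z az; have [[i _ Mz]|nM] := pselect ((\bigcup_i M i) z).
      by have [_ ->] := PNM i z Mz; have [] := abK i z az.
    by have [_ ->] := PN0 _ nM; rewrite normr0 ltW.
(* Radii a / (8 (n + 1)): at most a/8, as the mollified family requires, and tending to 0. *)
pose e n := (a / 8) * @harmonic R n.
have e0 n : 0 < e n by rewrite mulr_gt0 ?divr_gt0//; exact: harmonic_gt0.
have ea n : e n <= a / 8.
  by rewrite ger_pMr ?divr_gt0//= invf_le1// ler1n.
have e_cvg : e n @[n --> \oo] --> (0 : R).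
  by rewrite -(mulr0 (a / 8)); apply: cvgM; [exact: cvg_cst|exact: cvg_harmonic].
have /choice[B hB] := fun n => mollifier (e0 n).
have a20 : 0 < a / 2 by rewrite divr_gt0.
have cov' : (@lam2 R).-negligible (sq p (a / 2) `\` \bigcup_i M i).
  apply: negligibleS cov; apply: setSD; apply: sq_le.
  by apply: le_trans aa1; rewrite ler_pdivrMr// ler_peMr ?ler1n// ltW.
pose d1 := Num.min a1 (rho (a / 2) V c0).
exists d1; first by rewrite lt_min a10 rho_gt0//= /d1 ge_min lexx.
move=> i j z Mz zd.
apply: (@moll_max R r p a M al be H G P N (fun i => al i p) (fun i => be i p) K V c0 eta a0 K0 V0 c00
  (ltW eta0) eta1 eta2 eta3 oM cov' vV vc vx _ _ _ _ _ _ _ _ clo abK bP bN PNM (Sig a a0 aa1) e B ea e_cvg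
  _ _ _ _ _ i j z) => //.
- by move=> k w /Qa; exact: cH.
- by move=> k w /Qa; exact: cG.
- by move=> k w /Qa; exact: cal.
- by move=> k w /Qa; exact: cbe.
- by move=> k w /Qa; exact: Hx.
- by move=> k w /Qa; exact: Hy.
- by move=> k w /Qa; exact: Gx.
- by move=> k w /Qa; exact: Gy.
- by move=> n; have [] := hB n.
- by move=> n; have [] := hB n.
- by move=> n; have [] := hB n.
- by move=> n; have [] := hB n.
- by move=> n; have [] := hB n.
- by apply: sq_le zd; rewrite /d1 ge_min lexx orbT.
Unshelve. all: end_near. Qed.

(** * Weak gradient of a maximum *)

Lemma cvg_sumr (R : realType) (r : nat) (T : Type) (F : set_system T) (f : 'I_r -> T -> R) (l : 'I_r -> R) :
  Filter F -> (forall i, f i x @[x --> F] --> l i) -> \sum_i f i x @[x --> F] --> \sum_i l i.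
Proof.
move=> FF fl; elim: (index_enum _) => [|i s ih].
  by rewrite big_nil; under eq_fun do rewrite big_nil; exact: cvg_cst.
by rewrite big_cons; under eq_fun do rewrite big_cons; exact: cvgD.
Qed.

Lemma cont_on_bounded_fin (R : realType) (r : nat) (p : R * R) (a : R) (f : 'I_r -> R * R -> R) :
  (forall i, cont_on (sq p a) (f i)) -> exists2 K : R, 0 < K & forall i z, sq p a z -> `|f i z| <= K.
Proof.
move=> cf; have /choice[L hL] : forall i, exists L : R, 0 < L /\ forall z, sq p a z -> `|f i z| <= L.
  by move=> i; have [L L0 hL] := cont_on_bounded (cf i); exists L.
have L0 i : 0 <= L i by rewrite ltW//; case: (hL i).
exists (1 + \sum_i L i); first by rewrite ltr_pwDl// sumr_ge0.
move=> i z Qz; have [_ /(_ z Qz)/le_trans] := hL i; apply.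
by rewrite (bigD1 i)//= addrCA lerDl addr_ge0// sumr_ge0.
Qed.

Section softmax.
Variables (R : realType) (r : nat).
Implicit Types (u d : 'I_r -> R) (k : R).

Definition sumexp k u : R := \sum_i expR (k * u i).
Definition softmax k u i : R := expR (k * u i) / sumexp k u.
Definition lse k u : R := k^-1 * ln (sumexp k u).

Lemma expR_le_sumexp k u j : expR (k * u j) <= sumexp k u.
Proof. by rewrite /sumexp (bigD1 j)//= lerDl sumr_ge0// => i _; exact: expR_ge0. Qed.

Lemma sumexp_gt0 k u (j : 'I_r) : 0 < sumexp k u.
Proof. by apply: lt_le_trans (expR_le_sumexp k u j); exact: expR_gt0. Qed.

Lemma softmax_ge0 k u i : 0 <= softmax k u i.
Proof. by rewrite divr_ge0 ?expR_ge0// ltW// (sumexp_gt0 k u i). Qed.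

Lemma softmax_sum k u (j : 'I_r) : \sum_i softmax k u i = 1.
Proof. by rewrite -mulr_suml divff// gt_eqF// (sumexp_gt0 k u j). Qed.

Lemma softmax_le k u i j : softmax k u i <= expR (k * (u i - u j)).
Proof.
rewrite ler_pdivrMr ?(sumexp_gt0 k u j)//.
apply: le_trans (ler_wpM2l (expR_ge0 _) (expR_le_sumexp k u j)).
by rewrite -expRD -mulrDr subrK.
Qed.

(** The sum of exponentials lies between exp(k m) and r exp(k m), so the error is uniform in [u]. *)
Lemma lse_dist k u m : 0 < k -> (forall i, u i <= m) -> (exists i, u i = m) ->
  `|lse k u - m| <= ln r%:R / k.
Proof.
move=> k0 um [j uj]; have s0 := sumexp_gt0 k u j.
have r0 : 0 < r%:R :> R by rewrite ltr0n; exact: leq_ltn_trans (leq0n _) (ltn_ord j).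
have lo : k * m <= ln (sumexp k u).
  by rewrite -(expRK (k * m)) ler_ln ?posrE ?expR_gt0// -uj; exact: expR_le_sumexp.
have hi : ln (sumexp k u) <= ln r%:R + k * m.
  rewrite -[k * m]expRK -lnM ?posrE ?expR_gt0// ler_ln ?posrE ?mulr_gt0 ?expR_gt0//.
  apply: (@le_trans _ _ (\sum_(i < r) expR (k * m))).
    by apply: ler_sum => i _; rewrite ler_expR ler_pM2l.
  by rewrite sumr_const card_ord mulr_natl.
have -> : lse k u - m = (ln (sumexp k u) - k * m) / k.
  by rewrite /lse; field; rewrite gt_eqF.
rewrite ger0_norm; last by rewrite divr_ge0 ?subr_ge0// ltW.
by rewrite ler_pM2r ?invr_gt0// lerBlDr.
Qed.

Lemma lse_derive k (h : 'I_r -> R -> R) d (x : R) (j : 'I_r) : 0 < k ->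
  (forall i, is_derive x 1 (h i) (d i)) ->
  is_derive x 1 (fun t => lse k (h ^~ t)) (\sum_i softmax k (h ^~ x) i * d i).
Proof.
move=> k0 hd.
have he i : is_derive x 1 (fun t => expR (k * h i t)) (expR (k * h i x) * (k * d i)).
  exact: (is_derive_compp (is_derive_expR _) (is_deriveZl k (hd i))).
have hs : is_derive x 1 (fun t => sumexp k (h ^~ t)) (\sum_i expR (k * h i x) * (k * d i)).
  by have := is_derive_sum he; congr (is_derive _ _ _ _); apply/funext => t; rewrite fct_sumE.
have hl := is_derive_compp (is_derive1_ln (sumexp_gt0 k (h ^~ x) j)) hs.
apply: is_derive_eq (is_deriveZl k^-1 hl) _.
rewrite !mulr_sumr; apply: eq_bigr => i _; rewrite /softmax; field.
by rewrite !gt_eqF// (sumexp_gt0 k (h ^~ x) j).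
Qed.

Lemma softmax_mean_le k u d (K : R) (j : 'I_r) : (forall i, `|d i| <= K) ->
  `|\sum_i softmax k u i * d i| <= K.
Proof.
move=> dK; apply: le_trans (ler_norm_sum _ _ _) _.
rewrite -[K]mul1r -(softmax_sum k u j) mulr_suml; apply: ler_sum => i _.
by rewrite normrM (ger0_norm (softmax_ge0 _ _ _)) ler_wpM2l// softmax_ge0.
Qed.

(** Weights below the maximum decay geometrically, with ratio exp(u i - u j). The weights at a tie
    need not be known one by one, because [d] is constant there and the total weight is 1. *)
Lemma softmax_mean_cvg u d j : (forall i, u i <= u j) -> (forall i, u i = u j -> d i = d j) ->
  \sum_i softmax n.+1%:R u i * d i @[n --> \oo] --> d j.
Proof.
move=> uj ud.
have term i : softmax n.+1%:R u i * (d i - d j) @[n --> \oo] --> (0 : R).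
  have [/ud->|ne] := eqVneq (u i) (u j).
    by under eq_fun do rewrite subrr mulr0; exact: cvg_cst.
  have lt : u i < u j by rewrite lt_neqAle ne uj.
  rewrite -(mul0r (d i - d j)); apply: cvgM; last exact: cvg_cst.
  apply: (@squeeze_cvgr _ _ _ _ (fun=> 0) (fun n => expR (u i - u j) ^+ n.+1)).
  - by near=> n; rewrite softmax_ge0 -expRM_natl softmax_le.
  - exact: cvg_cst.
  - have e1 : `|expR (u i - u j)| < 1 by rewrite ger0_norm ?expR_ge0// -expR0 ltr_expR subr_lt0.
    by have := cvg_expr e1; rewrite -cvg_shiftS.
have -> : (fun n => \sum_i softmax n.+1%:R u i * d i) =
    (fun n => d j + \sum_i softmax n.+1%:R u i * (d i - d j)).
  apply/funext => n; under [in RHS]eq_bigr do rewrite mulrBr.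
  by rewrite sumrB -mulr_suml (softmax_sum _ _ j) mul1r addrC subrK.
rewrite -[X in _ --> X]addr0; apply: cvgD; first exact: cvg_cst.
have := cvg_sumr _ term; rewrite big1//; apply.
Unshelve. all: end_near. Qed.
End softmax.

Section max_weak.
Variables (R : realType) (r : nat) (p : R * R) (a : R).
Local Notation mu := (@lam2 R).
Local Notation mR := (measurableTypeR R).
Local Notation Q := (sq p a).
Variables (H : 'I_r -> R * R -> R) (phi ps : R * R -> R) (j0 : 'I_r).
Hypothesis a0 : 0 < a.
Hypothesis cH : forall i, cont_on Q (H i).
Hypothesis cps : cont_on Q ps.
Hypothesis phi_ge : forall i z, H i z <= phi z.
Hypothesis phi_eq : forall z, exists i, H i z = phi z.

(** Each inequality is taken at an index that realises [phi] at one of the two points. *)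
Lemma phi_cont : cont_on Q phi.
Proof.
move=> z Qz; apply/cvgrPdist_le => e e0.
have : \forall w \near z, forall i, `|H i z - H i w| <= e.
  apply: (@filter_forall _ _ (fun i w => `|H i z - H i w| <= e) (nbhs z)) => i.
  by have /cvgrPdist_le := cH (i := i) Qz; apply.
apply: filterS => w hw; rewrite ler_norml; apply/andP; split.
  have [i iw] := phi_eq w; have := phi_ge i z; have := hw i; rewrite ler_norml -iw => /andP[]; lra.
have [i iz] := phi_eq z; have := phi_ge i w; have := hw i; rewrite ler_norml -iz => /andP[]; lra.
Qed.

Lemma sumexp_cont k : cont_on Q (fun z => sumexp k (H ^~ z)).
Proof.
move=> z Qz; apply: cvg_sumr => i.
apply: (@continuous_comp _ _ _ (fun z => k * H i z) expR); last exact: continuous_expR.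
by apply: cvgM; [exact: cvg_cst|exact: cH].
Qed.

Lemma lse_cont k : cont_on Q (fun z => lse k (H ^~ z)).
Proof.
move=> z Qz; apply: cvgM; first exact: cvg_cst.
apply: (@continuous_comp _ _ _ (fun z => sumexp k (H ^~ z)) (@ln R)); first exact: sumexp_cont.
by apply: continuous_ln; exact: sumexp_gt0 j0.
Qed.

Lemma softmax_cont k i : cont_on Q (fun z => softmax k (H ^~ z) i).
Proof.
move=> z Qz; apply: cvgM.
  apply: (@continuous_comp _ _ _ (fun z => k * H i z) expR); last exact: continuous_expR.
  by apply: cvgM; [exact: cvg_cst|exact: cH].
by apply: cvgV; [rewrite gt_eqF// (sumexp_gt0 k _ j0)|exact: sumexp_cont].
Qed.

Section direction.
Variables (al : 'I_r -> R * R -> R) (P ps' : R * R -> R) (K : R) (Z : set (R * R)).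
Hypothesis cal : forall i, cont_on Q (al i).
Hypothesis cps' : cont_on Q ps'.
Hypothesis bP : bmeas p a P K.
Hypothesis nZ : mu.-negligible Z.
Hypothesis PZ : forall z, Q z -> ~ Z z -> exists j, [/\ P z = al j z, forall i, H i z <= H j z &
  forall i, H i z = H j z -> al i z = al j z].

Let mean n z := \sum_i softmax n.+1%:R (H ^~ z) i * al i z.

Lemma mean_cont n : cont_on Q (mean n).
Proof.
by move=> z Qz; apply: cvg_sumr => i; apply: cvgM; [exact: softmax_cont|exact: cal].
Qed.

(** The difference between the regularised integrand and the final one is bounded and tends to 0 off
    [Z]. The regularised integral is 0 for every n, so the integral of the difference is constantly
    minus the desired one. *)
Lemma max_weak_core :
  (forall n, \int[mu]_(z in Q) (lse n.+1%:R (H ^~ z) * ps' z + ps z * mean n z) = 0) ->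
  \int[mu]_(z in Q) (P z * ps z + phi z * ps' z) = 0.
Proof.
move=> ibp.
have [Ka Ka0 hKa] := cont_on_bounded_fin (@cal).
have [K1 K10 hK1] := cont_on_bounded cps; have [K2 K20 hK2] := cont_on_bounded cps'.
pose F n z := (lse n.+1%:R (H ^~ z) * ps' z + ps z * mean n z) - (P z * ps z + phi z * ps' z).
have mm := @measurable_sq R p a.
have mc f : cont_on Q f -> measurable_fun (Q : set (mR * mR)) (f : _ -> mR).
  by move=> cf; apply: measurable_cont_on.
have c1 n : cont_on Q (fun z => lse n.+1%:R (H ^~ z) * ps' z + ps z * mean n z).
  apply: cont_onD; apply: cont_onM => //; [exact: lse_cont|exact: mean_cont].
have mP : measurable_fun (Q : set (mR * mR)) (fun z => P z * ps z + phi z * ps' z : mR).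
  apply: measurable_funD; apply: measurable_funM; try exact: mc.
  - by have [] := bP.
  - by apply: mc; exact: phi_cont.
have mF n : measurable_fun (Q : set (mR * mR)) (F n : _ -> mR).
  by apply: measurable_funB => //; exact: mc.
have FE n z : F n z = (lse n.+1%:R (H ^~ z) - phi z) * ps' z + (mean n z - P z) * ps z.
  by rewrite /F; ring.
have r1 : 1 <= r%:R :> R by rewrite ler1n; exact: leq_ltn_trans (leq0n _) (ltn_ord j0).
have lr0 : 0 <= ln r%:R :> R by exact: ln_ge0.
have lseb n z : `|lse n.+1%:R (H ^~ z) - phi z| <= ln r%:R * @harmonic R n.
  exact: lse_dist.
have bF n z : Q z -> `|F n z| <= ln r%:R * K2 + (Ka + K) * K1.
  move=> Qz; rewrite FE; apply: le_trans (ler_normD _ _) _; rewrite !normrM; apply: lerD.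
    apply: ler_pM => //; last exact: hK2.
    apply: le_trans (lseb n z) _; rewrite ler_piMr//= invf_le1// ler1n//.
  apply: ler_pM => //; last exact: hK1.
  apply: le_trans (ler_normB _ _) _; apply: lerD; last by have [_] := bP; apply.
  by apply: softmax_mean_le => // i; exact: hKa.
have cF z : Q z -> ~ Z z -> F n z @[n --> \oo] --> (0 : R).
  move=> Qz nz; have [j [Pz Hj tie]] := PZ Qz nz.
  under eq_fun do rewrite FE.
  have -> : (0 : R) = 0 * ps' z + 0 * ps z by ring.
  apply: cvgD; apply: cvgM; try exact: cvg_cst.
    apply/norm_cvg0P; apply: (@squeeze_cvgr _ _ _ _ (fun=> 0) (fun n => ln r%:R * @harmonic R n)).
    - by near=> n; rewrite normr_ge0 lseb.
    - exact: cvg_cst.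
    - by rewrite -(mulr0 (ln r%:R)); apply: cvgM; [exact: cvg_cst|exact: cvg_harmonic].
  rewrite -(subrr (P z)); apply: cvgB; last exact: cvg_cst.
  by rewrite Pz; apply: softmax_mean_cvg.
have lim := bounded_cvg_integral mF bF nZ cF.
have iP : mu.-integrable Q (EFin \o (fun z => P z * ps z + phi z * ps' z)).
  have [Kp _ hKp] := cont_on_bounded phi_cont.
  apply: (@sq_integrable _ _ _ _ (K * K1 + Kp * K2)) => // z Qz.
  apply: le_trans (ler_normD _ _) _; rewrite !normrM; apply: lerD; apply: ler_pM => //.
  - by have [_] := bP; apply.
  - exact: hK1.
  - exact: hKp.
  - exact: hK2.
have FI n : \int[mu]_(z in Q) F n z = - \int[mu]_(z in Q) (P z * ps z + phi z * ps' z).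
  apply: etrans (sq_integralB (cont_on_integrable (c1 n)) iP) _.
  by rewrite ibp sub0r.
apply/eqP; rewrite -oppr_eq0; apply/eqP.
apply: (cvg_unique _ _ lim) => //.
have -> : (fun n => \int[mu]_(z in Q) F n z) = fun=> - \int[mu]_(z in Q) (P z * ps z + phi z * ps' z).
  exact/funext.
exact: cvg_cst.
Unshelve. all: end_near. Qed.

Lemma max_weak_dx : (forall i, dx_on Q (H i) (al i)) -> dx_on Q ps ps' ->
  (forall z, Q z -> `|z.1 - p.1| = a -> ps z = 0) ->
  \int[mu]_(z in Q) (P z * ps z + phi z * ps' z) = 0.
Proof.
move=> Hx psx ps0; apply: max_weak_core => n.
have Fx : dx_on Q (fun z => lse n.+1%:R (H ^~ z)) (mean n).
  move=> z Qz; have := @lse_derive R r n.+1%:R (fun i t => H i (t, z.2)) (fun i => al i z) z.1 j0.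
  rewrite /mean [in H ^~ z](surjective_pairing z); apply => // i; exact: Hx.
apply: (sq_integral_dx a0 (dx_onM Fx psx)).
  apply: cont_onD; apply: cont_onM => //; [exact: lse_cont|exact: mean_cont].
by move=> z Qz za; rewrite ps0// mulr0.
Qed.

Lemma max_weak_dy : (forall i, dy_on Q (H i) (al i)) -> dy_on Q ps ps' ->
  (forall z, Q z -> `|z.2 - p.2| = a -> ps z = 0) ->
  \int[mu]_(z in Q) (P z * ps z + phi z * ps' z) = 0.
Proof.
move=> Hy psy ps0; apply: max_weak_core => n.
have Fy : dy_on Q (fun z => lse n.+1%:R (H ^~ z)) (mean n).
  move=> z Qz; have := @lse_derive R r n.+1%:R (fun i t => H i (z.1, t)) (fun i => al i z) z.2 j0.
  rewrite /mean [in H ^~ z](surjective_pairing z); apply => // i; exact: Hy.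
apply: (sq_integral_dy a0 (dy_onM Fy psy)).
  apply: cont_onD; apply: cont_onM => //; [exact: lse_cont|exact: mean_cont].
by move=> z Qz za; rewrite ps0// mulr0.
Qed.
End direction.
End max_weak.

(** * From the complex plane to real coordinates *)

Section complex_plane.
Variable R : realType.
Local Open Scope complex_scope.
Local Notation C := (R[i]).
Implicit Types (z w : C) (q : R * R).

Lemma toC_ReIm z : toC (complex.Re z, complex.Im z) = z. Proof. by case: z. Qed.

Lemma ReMC z w : complex.Re (z * w) = complex.Re z * complex.Re w - complex.Im z * complex.Im w.
Proof. by case: z => ? ?; case: w. Qed.

Lemma ImMC z w : complex.Im (z * w) = complex.Re z * complex.Im w + complex.Im z * complex.Re w.
Proof. by case: z => ? ?; case: w. Qed.

Lemma normC_real (x : R) : `|x%:C| = `|x|%:C.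
Proof. by rewrite normc_def /= expr0n /= addr0 sqrtr_sqr. Qed.

Lemma normC_i : `|'i : C| = 1.
Proof. by rewrite normc_def /= expr0n /= add0r expr1n sqrtr1. Qed.

Lemma normC_leRI z : `|z| <= (`|complex.Re z| + `|complex.Im z|)%:C.
Proof.
rewrite {1}[z]complexE; apply: le_trans (ler_normD _ _) _.
by rewrite normrM normC_i mul1r !normC_real rmorphD.
Qed.

Lemma normC_geI z : `|complex.Im z|%:C <= `|z|.
Proof.
have := normc_ge_Re (z * 'i); rewrite normrM normC_i mulr1.
by rewrite ReiNIm normrN.
Qed.

(** The norm on the complex numbers takes complex values, and so do the radii of balls; positivity
    forces a radius to be real, which allows the passage to real coordinate boxes. *)
Lemma nbhsC z (A : set C) : nbhs z A <-> exists2 d : R, 0 < d &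
  forall w, `|complex.Re w - complex.Re z| < d -> `|complex.Im w - complex.Im z| < d -> A w.
Proof.
split=> [/nbhs_ballP[e /= e0 eA]|[d d0 dA]].
  move: e0; rewrite ltcE /= => /andP[/eqP ei er].
  exists (complex.Re e / 2); first by rewrite divr_gt0.
  move=> w w1 w2; apply: eA; rewrite -ball_normE /= distrC.
  apply: le_lt_trans (normC_leRI _) _; rewrite ltcE /= ei eqxx /=.
  rewrite raddfB /= raddfB /=.
  by rewrite [X in _ < X](splitr (complex.Re e)) ltrD.
apply/nbhs_ballP; exists d%:C; first by rewrite /= ltcR.
move=> w; rewrite -ball_normE /= distrC => wz; apply: dA; rewrite -ltcR; apply: le_lt_trans wz.
  by rewrite -raddfB; exact: normc_ge_Re.
by rewrite -raddfB; exact: normC_geI.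
Qed.

Lemma toC_continuous : continuous (@toC R).
Proof.
move=> q A /nbhsC[d d0 dA]; apply/nbhs_ballP; exists d => //= w [w1 w2].
by apply: dA => /=; rewrite distrC.
Qed.

Lemma Re_continuous : continuous (@complex.Re R : C -> R).
Proof.
move=> z A /nbhs_ballP[e /= e0 eA]; apply/nbhsC; exists e => // w w1 _.
by apply: eA; rewrite /ball /= distrC.
Qed.

Lemma Im_continuous : continuous (@complex.Im R : C -> R).
Proof.
move=> z A /nbhs_ballP[e /= e0 eA]; apply/nbhsC; exists e => // w _ w1.
by apply: eA; rewrite /ball /= distrC.
Qed.

Lemma open_toC (O : set C) : open O -> open (@toC R @^-1` O).
Proof. by move=> oO; apply: open_comp => // q _; exact: toC_continuous. Qed.

Lemma closure_toC (M : set C) z : closure M z ->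
  closure (@toC R @^-1` M) (complex.Re z, complex.Im z).
Proof.
move=> clM B /nbhs_ballP[d /= d0 dB].
have /clM[w [Mw [w1 w2]]] : nbhs z [set w | `|complex.Re w - complex.Re z| < d /\ `|complex.Im w - complex.Im z| < d].
  by apply/nbhsC; exists d.
exists (complex.Re w, complex.Im w); split; first by rewrite /= toC_ReIm.
by apply: dB; split; rewrite /ball /= distrC.
Qed.

Lemma cont_on_toC (D : set (R * R)) (f : C -> R) : (forall q, D q -> {for toC q, continuous f}) ->
  cont_on D (fun q => f (toC q)).
Proof.
move=> cf q Dq; apply: (@continuous_comp _ _ _ (@toC R) f); first exact: toC_continuous.
exact: cf.
Qed.

Lemma derivable_continuousC (F : C -> C) z : derivable F z 1 -> {for z, continuous F}.
Proof. by move=> /derivable1_diffP/differentiable_continuous. Qed.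

Lemma is_derive_cvg (f : R -> R) (x l : R) :
  t^-1 * (f (t + x) - f x) @[t --> 0^'] --> l -> is_derive x 1 f l.
Proof.
move=> cv; have cv' : (fun t : R => t^-1 *: ((f \o shift x) (t *: (1 : R)) - f x)) @ 0^' --> l.
  apply: cvg_trans cv; apply: near_eq_cvg; near=> t.
  by rewrite /= /GRing.scale /= mulr1.
by split; [apply/cvg_ex; exists l|exact: cvg_lim].
Unshelve. all: end_near. Qed.

Lemma is_derive_cvgC (F : C -> C) z (l : C) : is_derive z 1 F l ->
  h^-1 * (F (h + z) - F z) @[h --> 0^'] --> l.
Proof.
move=> [dF <-]; apply: cvg_trans dF; apply: near_eq_cvg; near=> h.
by rewrite /= /GRing.scale /= mulr1.
Unshelve. all: end_near. Qed.

Lemma dnbhs0_comp (k : R -> C) : continuous k -> k 0 = 0 -> (forall t, t != 0 -> k t != 0) ->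
  k t @[t --> 0^'] --> 0^'.
Proof.
move=> ck k0 kn A hA.
have : nbhs (0 : R) (k @^-1` [set x | x != 0 -> A x]) by apply: ck; rewrite k0.
by apply: filterS => t h t0; apply: h; exact: kn.
Qed.

(** The complex difference quotient is restricted to increments t and i t; the factor 1/i = -i in
    the second case yields the Cauchy-Riemann form of the four partials. *)
Lemma partials (F : C -> C) q (l : C) : is_derive (toC q) 1 F l ->
  [/\ is_derive q.1 1 (fun t => complex.Re (F (toC (t, q.2)))) (complex.Re l),
      is_derive q.2 1 (fun t => complex.Re (F (toC (q.1, t)))) (- complex.Im l),
      is_derive q.1 1 (fun t => complex.Im (F (toC (t, q.2)))) (complex.Im l) &
      is_derive q.2 1 (fun t => complex.Im (F (toC (q.1, t)))) (complex.Re l)].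
Proof.
move=> /is_derive_cvgC cv.
have rx (t : R) : toC (t + q.1, q.2) = t%:C + toC q by rewrite /toC; simpc.
have ry (t : R) : toC (q.1, t + q.2) = (0 +i* t) + toC q by rewrite /toC; simpc.
have ck1 : continuous (fun t : R => t%:C : C).
  move=> t; apply: (@continuous_comp _ _ _ (fun t : R => (t, 0 : R)) (@toC R)); last exact: toC_continuous.
  exact: pairr_continuous.
have ck2 : continuous (fun t : R => 0 +i* t : C).
  move=> t; apply: (@continuous_comp _ _ _ (fun t : R => (0 : R, t)) (@toC R)); last exact: toC_continuous.
  exact: pairl_continuous.
have cx := cvg_comp _ _ (dnbhs0_comp ck1 erefl _) cv.
have cy := cvg_comp _ _ (dnbhs0_comp ck2 erefl _) cv.
have n1 (t : R) : t != 0 -> t%:C != 0 :> C by move=> t0; rewrite eq_complex /= negb_and t0.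
have n2 (t : R) : t != 0 -> (0 +i* t) != 0 :> C by move=> t0; rewrite eq_complex /= negb_and t0 orbT.
have {}cx := cx n1; have {}cy := cy n2.
have ReM (t : R) (w : C) : complex.Re ((t%:C)^-1 * w) = t^-1 * complex.Re w.
  by rewrite -fmorphV; case: w => u v; simpc.
have ImM (t : R) (w : C) : complex.Im ((t%:C)^-1 * w) = t^-1 * complex.Im w.
  by rewrite -fmorphV; case: w => u v; simpc.
(* True at t = 0 as well, with the inverse of 0 equal to 0, so the rewriting below needs no side
   condition. *)
have iV (t : R) : (0 +i* t)^-1 = - (0 +i* t^-1) :> C.
  have [->|t0] := eqVneq t 0; first by rewrite !invr0 oppr0.
  apply: (mulfI (n2 _ t0)); rewrite mulfV ?n2//; simpc.
  by rewrite mulfV.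
have ReN (s : R) (w : C) : complex.Re (- (0 +i* s) * w) = s * complex.Im w.
  by rewrite ReMC /=; ring.
have ImN (s : R) (w : C) : complex.Im (- (0 +i* s) * w) = - (s * complex.Re w).
  by rewrite ImMC /=; ring.
split; apply: is_derive_cvg.
- have := cvg_comp _ _ cx (@Re_continuous l); apply: cvg_trans; apply: near_eq_cvg; near=> t.
  by rewrite /= ReM rx -surjective_pairing raddfB.
- have cI : continuous (fun w : C => - complex.Im w) by move=> w;
    apply: (@continuous_comp _ _ _ (@complex.Im R : C -> R) (fun t : R => - t));
    [exact: Im_continuous|exact: opp_continuous].
  have := cvg_comp _ _ cy (cI l); apply: cvg_trans; apply: near_eq_cvg; near=> t.
  by rewrite /= iV ry -surjective_pairing ImN opprK raddfB.
- have := cvg_comp _ _ cx (@Im_continuous l); apply: cvg_trans; apply: near_eq_cvg; near=> t.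
  by rewrite /= ImM rx -surjective_pairing raddfB.
- have := cvg_comp _ _ cy (@Re_continuous l); apply: cvg_trans; apply: near_eq_cvg; near=> t.
  by rewrite /= iV ry -surjective_pairing ReN raddfB.
Unshelve. all: end_near. Qed.
End complex_plane.

Section test_functions.
Variable R : realType.
Local Open Scope complex_scope.
Local Notation C := (R[i]).
Local Notation mR := (measurableTypeR R).
Local Notation R2 := (mR * mR)%type.
Local Notation mu := (@lam2 R).
Implicit Types (z w : C) (q p : R * R).

Lemma Rintegral_restrict (D E : set R2) (f : R2 -> R) : E `<=` D ->
  (forall q, D q -> ~ E q -> f q = 0) -> \int[mu]_(q in D) f q = \int[mu]_(q in E) f q.
Proof.
move=> ED f0; rewrite /Rintegral integral_mkcond [in RHS]integral_mkcond; congr fine.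
apply: eq_integral => q _; rewrite !patchE.
case: ifPn => [/set_mem Dq|/negP nD]; case: ifPn => [/set_mem Eq|/negP nE] //.
  by rewrite f0// => Eq; apply: nE; exact: mem_set.
by case: nD; apply: mem_set; exact: ED.
Qed.

Lemma cintE (D : set C) (g : C -> C) : cint D g =
  toC (\int[mu]_(q in @toC R @^-1` D) complex.Re (g (toC q)), \int[mu]_(q in @toC R @^-1` D) complex.Im (g (toC q))).
Proof. by rewrite [RHS]complexE. Qed.

Lemma sq_ae_eq p (a : R) (f g : R * R -> R) :
  measurable_fun (sq p a : set R2) (f : _ -> mR) -> measurable_fun (sq p a : set R2) (g : _ -> mR) ->
  {ae mu, forall q, sq p a q -> f q = g q} ->
  \int[mu]_(q in sq p a) f q = \int[mu]_(q in sq p a) g q.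
Proof.
move=> mf mg fg; rewrite /Rintegral; congr fine; apply: ae_eq_integral.
- exact: measurable_sq.
- exact/measurable_EFinP.
- exact/measurable_EFinP.
- by apply: (negligibleS _ fg) => q /= h1 h2; apply: h1 => Dq /=; rewrite h2.
Qed.

Section product.
Implicit Types (f g : R -> R).

(** Products are the only test functions extracted from [in_Sigma]: the kernel and the test function
    of [moll_curl] both have this form. *)
Definition tensor f g : C -> R := fun z => f (complex.Re z) * g (complex.Im z).

Lemma shift_derive f (x : R) : kder f (derive1 f) ->
  is_derive (0 : R) 1 (fun t : R => f (x + t)) (derive1 f x).
Proof.
move=> df; have := @is_derive_shift _ f (derive1 f) (- x) 0 df.
rewrite sub0r opprK; congr (is_derive _ _ _ _).
by apply/funext => t; rewrite addrC.
Qed.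

Lemma tensor_dx f g z : kder f (derive1 f) ->
  is_derive (0 : R) 1 (fun t : R => tensor f g (z + t%:C)) (tensor (derive1 f) g z).
Proof.
move=> df; have := is_deriveZr (g (complex.Im z)) (shift_derive (complex.Re z) df).
by congr (is_derive _ _ _ _); apply/funext => t; case: z => x y; rewrite /tensor /= addr0.
Qed.

Lemma tensor_dy f g z : kder g (derive1 g) ->
  is_derive (0 : R) 1 (fun t : R => tensor f g (z + Complex 0 t)) (tensor f (derive1 g) z).
Proof.
move=> dg; have := is_deriveZl (f (complex.Re z)) (shift_derive (complex.Im z) dg).
by congr (is_derive _ _ _ _); apply/funext => t; case: z => x y; rewrite /tensor /= addr0.
Qed.

Lemma pdx_tensor f g : kder f (derive1 f) ->
  pdx (tensor f g) = tensor (derive1 f) g.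
Proof. by move=> df; apply/funext => z; rewrite /pdx derive1E; have [_ ->] := tensor_dx g z df. Qed.

Lemma pdy_tensor f g : kder g (derive1 g) ->
  pdy (tensor f g) = tensor f (derive1 g).
Proof. by move=> dg; apply/funext => z; rewrite /pdy derive1E; have [_ ->] := tensor_dy f z dg. Qed.

Lemma tensor_continuous f g : continuous f -> continuous g -> continuous (tensor f g).
Proof.
move=> cf cg z.
apply: (@continuous_comp _ _ _ (fun z : C => (complex.Re z, complex.Im z))
  (fun q : R * R => f q.1 * g q.2)).
  move=> A /nbhs_ballP[e /= e0 eA]; apply/nbhsC; exists e => // w w1 w2.
  by apply: eA; split; rewrite /ball /= distrC.
apply: cvgM.
  by apply: (@continuous_comp _ _ _ (@fst R R) f); [exact: cvg_fst|exact: cf].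
by apply: (@continuous_comp _ _ _ (@snd R R) g); [exact: cvg_snd|exact: cg].
Qed.

Lemma tensor_Cn n f g : C1n n f -> C1n n g -> Cn n (tensor f g).
Proof.
elim: n f g => [|n ih] f g cf cg.
  by split => //; apply: tensor_continuous; [exact: C1n_cont cf|exact: C1n_cont cg].
have [df cf'] := C1n_elim cf; have [dg cg'] := C1n_elim cg.
split; first by apply: tensor_continuous; [exact: C1n_cont cf|exact: C1n_cont cg].
split.
  move=> z; split; [exact: (@ex_derive _ _ _ _ _ _ _ (tensor_dx g z df))|].
  exact: (@ex_derive _ _ _ _ _ _ _ (tensor_dy f z dg)).
rewrite pdx_tensor// pdy_tensor//; split; apply: ih => //; exact: C1nS.
Qed.

Lemma closed_toC_sq p (a : R) : closed (@toC R @` sq p a) /\ compact (@toC R @` sq p a).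
Proof.
have cs : compact (@toC R @` sq p a).
  apply: continuous_compact; last exact: compact_sq.
  by apply: continuous_subspaceT; exact: toC_continuous.
by split => //; apply: compact_closed => //; exact: norm_hausdorff.
Qed.

Lemma tensor_test (U : set C) p (a : R) f g : (forall n, C1n n f) -> (forall n, C1n n g) ->
  (forall s, a <= `|s - p.1| -> f s = 0) -> (forall s, a <= `|s - p.2| -> g s = 0) ->
  sq p a `<=` @toC R @^-1` U -> test_fun U (tensor f g).
Proof.
move=> cf cg f0 g0 aU; split; first by move=> n; exact: tensor_Cn.
have [cl co] := closed_toC_sq p a.
have sub : Defs.support (tensor f g) `<=` @toC R @` sq p a.
  rewrite ((closure_id _).1 cl); apply: closureS => z /= nz.
  exists (complex.Re z, complex.Im z); last exact: toC_ReIm.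
  split; rewrite /= leNgt; apply/negP => /ltW h; move: nz; rewrite /tensor.
    by rewrite f0// mul0r eqxx.
  by rewrite g0// mulr0 eqxx.
split; first by apply: subclosed_compact co sub; exact: closed_closure.
by move=> z /sub[q /aU + <-].
Qed.
End product.
End test_functions.

(** * The positivity condition in real coordinates *)

Section weak_formulation.
Variable R : realType.
Local Open Scope complex_scope.
Local Notation C := (R[i]).
Local Notation mR := (measurableTypeR R).
Local Notation R2 := (mR * mR)%type.
Local Notation mu := (@lam2 R).
Implicit Types (z : C) (q p w : R * R) (f g : R -> R).

Lemma derive1_out f (c a s : R) : (forall s, a <= `|s - c| -> f s = 0) -> a < `|s - c| -> derive1 f s = 0.
Proof.
move=> f0 sa; rewrite derive1E.
have hn : \near s, 0 = f s.
  near=> t; rewrite f0// ltW//; near: t.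
  have : {for s, continuous (fun t : R => `|t - c|)}.
    apply: (@continuous_comp _ _ _ (fun t : R => t - c) (fun t : R => `|t|)); last exact: norm_continuous.
    by apply: cvgB; [exact: cvg_id|exact: cvg_cst].
  by move=> /(_ _ (lt_nbhsr sa)).
by rewrite -(near_eq_derive (1 : R) hn); exact: derive_cst.
Unshelve. all: by end_near. Qed.

Lemma half_complex (w : C) : complex.Re (w / 2%:R) = complex.Re w / 2 /\ complex.Im (w / 2%:R) = complex.Im w / 2.
Proof.
have -> : (2%:R : C)^-1 = (2^-1)%:C by rewrite fmorphV /= rmorph_nat.
by rewrite ReMC ImMC /= !mulr0 subr0 add0r.
Qed.

Lemma dzbar_ReIm (psi : C -> R) z : complex.Re (dzbar psi z) = pdx psi z / 2 /\
  complex.Im (dzbar psi z) = pdy psi z / 2.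
Proof.
rewrite /dzbar (_ : _ + _ = toC (pdx psi z, pdy psi z)); last exact/esym/(complexE (toC _)).
exact: half_complex.
Qed.

Lemma dz_ReIm (psi : C -> R) z : complex.Re (dz psi z) = pdx psi z / 2 /\
  complex.Im (dz psi z) = - (pdy psi z / 2).
Proof.
rewrite /dz -mulrN -rmorphN (_ : _ + _ = toC (pdx psi z, - pdy psi z)); last exact/esym/(complexE (toC _)).
by rewrite -mulNr; exact: half_complex.
Qed.

Lemma loc_integrable_sq (U : set C) (Phi : C -> C) p (a : R) : loc_integrable U Phi ->
  sq p a `<=` @toC R @^-1` U ->
  measurable_fun (sq p a : set R2) (fun q => complex.Re (Phi (toC q)) : mR) /\
  measurable_fun (sq p a : set R2) (fun q => complex.Im (Phi (toC q)) : mR).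
Proof.
move=> li aU; have [_ co] := closed_toC_sq p a.
have sU : @toC R @` sq p a `<=` U by move=> _ [q aq <-]; exact: aU.
have [] := li _ co sU.
have -> : @toC R @^-1` (@toC R @` sq p a) = sq p a.
  apply/seteqP; split => q; last by exists q.
  by move=> [w aw] /= E; have -> : q = w by case: q E => ? ?; case: w {aw} => ? ? [-> ->].
by move=> /measurable_int/measurable_EFinP ? /measurable_int/measurable_EFinP ?.
Qed.

(** A complex number is >= 0 exactly when its imaginary part is 0 and its real part is >= 0; the two
    halves give the equation and the inequality of [weak_Sigma], up to the factor 1/2 of [dzbar]. *)
Lemma in_Sigma_weak (U : set C) (Phi : C -> C) p (a K : R) (P N : R * R -> R) :
  loc_integrable U Phi -> in_Sigma U Phi -> sq p a `<=` @toC R @^-1` U ->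
  bmeas p a P K -> bmeas p a N K ->
  {ae mu, forall q, sq p a q -> Phi (toC q) = toC (P q, N q)} ->
  weak_Sigma p a P N.
Proof.
move=> li inS aU [mP bP] [mN bN] ae_eq f g Cf Cg f0 g0 fa ga.
have [df Cf'] : kder f (derive1 f) /\ continuous (derive1 f).
  by have [d c] := C1n_elim (Cf 1); split => //; exact: C1n_cont c.
have [dg Cg'] : kder g (derive1 g) /\ continuous (derive1 g).
  by have [d c] := C1n_elim (Cg 1); split => //; exact: C1n_cont c.
have cf : continuous f by exact: C1n_cont (Cf 0).
have cg : continuous g by exact: C1n_cont (Cg 0).
have tf := tensor_test Cf Cg fa ga aU.
have := inS _ tf (fun z => mulr_ge0 (f0 _) (g0 _)).
rewrite cintE lecE /= oppr_eq0 oppr_ge0 => /andP[/eqP I0 R0].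
have [mRe mIm] := loc_integrable_sq li aU.
have prodc (k1 k2 : R -> R) : continuous k1 -> continuous k2 ->
    cont_on (sq p a) (fun w => k1 w.1 * k2 w.2).
  move=> c1 c2 w _; apply: cvgM.
    by apply: (@continuous_comp _ _ _ (@fst R R) k1); [exact: cvg_fst|exact: c1].
  by apply: (@continuous_comp _ _ _ (@snd R R) k2); [exact: cvg_snd|exact: c2].
have mk (h : R * R -> R) : cont_on (sq p a) h -> measurable_fun (sq p a : set R2) (h : _ -> mR).
  by move=> ch; apply: measurable_cont_on => //; exact: measurable_sq.
have c1 := prodc _ _ Cf' cg; have c2 := prodc _ _ cf Cg'.
have bk (Q1 h : R * R -> R) : measurable_fun (sq p a : set R2) (Q1 : _ -> mR) ->
    (forall q, sq p a q -> `|Q1 q| <= K) -> cont_on (sq p a) h ->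
    mu.-integrable (sq p a) (EFin \o (fun w => Q1 w * h w)).
  move=> mQ bQ ch; have [L L0 hL] := cont_on_bounded ch.
  apply: (@sq_integrable _ _ _ _ (K * L)); first by apply: measurable_funM => //; exact: mk.
  by move=> w aw; rewrite normrM; apply: ler_pM => //; [exact: bQ|exact: hL].
have out q : ~ sq p a q -> tensor (derive1 f) g (toC q) = 0 /\ tensor f (derive1 g) (toC q) = 0.
  rewrite /tensor /=.
  move=> /not_andP[] /negP; rewrite -ltNge => h.
    by rewrite (derive1_out fa h) (fa _ (ltW h)) !mul0r.
  by rewrite (derive1_out ga h) (ga _ (ltW h)) !mulr0.
have dE q : complex.Re (dzbar (tensor f g) (toC q)) = derive1 f q.1 * g q.2 / 2 /\
            complex.Im (dzbar (tensor f g) (toC q)) = f q.1 * derive1 g q.2 / 2.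
  by have [-> ->] := dzbar_ReIm (tensor f g) (toC q); rewrite pdx_tensor// pdy_tensor.
have dz0 q : ~ sq p a q -> complex.Re (dzbar (tensor f g) (toC q)) = 0 /\
    complex.Im (dzbar (tensor f g) (toC q)) = 0.
  move=> nq; have [t1 t2] := out q nq; have [-> ->] := dE q.
  by move: t1 t2; rewrite /tensor /= => -> ->; rewrite !mul0r.
have ReE : \int[mu]_(q in @toC R @^-1` U) complex.Re (Phi (toC q) * dzbar (tensor f g) (toC q)) =
   2^-1 * \int[mu]_(w in sq p a) (P w * (derive1 f w.1 * g w.2) - N w * (f w.1 * derive1 g w.2)).
  rewrite (Rintegral_restrict aU); last first.
    by move=> q _ /dz0[d1 d2]; rewrite ReMC d1 d2 !mulr0 subrr.
  rewrite -(sq_integralZ (sq_integrableB (bk _ _ mP bP c1) (bk _ _ mN bN c2))).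
  apply: sq_ae_eq.
  - apply: (@eq_measurable_fun _ _ _ _ _ (fun q => complex.Re (Phi (toC q)) * (derive1 f q.1 * g q.2 / 2) -
      complex.Im (Phi (toC q)) * (f q.1 * derive1 g q.2 / 2) : mR)).
      by move=> q _; rewrite /= ReMC; have [-> ->] := dE q.
    by apply: measurable_funB; apply: measurable_funM => //; apply: mk; apply: cont_onM => //; exact: cont_on_cst.
  - apply: measurable_funM; first exact: measurable_cst.
    by apply: measurable_funB; apply: measurable_funM => //; exact: mk.
  - apply: (negligibleS _ ae_eq) => q /= h1 h2; apply: h1 => aq; have [d1 d2] := dE q.
    by rewrite ReMC d1 d2 (h2 aq) /=; field.
have ImE : \int[mu]_(q in @toC R @^-1` U) complex.Im (Phi (toC q) * dzbar (tensor f g) (toC q)) =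
   2^-1 * \int[mu]_(w in sq p a) (P w * (f w.1 * derive1 g w.2) + N w * (derive1 f w.1 * g w.2)).
  rewrite (Rintegral_restrict aU); last first.
    by move=> q _ /dz0[d1 d2]; rewrite ImMC d1 d2 !mulr0 addr0.
  rewrite -(sq_integralZ (sq_integrableD (bk _ _ mP bP c2) (bk _ _ mN bN c1))).
  apply: sq_ae_eq.
  - apply: (@eq_measurable_fun _ _ _ _ _ (fun q => complex.Re (Phi (toC q)) * (f q.1 * derive1 g q.2 / 2) +
      complex.Im (Phi (toC q)) * (derive1 f q.1 * g q.2 / 2) : mR)).
      by move=> q _; rewrite /= ImMC; have [-> ->] := dE q.
    by apply: measurable_funD; apply: measurable_funM => //; apply: mk; apply: cont_onM => //; exact: cont_on_cst.
  - apply: measurable_funM; first exact: measurable_cst.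
    by apply: measurable_funD; apply: measurable_funM => //; exact: mk.
  - apply: (negligibleS _ ae_eq) => q /= h1 h2; apply: h1 => aq; have [d1 d2] := dE q.
    by rewrite ImMC d1 d2 (h2 aq) /=; field.
rewrite ReE in R0; rewrite ImE in I0; split.
  by move: R0; rewrite pmulr_rle0// invr_gt0.
by apply/eqP; move/eqP: I0; rewrite mulf_eq0 invr_eq0 pnatr_eq0.
Qed.
End weak_formulation.

(** * Maxima, ties and test functions on the neighbourhood *)

Section assembly.
Variable R : realType.
Local Open Scope complex_scope.
Local Notation C := (R[i]).
Local Notation mR := (measurableTypeR R).
Local Notation R2 := (mR * mR)%type.
Local Notation mu := (@lam2 R).
Implicit Types (z : C) (q p w : R * R).

Lemma maxfam_ge r (h : 'I_r -> R) i : h i <= maxfam h.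
Proof. by case: r h i => [h []//|n h i]; exact: le_bigmax. Qed.

Lemma maxfam_eq r (h : 'I_r -> R) (j : 'I_r) : exists i, h i = maxfam h.
Proof.
case: r h j => [h []//|n h _].
apply: (big_ind (fun x => exists i, h i = x)); first by exists ord0.
  by move=> _ _ [i <-] [k <-]; case: (leP (h i) (h k)) => _; [exists k|exists i].
by move=> i _; exists i.
Qed.

Lemma maxfam_empty r (h : 'I_r -> R) : (forall j : 'I_r, False) -> maxfam h = 0.
Proof. by case: r h => // n h /(_ ord0). Qed.

(* A point of [M] where two branches tie is a local minimum of their difference. *)
Lemma tie_partials p (d : R) (M : set (R * R)) (h1 h2 x1 x2 y1 y2 : R * R -> R) : 0 < d -> open M ->
  dx_on (sq p d) h1 x1 -> dx_on (sq p d) h2 x2 -> dy_on (sq p d) h1 y1 -> dy_on (sq p d) h2 y2 ->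
  (forall q, M q -> sq p d q -> h1 q <= h2 q) ->
  forall q, M q -> sq p (d / 2) q -> h1 q = h2 q -> x1 q = x2 q /\ y1 q = y2 q.
Proof.
move=> d0 oM hx1 hx2 hy1 hy2 le q Mq qd E; have [t t0 tM] := open_sq oM Mq.
pose s := Num.min t (d / 2).
have s0 : 0 < s by rewrite lt_min t0 divr_gt0.
have sM : sq q s `<=` M by apply: subset_trans tM; apply: sq_le; rewrite /s ge_min lexx.
have sd : sq q s `<=` sq p d.
  apply: (@subset_trans _ (sq q (d / 2))); first by apply: sq_le; rewrite /s ge_min lexx orbT.
  by apply: sq_sub; have -> : d - d / 2 = d / 2 by lra.
have core (f1 f2 : R -> R) (c e1 e2 : R) : (forall u, `|u - c| < s -> derivable (fun u => f2 u - f1 u) u 1) ->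
    is_derive c 1 f1 e1 -> is_derive c 1 f2 e2 -> f1 c = f2 c ->
    (forall u, `|u - c| < s -> f1 u <= f2 u) -> e1 = e2.
  move=> df d1 d2 Ec lef.
  have itv u : (u \in `]c - s, c + s[%R) = (`|u - c| < s) by rewrite in_itv /= ltr_distl.
  have [||||_] := @derive1_at_min R (fun u => f2 u - f1 u) (c - s) (c + s) c.
  - lra.
  - by move=> u; rewrite itv; exact: df.
  - by rewrite itv subrr normr0.
  - by move=> u; rewrite itv => /lef; rewrite Ec subrr subr_ge0.
  have [_ ->] := is_deriveBp d2 d1.
  by move=> /eqP; rewrite subr_eq0 => /eqP.
have in1 u : `|u - q.1| < s -> sq q s (u, q.2) by move=> h; split; rewrite /= ?subrr ?normr0 ltW.
have in2 u : `|u - q.2| < s -> sq q s (q.1, u) by move=> h; split; rewrite /= ?subrr ?normr0 ltW.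
have qq : sq p d q by apply: sd; split; rewrite subrr normr0 ltW.
split.
  apply: (core (fun u => h1 (u, q.2)) (fun u => h2 (u, q.2)) q.1); rewrite -?surjective_pairing//.
  - move=> u /in1/sd us; exact: (@ex_derive _ _ _ _ _ _ _ (is_deriveBp (hx2 _ us) (hx1 _ us))).
  - exact: hx1.
  - exact: hx2.
  - by move=> u /in1 us; apply: le; [exact: sM|exact: sd].
apply: (core (fun u => h1 (q.1, u)) (fun u => h2 (q.1, u)) q.2); rewrite -?surjective_pairing//.
- move=> u /in2/sd us; exact: (@ex_derive _ _ _ _ _ _ _ (is_deriveBp (hy2 _ us) (hy1 _ us))).
- exact: hy1.
- exact: hy2.
- by move=> u /in2 us; apply: le; [exact: sM|exact: sd].
Qed.

(** Turns condition (ii), that no real multiple is attained, into a nonzero cross product. The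
    witness is the coefficient of the orthogonal projection onto y. *)
Lemma collinear_real (x1 x2 y1 y2 : R) : 0 < y1 ^+ 2 + y2 ^+ 2 -> x1 * y2 - x2 * y1 = 0 ->
  exists t, x1 = t * y1 /\ x2 = t * y2.
Proof.
move=> y0 cr; exists ((x1 * y1 + x2 * y2) / (y1 ^+ 2 + y2 ^+ 2)).
have yn : y1 ^+ 2 + y2 ^+ 2 != 0 by rewrite gt_eqF.
split; apply: (mulIf yn); rewrite mulrAC divfK//.
  have -> : x1 * (y1 ^+ 2 + y2 ^+ 2) = (x1 * y1 + x2 * y2) * y1 + (x1 * y2 - x2 * y1) * y2 by ring.
  by rewrite cr mul0r addr0.
have -> : x2 * (y1 ^+ 2 + y2 ^+ 2) = (x1 * y1 + x2 * y2) * y2 - (x1 * y2 - x2 * y1) * y1 by ring.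
by rewrite cr mul0r subr0.
Qed.

Lemma sqnorm_gt0 (x y : C) : x != y ->
  0 < (complex.Re x - complex.Re y) ^+ 2 + (complex.Im x - complex.Im y) ^+ 2.
Proof.
case: x => x1 x2; case: y => y1 y2; rewrite eq_complex /= => ne.
rewrite lt_neqAle addr_ge0 ?sqr_ge0// andbT eq_sym paddr_eq0 ?sqr_ge0// !sqrf_eq0 !subr_eq0.
exact: ne.
Qed.

(** The neighbourhood has to be open, whereas the calculus is done on closed squares; integrals
    against a test function supported in the open square agree on both. *)
Definition osq (p : R * R) (a : R) : set C :=
  [set z | `|complex.Re z - p.1| < a /\ `|complex.Im z - p.2| < a].

Lemma open_osq p (a : R) : open (osq p a).
Proof.
rewrite openE => z [z1 z2]; apply/nbhsC.
exists (Num.min (a - `|complex.Re z - p.1|) (a - `|complex.Im z - p.2|)).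
  by rewrite lt_min !subr_gt0 z1.
move=> w; rewrite !lt_min => /andP[w1 _] /andP[_ w2]; split.
  by have := ler_normD (complex.Re w - complex.Re z) (complex.Re z - p.1); rewrite addrA subrK; lra.
by have := ler_normD (complex.Im w - complex.Im z) (complex.Im z - p.2); rewrite addrA subrK; lra.
Qed.

Lemma off_support (psi : C -> R) z : ~ Defs.support psi z -> [/\ psi z = 0, pdx psi z = 0 & pdy psi z = 0].
Proof.
move=> nz.
have oS : open (~` Defs.support psi) by apply: closed_openC; exact: closed_closure.
have off (w : C) : (~` Defs.support psi) w -> psi w = 0.
  by move=> nw; apply: contrapT => /eqP h; apply: nw; exact: subset_closure.
have [d d0 hd] := (nbhsC z (~` Defs.support psi)).1 (open_nbhs_nbhs (conj oS nz)).
have near0 (k : R -> C) : (forall t, `|t| < d -> `|complex.Re (k t) - complex.Re z| < d /\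
    `|complex.Im (k t) - complex.Im z| < d) -> derive1 (fun t => psi (k t)) 0 = 0.
  move=> hk; rewrite derive1E.
  have hn : \forall t \near (0 : R), 0 = psi (k t).
    near=> t; have [k1 k2] : `|complex.Re (k t) - complex.Re z| < d /\ `|complex.Im (k t) - complex.Im z| < d.
      apply: hk; near: t; apply/nbhs_ballP; exists d => // t; rewrite /ball /= sub0r normrN.
      exact.
    exact: (esym (off _ (hd _ k1 k2))).
  by rewrite -(near_eq_derive (1 : R) hn); exact: derive_cst.
split; first exact: off.
  apply: near0 => t td.
  have -> : complex.Re (z + t%:C) = complex.Re z + t by case: (z).
  have -> : complex.Im (z + t%:C) = complex.Im z by case: (z) => ? ? /=; rewrite addr0.
  by rewrite [_ + t]addrC addrK subrr normr0.
apply: near0 => t td.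
have -> : complex.Re (z + Complex 0 t) = complex.Re z by case: (z) => ? ? /=; rewrite addr0.
have -> : complex.Im (z + Complex 0 t) = complex.Im z + t by case: (z).
by rewrite [_ + t]addrC addrK subrr normr0.
Unshelve. all: end_near. Qed.

Lemma Cn1_partials (psi : C -> R) : Cn 1 psi -> forall (D : set (R * R)),
  [/\ cont_on D (fun q => psi (toC q)), cont_on D (fun q => pdx psi (toC q)),
      cont_on D (fun q => pdy psi (toC q)),
      dx_on D (fun q => psi (toC q)) (fun q => pdx psi (toC q)) &
      dy_on D (fun q => psi (toC q)) (fun q => pdy psi (toC q))].
Proof.
move=> [c [d [[cx _] [cy _]]]] D.
have shift0 (f : R -> R) (x l : R) : is_derive (0 : R) 1 (fun t => f (x + t)) l -> is_derive x 1 f l.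
  move=> h; have h2 : is_derive x 1 (fun t : R => t - x) 1.
    by apply: is_derive_eq (is_deriveBp (is_derive_id x 1) (is_derive_cst x x 1)) _; rewrite subr0.
  have h3 : is_derive (x - x) 1 (fun t => f (x + t)) l by rewrite subrr.
  have := @is_derive_compp _ (fun t => f (x + t)) (fun t => t - x) x _ _ h3 h2; rewrite mulr1.
  by congr (is_derive _ _ _ _); apply/funext => t; rewrite addrC subrK.
split.
- by apply: cont_on_toC => q _; exact: c.
- by apply: cont_on_toC => q _; exact: cx.
- by apply: cont_on_toC => q _; exact: cy.
- move=> q _; have [dd _] := d (toC q).
  have X : is_derive (0 : R) 1 (fun t : R => psi (toC (q.1 + t, q.2))) (pdx psi (toC q)).
    have -> : (fun t : R => psi (toC (q.1 + t, q.2))) = (fun t => psi (toC q + t%:C)).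
      by apply/funext => t; rewrite /toC; congr psi; simpc.
    by apply: DeriveDef => //; rewrite /pdx derive1E.
  exact: (shift0 (fun t => psi (toC (t, q.2))) _ _ X).
- move=> q _; have [_ dd] := d (toC q).
  have X : is_derive (0 : R) 1 (fun t : R => psi (toC (q.1, q.2 + t))) (pdy psi (toC q)).
    have -> : (fun t : R => psi (toC (q.1, q.2 + t))) = (fun t => psi (toC q + Complex 0 t)).
      by apply/funext => t; rewrite /toC; congr psi; simpc.
    by apply: DeriveDef => //; rewrite /pdy derive1E.
  exact: (shift0 (fun t => psi (toC (q.1, t))) _ _ X).
Qed.
End assembly.

(** * The piecewise representative and the distributional identity *)

Section piecewise_data.
Variable R : realType.
Local Open Scope complex_scope.
Local Notation C := (R[i]).
Local Notation mR := (measurableTypeR R).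
Local Notation R2 := (mR * mR)%type.
Local Notation mu := (@lam2 R).

Section piecewise.
Variables (r : nat) (M : 'I_r -> set C) (A : 'I_r -> C -> C).

(** A representative of [Phi] with a definite value at every point, so that statements on the pieces
    hold without exceptional sets. *)
Definition pw (z : C) : C := \sum_(i < r) A i z * \1_(M i) z.

Lemma pw_in i z : (forall i j, i != j -> M i `&` M j = set0) -> M i z -> pw z = A i z.
Proof.
move=> disj Mz; rewrite /pw (bigD1 i)//= big1 ?addr0.
  by rewrite indicE mem_set// mulr1.
move=> j ji; rewrite indicE memNset ?mulr0// => Mjz.
by have := disj _ _ ji; rewrite -subset0 => /(_ z); apply.
Qed.

Lemma pw_out z : ~ (\bigcup_i M i) z -> pw z = 0.
Proof.
move=> nM; rewrite /pw big1// => i _; rewrite indicE memNset ?mulr0// => Mz.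
by apply: nM; exists i.
Qed.

Lemma pw_measurable (D : set R2) : measurable D -> (forall i, open (M i)) ->
  (forall i, cont_on D (fun q => complex.Re (A i (toC q)))) ->
  (forall i, cont_on D (fun q => complex.Im (A i (toC q)))) ->
  measurable_fun D (fun q => complex.Re (pw (toC q)) : mR) /\
  measurable_fun D (fun q => complex.Im (pw (toC q)) : mR).
Proof.
move=> mD oM cr ci.
have mM i : measurable (@toC R @^-1` (M i) : set R2).
  by apply: open_measurable_plane; exact: open_toC.
have E (z : C) i : A i z * \1_(M i) z = toC (complex.Re (A i z) * \1_(M i) z, complex.Im (A i z) * \1_(M i) z).
  by rewrite !indicE; case: (z \in M i); rewrite ?mulr1 ?mulr0 ?toC_ReIm.
have iE i (q : R2) : (\1_(M i) (toC q) : R) = \1_(@toC R @^-1` (M i)) q.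
  by rewrite !indicE; congr (_%:R); congr nat_of_bool; apply/idP/idP => /set_mem h; exact: mem_set.
split.
  rewrite (_ : (fun q => _) = fun q : R2 => \sum_(i < r) complex.Re (A i (toC q)) * \1_(@toC R @^-1` (M i)) q); last first.
    by apply/funext => q; rewrite /pw raddf_sum; apply: eq_bigr => i _; rewrite E /= iE.
  apply: measurable_sum => i; apply: measurable_funM; first exact: measurable_cont_on.
  exact: measurable_indic.
rewrite (_ : (fun q => _) = fun q : R2 => \sum_(i < r) complex.Im (A i (toC q)) * \1_(@toC R @^-1` (M i)) q); last first.
  by apply/funext => q; rewrite /pw raddf_sum; apply: eq_bigr => i _; rewrite E /= iE.
apply: measurable_sum => i; apply: measurable_funM; first exact: measurable_cont_on.
exact: measurable_indic.
Qed.

End piecewise.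

(** Twice the z-derivative of [phi] is phi_x - i phi_y, so the identity splits into phi_x = [P] and
    phi_y = -[N] in the weak sense. *)
Lemma weak_cint (p : R * R) (a K : R) (U : set R[i]) (Phi : R[i] -> R[i])
    (phi psi : R[i] -> R) (P N : R * R -> R) : 0 < a ->
  loc_integrable U Phi -> sq p a `<=` @toC R @^-1` U ->
  bmeas p a P K -> bmeas p a N K -> cont_on (sq p a) (fun q => phi (toC q)) ->
  {ae mu, forall q, sq p a q -> Phi (toC q) = toC (P q, N q)} ->
  test_fun (osq p a) psi ->
  \int[mu]_(q in sq p a) (P q * psi (toC q) + phi (toC q) * pdx psi (toC q)) = 0 ->
  \int[mu]_(q in sq p a) (- N q * psi (toC q) + phi (toC q) * pdy psi (toC q)) = 0 ->
  cint (osq p a) (fun z => Phi z * (psi z)%:C) =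
  - 2%:R * cint (osq p a) (fun z => (phi z)%:C * dz psi z).
Proof.
move=> a0 li aU [mP bP] [mN bN] cphi ae_eq [sm [_ supp]] wx wy.
have [cps cpx cpy _ _] := Cn1_partials (sm 1) (sq p a).
have [mRe mIm] := loc_integrable_sq li aU.
have off q : ~ osq p a (toC q) -> [/\ psi (toC q) = 0, pdx psi (toC q) = 0 & pdy psi (toC q) = 0].
  by move=> nq; apply: off_support => /supp.
have mk (h : R * R -> R) : cont_on (sq p a) h -> measurable_fun (sq p a : set R2) (h : _ -> mR).
  by move=> ch; apply: measurable_cont_on => //; exact: measurable_sq.
have bk (Q1 h : R * R -> R) : measurable_fun (sq p a : set R2) (Q1 : _ -> mR) ->
    (forall q, sq p a q -> `|Q1 q| <= K) -> cont_on (sq p a) h ->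
    mu.-integrable (sq p a) (EFin \o (fun w => Q1 w * h w)).
  move=> mQ bQ ch; have [L L0 hL] := cont_on_bounded ch.
  apply: (@sq_integrable _ _ _ _ (K * L)); first by apply: measurable_funM => //; exact: mk.
  by move=> w aw; rewrite normrM; apply: ler_pM => //; [exact: bQ|exact: hL].
have mN' : measurable_fun (sq p a : set R2) ((fun q => - N q) : _ -> mR).
  exact: measurableT_comp.
have bN' q : sq p a q -> `|- N q| <= K by rewrite normrN; exact: bN.
have oS : @toC R @^-1` osq p a `<=` sq p a by move=> q [q1 q2]; split; exact: ltW.
have res (f : R * R -> R) : (forall q, ~ osq p a (toC q) -> f q = 0) ->
    \int[mu]_(q in @toC R @^-1` osq p a) f q = \int[mu]_(q in sq p a) f q.
  by move=> f0; apply: esym; apply: Rintegral_restrict oS _ => q _; exact: f0.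
have rep (f g : R * R -> R) : measurable_fun (sq p a : set R2) (f : _ -> mR) ->
    measurable_fun (sq p a : set R2) (g : _ -> mR) ->
    {ae mu, forall q, sq p a q -> f q = g q} ->
    \int[mu]_(q in sq p a) (f q * psi (toC q)) = \int[mu]_(q in sq p a) (g q * psi (toC q)).
  move=> mf mg fg; apply: sq_ae_eq.
  - by apply: measurable_funM => //; exact: mk.
  - by apply: measurable_funM => //; exact: mk.
  - by apply: (negligibleS _ fg) => q /= h1 h2; apply: h1 => aq; rewrite h2.
have x1 : \int[mu]_(q in @toC R @^-1` osq p a) complex.Re (Phi (toC q) * (psi (toC q))%:C) =
    \int[mu]_(q in sq p a) (P q * psi (toC q)).
  rewrite res; last by move=> q /off[-> _ _]; rewrite mulr0.
  rewrite -(rep (fun q => complex.Re (Phi (toC q))))//.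
    by apply: eq_Rintegral => q _; rewrite ReMC /= mulr0 subr0.
  by apply: (negligibleS _ ae_eq) => q /= h1 h2; apply: h1 => aq; rewrite h2.
have y1 : \int[mu]_(q in @toC R @^-1` osq p a) complex.Im (Phi (toC q) * (psi (toC q))%:C) =
    \int[mu]_(q in sq p a) (N q * psi (toC q)).
  rewrite res; last by move=> q /off[-> _ _]; rewrite mulr0.
  rewrite -(rep (fun q => complex.Im (Phi (toC q))))//.
    by apply: eq_Rintegral => q _; rewrite ImMC /= mulr0 add0r.
  by apply: (negligibleS _ ae_eq) => q /= h1 h2; apply: h1 => aq; rewrite h2.
have ix := cont_on_integrable (cont_onM cphi cpx); have iy := cont_on_integrable (cont_onM cphi cpy).
have x2 : \int[mu]_(q in @toC R @^-1` osq p a) complex.Re ((phi (toC q))%:C * dz psi (toC q)) =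
    2^-1 * \int[mu]_(q in sq p a) (phi (toC q) * pdx psi (toC q)).
  have dE q : complex.Re ((phi (toC q))%:C * dz psi (toC q)) = 2^-1 * (phi (toC q) * pdx psi (toC q)).
    by rewrite ReMC mul0r subr0; have [-> _] := dz_ReIm psi (toC q); rewrite /=; field.
  rewrite res; last by move=> q /off[_ e _]; rewrite dE e !mulr0.
  by rewrite -(sq_integralZ ix); apply: eq_Rintegral => q _; exact: dE.
have y2 : \int[mu]_(q in @toC R @^-1` osq p a) complex.Im ((phi (toC q))%:C * dz psi (toC q)) =
    - 2^-1 * \int[mu]_(q in sq p a) (phi (toC q) * pdy psi (toC q)).
  have dE q : complex.Im ((phi (toC q))%:C * dz psi (toC q)) = - 2^-1 * (phi (toC q) * pdy psi (toC q)).
    by rewrite ImMC mul0r addr0; have [_ ->] := dz_ReIm psi (toC q); rewrite /=; field.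
  rewrite res; last by move=> q /off[_ _ e]; rewrite dE e !mulr0.
  by rewrite -(sq_integralZ iy); apply: eq_Rintegral => q _; exact: dE.
rewrite !cintE x1 y1 x2 y2.
have ex : \int[mu]_(q in sq p a) (P q * psi (toC q)) =
    - \int[mu]_(q in sq p a) (phi (toC q) * pdx psi (toC q)).
  apply/eqP; rewrite -addr_eq0; apply/eqP; apply: etrans wx.
  by rewrite -(sq_integralD (bk _ _ mP bP cps) ix).
have ey : \int[mu]_(q in sq p a) (N q * psi (toC q)) =
    \int[mu]_(q in sq p a) (phi (toC q) * pdy psi (toC q)).
  apply/eqP; rewrite -subr_eq0 -oppr_eq0 opprB addrC; apply/eqP; apply: etrans wy.
  apply: etrans (esym (sq_integralD (bk _ _ mN' bN' cps) iy)); congr (_ + _).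
  rewrite -mulN1r -(sq_integralZ (bk _ _ mN bN cps)).
  by apply: eq_Rintegral => q _; rewrite mulN1r mulNr.
rewrite ex ey; set X := \int[_]_(q in _) _; set Y := \int[_]_(q in _) _.
have -> : - 2%:R = (- 2)%:C :> R[i] by rewrite rmorphN rmorph_nat.
by apply/eqP; rewrite eq_complex ReMC ImMC /=; apply/andP; split; apply/eqP; field.
Qed.
End piecewise_data.

Local Open Scope complex_scope.

Theorem theorem1 (R : realType) (U : set R[i]) (Phi : R[i] -> R[i]) (r : nat)
    (M : 'I_r -> set R[i]) (A : 'I_r -> R[i] -> R[i]) (p : R[i]) :
  domain U -> simply_connected U ->
  piecewise_analytic U Phi M A ->
  in_Sigma U Phi ->
  U p ->
  (forall i, closure (M i) p) ->
  (forall i j k : 'I_r, i != j -> j != k -> i != k ->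
     forall t : R, A i p - A k p != t%:C * (A j p - A k p)) ->
  (forall i k : 'I_r, i != k -> A i p != A k p) ->
  (* F_i(z) = \int_p^z A_i(w) dw : the primitive of A_i on U vanishing at p *)
  forall F : 'I_r -> R[i] -> R[i],
    (forall i (z : R[i]), U z -> is_derive z 1 (F i) (A i z)) ->
    (forall i, F i p = 0) ->
  exists N : set R[i], open N /\ N p /\ N `<=` U /\
    (* Phi = 2 d(phi)/dz in the sense of distributions on N, where
       phi = max_i H_i and H_i = Re F_i *)
    forall psi : R[i] -> R, test_fun N psi ->
      cint N (fun z => Phi z * (psi z)%:C) =
      - 2%:R * cint N (fun z => (phimax (fun i w => complex.Re (F i w)) z)%:C
                                 * dz psi z).
Proof.
move=> [oU _] _ [li [oMU [disj [negl [anA [_ ae_eq]]]]]] inS Up clM cross ne F dF F0.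
pose p2 := (complex.Re p, complex.Im p).
have p2E : toC p2 = p by exact: toC_ReIm.
have Up2 : (@toC R @^-1` U) p2 by rewrite /= p2E.
have [a1 a10 a1U] := open_sq (open_toC oU) Up2.
pose al i q := complex.Re (A i (toC q)); pose be i q := complex.Im (A i (toC q)).
pose H i q := complex.Re (F i (toC q)); pose G i q := complex.Im (F i (toC q)).
pose M' i := @toC R @^-1` (M i).
pose P q := complex.Re (pw M A (toC q)); pose N q := complex.Im (pw M A (toC q)).
have oM i : open (M i) by have [] := oMU i.
have oM' i : open (M' i) by exact: open_toC.
have dF' i q : sq p2 a1 q -> _ := fun h => partials (dF i (toC q) (a1U q h)).
have comp_cont (f : R[i] -> R[i]) (k : R[i] -> R) : continuous k ->
    (forall q, sq p2 a1 q -> {for toC q, continuous f}) -> cont_on (sq p2 a1) (fun q => k (f (toC q))).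
  move=> ck cf; apply: (cont_on_toC (f := fun z => k (f z))) => q aq.
  by apply: (@continuous_comp _ _ _ f k); [exact: cf|exact: ck].
have cA i q : sq p2 a1 q -> {for toC q, continuous (A i)}.
  by move=> aq; apply: derivable_continuousC; apply: anA; exact: a1U.
have cF i q : sq p2 a1 q -> {for toC q, continuous (F i)}.
  by move=> aq; apply: derivable_continuousC; apply: ex_derive; apply: dF; exact: a1U.
have cal i : cont_on (sq p2 a1) (al i) by exact: comp_cont (@Re_continuous R) (cA i).
have cbe i : cont_on (sq p2 a1) (be i) by exact: comp_cont (@Im_continuous R) (cA i).
have cH i : cont_on (sq p2 a1) (H i) by exact: comp_cont (@Re_continuous R) (cF i).
have cG i : cont_on (sq p2 a1) (G i) by exact: comp_cont (@Im_continuous R) (cF i).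
have Hx i : dx_on (sq p2 a1) (H i) (al i) by move=> q aq; have [] := dF' i q aq.
have Hy i : dy_on (sq p2 a1) (H i) (fun q => - be i q) by move=> q aq; have [] := dF' i q aq.
have Gx i : dx_on (sq p2 a1) (G i) (be i) by move=> q aq; have [] := dF' i q aq.
have Gy i : dy_on (sq p2 a1) (G i) (al i) by move=> q aq; have [] := dF' i q aq.
have [mP mN] := pw_measurable (measurable_sq p2 a1) oM cal cbe.
have PNM i q : M' i q -> P q = al i q /\ N q = be i q.
  by move=> Mq; rewrite /P /N (pw_in A disj Mq).
have PN0 q : ~ (\bigcup_i M' i) q -> P q = 0 /\ N q = 0.
  by move=> nq; rewrite /P /N pw_out// => -[i _ Mi]; apply: nq; exists i.
have cov : (@lam2 R).-negligible (sq p2 a1 `\` \bigcup_i M' i).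
  by apply: negligibleS negl => q [aq nq]; split; [exact: a1U|move=> [i _ Mi]; apply: nq; exists i].
have [K K0 abK] : exists2 K : R, 0 < K & forall i q, sq p2 a1 q -> `|al i q| <= K /\ `|be i q| <= K.
  have [K1 K10 hK1] := cont_on_bounded_fin cal; have [K2 K20 hK2] := cont_on_bounded_fin cbe.
  exists (K1 + K2); first exact: addr_gt0.
  by move=> i q aq; split; [apply: le_trans (hK1 i q aq) _|apply: le_trans (hK2 i q aq) _]; rewrite ?lerDl ?lerDr ltW.
have bPN a : a <= a1 -> bmeas p2 a P K /\ bmeas p2 a N K.
  move=> aa1; have aS : sq p2 a `<=` sq p2 a1 by exact: sq_le.
  have bd q : sq p2 a q -> `|P q| <= K /\ `|N q| <= K.
    move=> /aS aq; have [[i _ Mq]|nM] := pselect ((\bigcup_i M' i) q).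
      by have [-> ->] := PNM i q Mq; exact: abK.
    by have [-> ->] := PN0 _ nM; rewrite normr0 ltW.
  split; split.
  - exact: (measurable_funS (measurable_sq p2 a1) aS mP).
  - by move=> q /bd[].
  - exact: (measurable_funS (measurable_sq p2 a1) aS mN).
  - by move=> q /bd[].
have aePN a : a <= a1 -> {ae @lam2 R, forall q, sq p2 a q -> Phi (toC q) = toC (P q, N q)}.
  move=> aa1; apply: (negligibleS _ ae_eq) => q /= h1 h2; apply: h1 => aq.
  by rewrite h2; [rewrite toC_ReIm|apply: a1U; exact: sq_le aq].
have [d /andP[d0 da1] order] : exists2 d : R, 0 < d <= a1 & forall i j q, M' j q -> sq p2 d q -> H i q <= H j q.
  apply: (@piecewise_max R r p2 a1 M' al be H G P N) => //.
  - by move=> i; exact: closure_toC.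
  - by move=> i j ij; rewrite /al /be p2E; apply: sqnorm_gt0; exact: ne.
  - move=> i j k ij jk ik; rewrite /al /be p2E; apply/eqP => cr.
    have jk0 := sqnorm_gt0 (ne _ _ jk).
    have [t [t1 t2]] := collinear_real jk0 cr.
    have /eqP := cross i j k ij jk ik t; apply.
    by apply/eqP; rewrite eq_complex ReMC ImMC /= !raddfB /= t1 t2 !mul0r subr0 addr0 !eqxx.
  - by move=> i; rewrite /H p2E F0.
  - move=> a a0 aa1; have [bP bN] := bPN a aa1.
    have aU : sq p2 a `<=` @toC R @^-1` U by apply: subset_trans a1U; exact: sq_le.
    exact: (in_Sigma_weak li inS aU bP bN (aePN a aa1)).
(* Halving leaves room around each point for the local minimum argument of [tie_partials], which
   uses the order on the larger square. *)
pose a := d / 2.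
have a0 : 0 < a by rewrite divr_gt0.
have ad : a <= d by rewrite ler_pdivrMr// ler_peMr ?ler1n// ltW.
have aa1 : a <= a1 by exact: le_trans da1.
have aS : sq p2 a `<=` sq p2 a1 by exact: sq_le.
have dS : sq p2 d `<=` sq p2 a1 by exact: sq_le.
have aU : sq p2 a `<=` @toC R @^-1` U by exact: subset_trans a1U.
have [bP bN] := bPN a aa1.
exists (osq p2 a); split; first exact: open_osq.
split; first by split; rewrite subrr normr0.
split; first by move=> z [z1 z2]; rewrite -[z]toC_ReIm; apply: aU; split; exact: ltW.
move=> psi tpsi; pose phi := phimax (fun i w => complex.Re (F i w)).
have [sm [_ supp]] := tpsi.
have [cps cpx cpy dpx dpy] := Cn1_partials (sm 1) (sq p2 a).
have bdry q : sq p2 a q -> `|q.1 - p2.1| = a \/ `|q.2 - p2.2| = a -> psi (toC q) = 0.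
  move=> aq b; have [//|] := @off_support _ psi (toC q); last by move=> ->.
  by move=> /supp[]; case: b => /= ->; rewrite ltxx.
have phi_ge i q : H i q <= phi (toC q) by exact: (maxfam_ge (fun i => H i q)).
have cH' i : cont_on (sq p2 a) (H i) by move=> q /aS; exact: cH.
suff [cphi [wx wy]] : cont_on (sq p2 a) (fun q => phi (toC q)) /\
    \int[@lam2 R]_(q in sq p2 a) (P q * psi (toC q) + phi (toC q) * pdx psi (toC q)) = 0 /\
    \int[@lam2 R]_(q in sq p2 a) (- N q * psi (toC q) + phi (toC q) * pdy psi (toC q)) = 0.
  exact: (weak_cint a0 li aU bP bN cphi (aePN a aa1) tpsi wx wy).
(* For r = 0 the maximum has the default value 0 and the representative is the empty sum, so both
   integrands vanish. *)
have [[j0 _]|no] := pselect (exists j : 'I_r, True); last first.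
  have no' (j : 'I_r) : False by apply: no; exists j.
  have phi0 z : phi z = 0 by exact: maxfam_empty.
  have PN0' q : P q = 0 /\ N q = 0 by apply: PN0 => -[k _ _]; case: (no' k).
  split; first by under eq_fun do rewrite phi0; exact: cont_on_cst.
  by split; rewrite /Rintegral integral0_eq//= => q _; have [Pq Nq] := PN0' q;
    rewrite ?Pq ?Nq phi0 ?oppr0 !mul0r addr0.
have phi_eq q : exists i, H i q = phi (toC q) by exact: (maxfam_eq (fun i => H i q)).
(* Off the uncovered null set, the branch of the piece containing the point attains the maximum, and
   all branches tied with it have the same gradient. *)
have PZ q : sq p2 a q -> ~ (sq p2 a1 `\` \bigcup_i M' i) q -> exists j,
    [/\ P q = al j q, N q = be j q, forall i, H i q <= H j q &
        forall i, H i q = H j q -> al i q = al j q /\ - be i q = - be j q].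
  move=> aq nq; have [j _ Mq] : (\bigcup_i M' i) q.
    by apply: contrapT => nM; apply: nq; split => //; exact: aS.
  have [Pq Nq] := PNM j q Mq; exists j; split => //.
    by move=> i; apply: order => //; exact: sq_le aq.
  move=> i tie.
  exact: (tie_partials d0 (oM' j) (fun q dq => Hx i q (dS q dq)) (fun q dq => Hx j q (dS q dq))
    (fun q dq => Hy i q (dS q dq)) (fun q dq => Hy j q (dS q dq)) (order i j) Mq aq tie).
have cphi := phi_cont cH' phi_ge phi_eq.
split => //; split.
- apply: (@max_weak_dx R r p2 a H (fun q => phi (toC q)) (fun q => psi (toC q)) j0 a0 cH' cps phi_ge phi_eq
    al P (fun q => pdx psi (toC q)) K _ _ cpx bP cov) => //.
  + by move=> i q /aS; exact: cal.
  + by move=> q aq nq; have [j [? _ ? tie]] := PZ q aq nq; exists j; split => // i /tie[].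
  + by move=> i q /aS; exact: Hx.
  + by move=> q aq b; apply: bdry => //; left.
- have bN' : bmeas p2 a (fun q => - N q) K.
    by case: bN => mN' hN; split; [exact: measurableT_comp|move=> q; rewrite normrN; exact: hN].
  apply: (@max_weak_dy R r p2 a H (fun q => phi (toC q)) (fun q => psi (toC q)) j0 a0 cH' cps phi_ge phi_eq
    (fun i q => - be i q) (fun q => - N q) (fun q => pdy psi (toC q)) K _ _ cpy bN' cov) => //.
  + by move=> i q /aS aq; apply: cvgN; exact: cbe.
  + by move=> q aq nq; have [j [_ Nq ? tie]] := PZ q aq nq; exists j; split => //; [rewrite Nq|move=> i /tie[]].
  + by move=> i q /aS; exact: Hy.
  + by move=> q aq b; apply: bdry => //; right.
Qed.
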